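(* Fix a prime $p$. For every finite extension $K$ of $\mathbb{Q}_p$ fix an arbitrary cross-section $s_K:\Gamma_K\to K^\times$, and regard $K$ as an $L_{\mathrm{val},\times}$-structure. Then the asymptotic $\exists\forall$-theory of the class $\{K : [K:\mathbb{Q}_p]<\infty\}$ in $L_{\mathrm{val},\times}$ is undecidable. In particular, the full asymptotic $L_{\mathrm{val},\times}$-theory of this class is undecidable.
   Context: $L_{\mathrm{val}}$ is the three-sorted language of valued fields. The field sort $\mathbf{K}$ carries the ring language $\{0,1,+,\cdot\}$. The value group sort $\mathbf{\Gamma}$ carries $\{0,+,<\}$ together with a constant $\infty$. The residue field sort $\mathbf{k}$ carries the ring language. There are function symbols $v:\mathbf{K}\to\mathbf{\Gamma}$ (the valuation) and $\mathrm{res}:\mathbf{K}\to\mathbf{k}$ (the residue map, with $\mathrm{res}(x)=0$ when $v(x)<0$). $L_{\mathrm{val},\times}$ is $L_{\mathrm{val}}$ expanded by a function symbol $s:\mathbf{\Gamma}\to\mathbf{K}$ interpreted as a cross-section: a group homomorphism $s:\Gamma\to K^\times$ with $v\circ s=\mathrm{id}_\Gamma$, extended by $s(\infty)=0$. For a finite extension $K/\mathbb{Q}_p$ the value group $\Gamma_K\cong\mathbb{Z}$; a cross-section exists and corresponds to a choice of uniformizer. The asymptotic theory of a class $\mathcal{C}$ of structures is the set of sentences true in all but finitely many members of $\mathcal{C}$. The asymptotic $\exists\forall$-theory is the set of such sentences of the form (block of existential quantifiers)(block of universal quantifiers)(quantifier-free). A set of sentences is decidable if membership (for sentences identified with natural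 numbers via a Gödel numbering) is decided by an algorithm; undecidable otherwise. *)

(* Defs.v *)
From HB Require Import structures.
From mathcomp Require Import all_boot all_order all_algebra.
Set Implicit Arguments. Unset Strict Implicit. Unset Printing Implicit Defensive.
Import Order.TTheory GRing.Theory Num.Theory.

Inductive mrec : Type :=
| MZero : mrec
| MSucc : mrec
| MProj : nat -> mrec
| MComp : mrec -> list mrec -> mrec
| MPrim : mrec -> mrec -> mrec
| MMu   : mrec -> mrec.

Inductive meval : mrec -> seq nat -> nat -> Prop :=
| ev_zero l : meval MZero l 0
| ev_succ x l : meval MSucc (x :: l) x.+1
| ev_proj i l : meval (MProj i) l (nth 0 l i)
| ev_comp f gs l ys y :
    meval_list gs l ys -> meval f ys y -> meval (MComp f gs) l y
| ev_prim0 f g l y : meval f l y -> meval (MPrim f g) (0 :: l) y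
| ev_primS f g n l r y :
    meval (MPrim f g) (n :: l) r -> meval g (n :: r :: l) y ->
    meval (MPrim f g) (n.+1 :: l) y
| ev_mu f l n :
    meval f (n :: l) 0 ->
    (forall m, m < n -> exists k, meval f (m :: l) k.+1) ->
    meval (MMu f) l n
with meval_list : list mrec -> seq nat -> seq nat -> Prop :=
| evl_nil l : meval_list nil l [::]
| evl_cons g gs l y ys :
    meval g l y -> meval_list gs l ys -> meval_list (g :: gs) l (y :: ys).

Definition decidable_nat (A : nat -> Prop) : Prop :=
  exists f : mrec, forall n : nat,
    (A n -> meval f [:: n] 1) /\ (~ A n -> meval f [:: n] 0).

Inductive sort := SK | SG | Sk.

Definition sort_eqb (s t : sort) : bool :=
  match s, t with SK, SK | SG, SG | Sk, Sk => true | _, _ => false end.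

Definition sort_code (s : sort) : nat :=
  match s with SK => 0 | SG => 1 | Sk => 2 end.

Inductive term : sort -> Type :=
| Var  (s : sort) (n : nat) : term s
| KZero : term SK
| KOne  : term SK
| KAdd  : term SK -> term SK -> term SK
| KMul  : term SK -> term SK -> term SK
| Sec   : term SG -> term SK
| GZero : term SG
| GInf  : term SG
| GAdd  : term SG -> term SG -> term SG
| Val   : term SK -> term SG
| RZero : term Sk
| ROne  : term Sk
| RAdd  : term Sk -> term Sk -> term Sk
| RMul  : term Sk -> term Sk -> term Sk
| Res   : term SK -> term Sk.

Inductive formula : Type :=
| FEq  (s : sort) : term s -> term s -> formula
| FLt  : term SG -> term SG -> formula
| FNeg : formula -> formula
| FAnd : formula -> formula -> formula
| FOr  : formula -> formula -> formula
| FImp : formula -> formula -> formula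
| FEx  : sort -> nat -> formula -> formula
| FAll : sort -> nat -> formula -> formula.

Fixpoint tfree (s : sort) (t : term s) (s' : sort) (m : nat) : bool :=
  match t with
  | Var s n => sort_eqb s s' && (n == m)
  | KZero | KOne | GZero | GInf | RZero | ROne => false
  | KAdd a b | KMul a b => tfree a s' m || tfree b s' m
  | GAdd a b => tfree a s' m || tfree b s' m
  | RAdd a b | RMul a b => tfree a s' m || tfree b s' m
  | Sec g => tfree g s' m
  | Val a => tfree a s' m
  | Res a => tfree a s' m
  end.

Fixpoint ffree (f : formula) (s' : sort) (m : nat) : bool :=
  match f with
  | FEq _ a b => tfree a s' m || tfree b s' m
  | FLt a b => tfree a s' m || tfree b s' m
  | FNeg g => ffree g s' m
  | FAnd g h | FOr g h | FImp g h => ffree g s' m || ffree h s' m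
  | FEx s n g | FAll s n g => ffree g s' m && ~~ (sort_eqb s s' && (n == m))
  end.

Definition sentence (f : formula) : Prop := forall s m, ffree f s m = false.

Fixpoint is_qf (f : formula) : bool :=
  match f with
  | FEq _ _ _ | FLt _ _ => true
  | FNeg g => is_qf g
  | FAnd g h | FOr g h | FImp g h => is_qf g && is_qf h
  | FEx _ _ _ | FAll _ _ _ => false
  end.

Fixpoint is_univ (f : formula) : bool :=
  match f with FAll _ _ g => is_univ g | _ => is_qf f end.

Fixpoint is_EA (f : formula) : bool :=
  match f with FEx _ _ g => is_EA g | _ => is_univ f end.

Definition cpair (a b : nat) : nat := (a + b) * (a + b).+1 %/ 2 + b.

Fixpoint tcode (s : sort) (t : term s) : nat :=
  match t with
  | Var s n => cpair 0 (cpair (sort_code s) n)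
  | KZero => cpair 1 0
  | KOne => cpair 2 0
  | KAdd a b => cpair 3 (cpair (tcode a) (tcode b))
  | KMul a b => cpair 4 (cpair (tcode a) (tcode b))
  | Sec g => cpair 5 (tcode g)
  | GZero => cpair 6 0
  | GInf => cpair 7 0
  | GAdd a b => cpair 8 (cpair (tcode a) (tcode b))
  | Val a => cpair 9 (tcode a)
  | RZero => cpair 10 0
  | ROne => cpair 11 0
  | RAdd a b => cpair 12 (cpair (tcode a) (tcode b))
  | RMul a b => cpair 13 (cpair (tcode a) (tcode b))
  | Res a => cpair 14 (tcode a)
  end.

Fixpoint fcode (f : formula) : nat :=
  match f with
  | FEq s a b => cpair 0 (cpair (sort_code s) (cpair (tcode a) (tcode b)))
  | FLt a b => cpair 1 (cpair (tcode a) (tcode b))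
  | FNeg g => cpair 2 (fcode g)
  | FAnd g h => cpair 3 (cpair (fcode g) (fcode h))
  | FOr g h => cpair 4 (cpair (fcode g) (fcode h))
  | FImp g h => cpair 5 (cpair (fcode g) (fcode h))
  | FEx s n g => cpair 6 (cpair (sort_code s) (cpair n (fcode g)))
  | FAll s n g => cpair 7 (cpair (sort_code s) (cpair n (fcode g)))
  end.

Definition decidable_theory (T : formula -> Prop) : Prop :=
  decidable_nat (fun n => exists f, fcode f = n /\ T f).

(* Gamma u {infinity}: since Gamma_K ~ Z we use Z u {oo}, None = oo. *)
Definition vgroup := option int.
Definition addG (a b : vgroup) : vgroup :=
  match a, b with Some x, Some y => Some (x + y)%R | _, _ => None end.
Definition ltG (a b : vgroup) : Prop :=
  match a, b with
  | Some x, Some y => (x < y)%R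
  | Some _, None => True
  | None, _ => False
  end.
Definition geZ (a : vgroup) (n : int) : Prop :=
  match a with Some m => (n <= m)%R | None => True end.

Record VField : Type := {
  VK   : fieldType;
  Vk   : fieldType;
  Vv   : VK -> vgroup;
  Vres : VK -> Vk
}.

Local Open Scope ring_scope.

Definition is_padic_field (p : nat) (P : VField) : Prop :=
  let K := VK P in let v := @Vv P in let res := @Vres P in
  (forall x : K, v x = None <-> x = 0) /\
  (forall x y : K, v (x * y) = addG (v x) (v y)) /\
  (forall (x y : K) (n : int), geZ (v x) n -> geZ (v y) n -> geZ (v (x + y)) n) /\
  (forall n : int, exists x : K, v x = Some n) /\
  (forall x y : K, geZ (v x) 0 -> geZ (v y) 0 -> res (x + y) = res x + res y) /\
  (forall x y : K, geZ (v x) 0 -> geZ (v y) 0 -> res (x * y) = res x * res y) /\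
  res 1 = 1 /\
  (forall x : K, geZ (v x) 0 -> (res x = 0 <-> geZ (v x) 1)) /\
  (forall x : K, ~ geZ (v x) 0 -> res x = 0) /\
  (forall a : Vk P, exists x : K, geZ (v x) 0 /\ res x = a) /\
  (forall n : nat, (0 < n)%N -> (n%:R : K) != 0) /\
  (* v restricted to Q is (a positive multiple of) the p-adic valuation *)
  (forall n : nat, ~~ (p %| n)%N -> v (n%:R : K) = Some 0) /\
  (exists e : int, 0 < e /\ v (p%:R : K) = Some e) /\
  (forall a : nat -> K,
     (forall N : int, exists M : nat, forall i j, (M <= i)%N -> (M <= j)%N ->
        geZ (v (a i - a j)) N) ->
     exists l : K, forall N : int, exists M : nat, forall i, (M <= i)%N ->
        geZ (v (a i - l)) N) /\
  (* K is finite dimensional over the closure of Q in K (which is Q_p) *)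
  (exists (n : nat) (e : 'I_n -> K), forall x : K,
     exists c : 'I_n -> K,
       (forall i, exists r : nat -> rat, forall N : int, exists M : nat,
          forall j, (M <= j)%N -> geZ (v (ratr (r j) - c i)) N) /\
       x = \sum_(i < n) c i * e i).

Definition cross_section (P : VField) (s : int -> VK P) : Prop :=
  (forall n : int, Vv (s n) = Some n) /\
  (forall m n : int, s (m + n) = s m * s n).

Definition field_iso (F1 F2 : fieldType) : Prop :=
  exists f : F1 -> F2, bijective f /\
    (forall x y, f (x + y) = f x + f y) /\
    (forall x y, f (x * y) = f x * f y) /\ f 1 = 1.

Definition carrier (P : VField) (s : sort) : Type :=
  match s with SK => VK P | SG => vgroup | Sk => Vk P end.

Record env (P : VField) := Env {
  envK : nat -> VK P; envG : nat -> vgroup; envk : nat -> Vk P }.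

Definition lookup (P : VField) (e : env P) (s : sort) (n : nat) : carrier P s :=
  match s return carrier P s with
  | SK => envK e n | SG => envG e n | Sk => envk e n end.

Definition update (P : VField) (e : env P) (s : sort) (n : nat) :
    carrier P s -> env P :=
  match s return carrier P s -> env P with
  | SK => fun x => Env (fun m => if m == n then x else envK e m) (envG e) (envk e)
  | SG => fun x => Env (envK e) (fun m => if m == n then x else envG e m) (envk e)
  | Sk => fun x => Env (envK e) (envG e) (fun m => if m == n then x else envk e m)
  end.

Fixpoint teval (P : VField) (sec : int -> VK P) (e : env P) (s : sort)
    (t : term s) : carrier P s :=
  match t in term s return carrier P s with
  | Var s n => lookup e s n
  | KZero => (0 : VK P)
  | KOne => (1 : VK P)
  | KAdd a b => (teval sec e a + teval sec e b : VK P)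
  | KMul a b => (teval sec e a * teval sec e b : VK P)
  | Sec g => (match teval sec e g with Some n => sec n | None => 0 end : VK P)
  | GZero => (Some 0 : vgroup)
  | GInf => (None : vgroup)
  | GAdd a b => addG (teval sec e a) (teval sec e b)
  | Val a => Vv (teval sec e a)
  | RZero => (0 : Vk P)
  | ROne => (1 : Vk P)
  | RAdd a b => (teval sec e a + teval sec e b : Vk P)
  | RMul a b => (teval sec e a * teval sec e b : Vk P)
  | Res a => Vres (teval sec e a)
  end.

Fixpoint sat (P : VField) (sec : int -> VK P) (e : env P) (f : formula) : Prop :=
  match f with
  | FEq s a b => teval sec e a = teval sec e b
  | FLt a b => ltG (teval sec e a) (teval sec e b)
  | FNeg g => ~ sat sec e g
  | FAnd g h => sat sec e g /\ sat sec e h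
  | FOr g h => sat sec e g \/ sat sec e h
  | FImp g h => sat sec e g -> sat sec e h
  | FEx s n g => exists x : carrier P s, sat sec (update e n x) g
  | FAll s n g => forall x : carrier P s, sat sec (update e n x) g
  end.

Definition models (P : VField) (sec : int -> VK P) (f : formula) : Prop :=
  forall e : env P, sat sec e f.

(* C assigns to every structure P its chosen cross-section C P.
   A sentence is in the asymptotic theory iff it holds in (K, C K) for all
   finite extensions K of Q_p outside finitely many isomorphism classes. *)
Definition asymptotic_theory (p : nat) (C : forall P : VField, int -> VK P)
    (f : formula) : Prop :=
  sentence f /\
  exists (n : nat) (E : nat -> VField), forall P : VField,
    is_padic_field p P ->
    (forall i, (i < n)%N -> ~ field_iso (VK P) (VK (E i))) ->
    models (C P) f.

Definition asymptotic_EA_theory (p : nat) (C : forall P : VField, int -> VK P)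
    (f : formula) : Prop :=
  asymptotic_theory p C f /\ is_EA f.

(* Main.v *)
(** The value group of a finite extension K of Q_p is Z, and with pi = s(1) the relation
    "m and n differ by a power of p" on 0 < m, n <= v(p) is existential: it says that
    pi^-m - pi^-n is congruent to z^p - z modulo the valuation ring for some z, because
    Frobenius is additive on elements of small pole order. From it one defines, inside the window
    of integers below v(p), the product of an integer with a power of p, hence the digits of an
    integer in a base W = p^w, hence unary functions on an initial segment of the naturals.
    An initial block of existential quantifiers therefore guesses a set of facts
    "program g maps input l to y", and a block of universal quantifiers states that this set is
    closed under the evaluation rules of recursive functions and omits "h maps N to 1".

    This sentence holds in every K when h(N) <> 1: take the set of all true facts. When h(N) = 1,
    a derivation is finite, so the sentence fails as soon as the window is large, in particular
    in Q_p(p^(1/e)) for all large e, and these fields are pairwise non-isomorphic. A decision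
    procedure for the theory then contradicts itself on the sentence whose N is its own code. *)

From HB Require Import structures.
From mathcomp Require Import all_boot all_order all_algebra.
From mathcomp Require Import boolp zify ring.
From Stdlib Require Import Eqdep_dec.
Require Import Defs.
Set Implicit Arguments. Unset Strict Implicit. Unset Printing Implicit Defensive.
Import Order.TTheory GRing.Theory Num.Theory.

Local Open Scope ring_scope.
Local Open Scope quotient_scope.

(** * The totally ramified field Q_p(p^(1/e)) *)

(** [prel] is only existentially definable. It may therefore be asserted in the existential block,
    and in the universal block it may only be a premise, its witnesses being universally quantified
    there; the conclusion drawn from such premises has to be linear. Moreover only products with
    powers of p become definable, so the pairing function behind the facts cannot be written out.
    Its two components are guessed as further tables, pinned down by recursion along the Cantor
    enumeration.

    The existential block could cheat by choosing tables of length zero, on which every closure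
    condition is void. Hence the length T is tied to v(p): a power Q0 of p satisfies 4p Q0 <= v(p) <
    4p^2 Q0, it lies between W^T and W^(T+1), and W is at most 2p(T+2). So T grows beyond every
    bound with v(p).

    The fields Q_p(p^(1/e)) are built from quotients of Z[[X]], where completeness and finite
    dimension over the closure of Q can be checked on power series. *)

Definition pser := nat -> int.
HB.instance Definition _ := gen_eqMixin pser.
HB.instance Definition _ := gen_choiceMixin pser.

(** * Formal power series over the integers *)

Section PowerSeriesRing.
Implicit Types f g h : pser.

Definition pser_add f g : pser := fun n => f n + g n.
Definition pser_opp f : pser := fun n => - f n.
Definition pser_const (c : int) : pser := fun n => if n is 0%N then c else 0.
Definition pser_mul f g : pser := fun n => \sum_(i < n.+1) f i * g (n - i)%N.

Lemma pser_addA : associative pser_add.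
Proof. by move=> f g h; apply/funext => n; rewrite /pser_add addrA. Qed.
Lemma pser_addC : commutative pser_add.
Proof. by move=> f g; apply/funext => n; rewrite /pser_add addrC. Qed.
Lemma pser_add0 : left_id (pser_const 0) pser_add.
Proof. by move=> f; apply/funext => -[|n]; rewrite /pser_add add0r. Qed.
Lemma pser_addN : left_inverse (pser_const 0) pser_opp pser_add.
Proof. by move=> f; apply/funext => -[|n]; rewrite /pser_add /pser_opp addNr. Qed.

HB.instance Definition _ :=
  GRing.isZmodule.Build pser pser_addA pser_addC pser_add0 pser_addN.

(** Convolution up to degree n sees only truncations, so associativity and commutativity are
    inherited from [{poly int}]. *)
Definition trunc_repr n (P : {poly int}) f := forall k, (k <= n)%N -> P`_k = f k.

Lemma trunc_repr_poly n f : trunc_repr n (\poly_(i < n.+1) f i) f.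
Proof. by move=> k kn; rewrite coef_poly ltnS kn. Qed.

Lemma trunc_reprM n P Q f g :
  trunc_repr n P f -> trunc_repr n Q g -> trunc_repr n (P * Q) (pser_mul f g).
Proof.
move=> hP hQ k kn; rewrite coefM; apply: eq_bigr => i _.
by rewrite hP ?hQ // ?(leq_trans (leq_subr _ _)) // (leq_trans _ kn) // -ltnS.
Qed.

Lemma trunc_repr_inj f g : (forall n, exists P, trunc_repr n P f /\ trunc_repr n P g) -> f = g.
Proof. by move=> h; apply/funext => n; have [P [<- // <-]] := h n. Qed.

Lemma pser_mulA : associative pser_mul.
Proof.
move=> f g h; apply: trunc_repr_inj => n.
have F := @trunc_repr_poly n f; have G := @trunc_repr_poly n g.
have H := @trunc_repr_poly n h.
exists (\poly_(i < n.+1) f i * \poly_(i < n.+1) g i * \poly_(i < n.+1) h i).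
split; last exact: trunc_reprM (trunc_reprM F G) H.
by rewrite -mulrA; exact: trunc_reprM F (trunc_reprM G H).
Qed.

Lemma pser_mulC : commutative pser_mul.
Proof.
move=> f g; apply: trunc_repr_inj => n.
have F := @trunc_repr_poly n f; have G := @trunc_repr_poly n g.
exists (\poly_(i < n.+1) f i * \poly_(i < n.+1) g i).
by split; last rewrite mulrC; exact: trunc_reprM.
Qed.

Lemma pser_mul1 : left_id (pser_const 1) pser_mul.
Proof.
move=> f; apply: trunc_repr_inj => n; exists (\poly_(i < n.+1) f i).
have F := @trunc_repr_poly n f; split=> //.
by rewrite -[X in trunc_repr _ X]mul1r; apply: trunc_reprM => // -[|k] _; rewrite coef1.
Qed.

Lemma pser_mulDl : left_distributive pser_mul pser_add.
Proof.
move=> f g h; apply/funext => n; rewrite /pser_add /pser_mul -big_split.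
by apply: eq_bigr => i _; rewrite mulrDl.
Qed.

Lemma pser_1neq0 : pser_const 1 != pser_const 0.
Proof. by apply/eqP => /(congr1 (fun f => f 0%N)). Qed.

HB.instance Definition _ :=
  GRing.Zmodule_isComNzRing.Build pser pser_mulA pser_mulC pser_mul1 pser_mulDl pser_1neq0.

Lemma pserD f g n : (f + g) n = f n + g n. Proof. by []. Qed.
Lemma pserN f n : (- f) n = - f n. Proof. by []. Qed.
Lemma pserB f g n : (f - g) n = f n - g n. Proof. by []. Qed.
Lemma pser0 n : (0 : pser) n = 0. Proof. by case: n. Qed.
Lemma pser1 n : (1 : pser) n = (n == 0%N)%:R. Proof. by case: n. Qed.
Lemma pserM f g n : (f * g) n = \sum_(i < n.+1) f i * g (n - i)%N. Proof. by []. Qed.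
Lemma pserM0 f g : (f * g) 0%N = f 0%N * g 0%N.
Proof. by rewrite pserM big_ord1. Qed.
Lemma pserMn f m n : (f *+ m) n = f n *+ m.
Proof. by elim: m => [|m IH]; rewrite ?mulr0n ?pser0 // !mulrS pserD IH. Qed.

Lemma pser_sum (I : Type) (r : seq I) (P : pred I) (F : I -> pser) n :
  (\sum_(i <- r | P i) F i) n = \sum_(i <- r | P i) F i n.
Proof.
by elim/big_rec2: _ => [|i x y _ <-]; [rewrite pser0 | rewrite pserD].
Qed.

Definition pserX : pser := fun n => (n == 1%N)%:R.

Definition pser_shift f : pser := fun n => f n.+1.

Lemma pserXM0 f : (pserX * f) 0%N = 0.
Proof. by rewrite pserM0 mul0r. Qed.

Lemma pserXMS f n : (pserX * f) n.+1 = f n.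
Proof.
rewrite pserM (bigD1 (Ordinal (isT : (1 < n.+2)%N))) //= big1 ?addr0.
  by rewrite /pserX /= mul1r subn1.
by move=> i; rewrite -val_eqE /pserX /= => /negbTE ->; rewrite mul0r.
Qed.

Lemma pserXnM n f k : (pserX ^+ n * f) k = if (k < n)%N then 0 else f (k - n)%N.
Proof.
elim: n k => [|n IH] k; first by rewrite mul1r subn0.
by rewrite exprS -mulrA; case: k => [|k]; rewrite ?pserXM0 // pserXMS IH.
Qed.

Lemma pserX_inj f g : pserX * f = pserX * g -> f = g.
Proof. by move=> h; apply/funext => n; rewrite -(pserXMS f) h pserXMS. Qed.

Lemma pser_splitX f : f 0%N = 0 -> f = pserX * pser_shift f.
Proof. by move=> f0; apply/funext => -[|n]; rewrite ?pserXM0 ?pserXMS. Qed.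

Lemma pserX_dvd n f : (forall k, (k < n)%N -> f k = 0) -> exists g, f = pserX ^+ n * g.
Proof.
move=> f0; exists (fun k => f (k + n)%N); apply/funext => k.
by rewrite pserXnM; case: ltnP => [/f0|/subnK ->].
Qed.

(** Degree k receives contributions only from i <= k, so the infinite sum of the X^i d_i is finite
    in each degree. This is the source of completeness of the quotient. *)
Lemma pser_series (d : nat -> pser) :
  exists s, forall N, exists r, s = \sum_(i < N) pserX ^+ i * d i + pserX ^+ N * r.
Proof.
exists (fun k => \sum_(i < k.+1) d i (k - i)%N) => N.
suff [r hr] : exists r, ((fun k => \sum_(i < k.+1) d i (k - i)%N) : pser) -
    \sum_(i < N) pserX ^+ i * d i = pserX ^+ N * r by exists r; rewrite -hr addrC subrK.
apply: pserX_dvd => k kN; rewrite pserB pser_sum; apply/eqP; rewrite subr_eq0; apply/eqP.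
rewrite (big_ord_widen N (fun i => d i (k - i)%N)) // big_mkcond /=.
apply: eq_bigr => i _; rewrite pserXnM ltnS leqNgt.
by case: ltnP.
Qed.

End PowerSeriesRing.

(** * Complete rings with a uniformizer: factorization, units, integrality *)

Section UniformizerRing.
Variables (O : comNzRingType) (F : fieldType) (X : O) (phi : {rmorphism O -> F}).
Hypothesis phiX : phi X = 0.
Hypothesis kerX : forall a, phi a = 0 -> exists b, a = X * b.
Hypothesis phi_surj : forall c, exists a, phi a = c.
Hypothesis regX : forall a, X * a = 0 -> a = 0.
Hypothesis sepX : forall a, (forall n, exists b, a = X ^+ n * b) -> a = 0.
Hypothesis compX : forall d : nat -> O, exists s, forall N, exists r,
  s = \sum_(i < N) X ^+ i * d i + X ^+ N * r.

(** If dividing out X never reached a unit residue, a would be divisible by every power of X, hence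
    zero by [sepX]. *)
Lemma dvr_factor (a : O) : a != 0 -> exists n u, phi u != 0 /\ a = X ^+ n * u.
Proof.
move=> a0; apply: contrapT => H; case/eqP: a0; apply: sepX.
elim=> [|n [b ab]]; first by exists a; rewrite mul1r.
have [/kerX [c bc]|nz] := eqVneq (phi b) 0; first by exists c; rewrite exprSr -mulrA -bc.
by case: H; exists n, b.
Qed.

(** Lifting the inverse residue gives a with a u = 1 - X b, and the geometric series in X b, which
    exists by [compX], inverts this. *)
Lemma dvr_unit (u : O) : phi u != 0 -> exists w, w * u = 1.
Proof.
move=> nz; have [a ha] := phi_surj (phi u)^-1.
have /kerX [b hb] : phi (1 - a * u) = 0 by rewrite rmorphB rmorphM rmorph1 ha mulVf ?subrr.
have [s hs] := compX (fun i => b ^+ i).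
exists (s * a); rewrite -mulrA.
have -> : a * u = 1 - X * b by rewrite -hb opprB addrCA subrr addr0.
apply/eqP; rewrite -subr_eq0; apply/eqP/sepX => N.
have [r ->] := hs N.
exists ((1 - X * b) * r - b ^+ N).
rewrite (eq_bigr (fun i : 'I_N => (X * b) ^+ i)); last by move=> i _; rewrite exprMn.
have E : (1 - X * b) * (\sum_(i < N) (X * b) ^+ i) = 1 - (X * b) ^+ N.
  by rewrite -opprB mulNr -subrX1 opprB.
rewrite [X in X - 1]mulrC mulrDr E exprMn; move: (X ^+ N) (b ^+ N) => y z; ring.
Qed.

Lemma dvr_regXn n (a : O) : X ^+ n * a = 0 -> a = 0.
Proof. by elim: n => [|n IH]; rewrite ?mul1r // exprS -mulrA => /regX. Qed.

Lemma dvr_domain (a b : O) : a * b = 0 -> (a == 0) || (b == 0).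
Proof.
have [//|a0 /=] := eqVneq a 0; have [//|b0 /=] := eqVneq b 0.
have [n [u [hu ->]]] := dvr_factor a0; have [m [w [hw ->]]] := dvr_factor b0.
rewrite mulrACA -exprD => /dvr_regXn uw0.
by have := mulf_neq0 hu hw; rewrite -rmorphM uw0 rmorph0 eqxx.
Qed.

End UniformizerRing.

(** * The Eisenstein quotient of the power series ring *)

Section EisensteinRing.
Variables (p : nat) (pr : prime p) (e : nat).

(** The ramification index is e.+1, so every natural number e gives a field. *)
Definition eis_poly : pser := pserX ^+ e.+1 - p%:R.

(* The X-adic closure of the ideal (X^e - p), so that the quotient is separated by construction. *)
Definition eis_ideal of prime p : pred pser := fun f =>
  `[< forall n, exists g h, f = eis_poly * g + pserX ^+ n * h >].

Lemma eis_idealP f :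
  reflect (forall n, exists g h, f = eis_poly * g + pserX ^+ n * h) (f \in eis_ideal pr).
Proof. exact: asboolP. Qed.

Lemma eis_poly0 : eis_poly 0%N = - p%:R.
Proof. by rewrite /eis_poly pserB exprS pserXM0 pserMn add0r. Qed.

Lemma prime_ndvd1 g : ((p%:R * g : int) == 1) = false.
Proof.
apply/negP => /eqP h; have := congr1 absz h.
rewrite abszM natz absz_nat => /eqP; rewrite muln_eq1 => /andP [/eqP p1 _].
by move: pr; rewrite p1.
Qed.

Lemma eis_ideal_closed : idealr_closed (eis_ideal pr).
Proof.
split.
- by apply/eis_idealP => n; exists 0, 0; rewrite !mulr0 addr0.
(* Reducing modulo X, membership of 1 would make p divide 1. *)
- apply/negP => /eis_idealP /(_ 1%N) [g [h /(congr1 (fun f : pser => f 0%N))]].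
  rewrite pserD pserM0 pserXM0 addr0 eis_poly0 pser1 mulNr -mulrN => /esym /eqP.
  by rewrite prime_ndvd1.
- move=> a f g /eis_idealP hf /eis_idealP hg; apply/eis_idealP => n.
  have [f1 [f2 ->]] := hf n; have [g1 [g2 ->]] := hg n.
  exists (a * f1 + g1), (a * f2 + g2).
  by rewrite !mulrDr addrACA ![a * (_ * _)]mulrCA.
Qed.

HB.instance Definition _ := isIdealr.Build pser (eis_ideal pr) eis_ideal_closed.

Definition eis_idealr : idealr pser := Idealr.clone pser (eis_ideal pr) _.
Definition eis_ring := {ideal_quot eis_idealr}.
HB.instance Definition _ := GRing.ComNzRing.on eis_ring.


Definition to_eis (f : pser) : eis_ring := \pi_({ideal_quot eis_idealr}) f.

Lemma to_eisP (a : eis_ring) : exists f, a = to_eis f.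
Proof. by exists (repr a); rewrite /to_eis reprK. Qed.

Lemma to_eisB : zmod_morphism to_eis.
Proof. by move=> f g; rewrite /to_eis [LHS]raddfB. Qed.

Lemma to_eisM : monoid_morphism to_eis.
Proof. by split; [exact: rmorph1 | move=> f g; exact: rmorphM]. Qed.

HB.instance Definition _ := GRing.isZmodMorphism.Build pser eis_ring to_eis to_eisB.
HB.instance Definition _ := GRing.isMonoidMorphism.Build pser eis_ring to_eis to_eisM.

Lemma to_eis_eq0 f :
  to_eis f = 0 <-> forall n, exists g h, f = eis_poly * g + pserX ^+ n * h.
Proof.
rewrite -(rmorph0 to_eis) /to_eis; split.
  by move/eqP; rewrite -Quotient.idealrBE subr0 => /eis_idealP.
by move=> h; apply/eqP; rewrite -Quotient.idealrBE subr0; apply/eis_idealP.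
Qed.

Definition eisX : eis_ring := to_eis pserX.

Lemma eisXe : eisX ^+ e.+1 = p%:R.
Proof.
apply/eqP; rewrite -subr_eq0 -(rmorph_nat to_eis) -rmorphXn -rmorphB; apply/eqP/to_eis_eq0.
by move=> n; exists 1, 0; rewrite mulr1 mulr0 addr0.
Qed.

Lemma Fp_int_eq0 (z : int) : ((z%:~R : 'F_p) == 0) = (p %| `|z|)%N.
Proof.
have H n : ((n%:R : 'F_p) == 0) = (p %| n)%N.
  have /andP [_ /eqP c] : p \in [pchar 'F_p] by exact: pchar_Fp.
  by rewrite (dvdn_pcharf (pchar_Fp pr)).
case: z => n; first exact: H.
by rewrite NegzE rmorphN oppr_eq0 abszN; exact: H.
Qed.

Definition eis_res (a : eis_ring) : 'F_p := (repr a 0%N)%:~R.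

(** Precision n = 1 in the ideal shows that two representatives differ in degree zero by a multiple
    of p. *)
Lemma eis_resE f : eis_res (to_eis f) = (f 0%N)%:~R.
Proof.
rewrite /eis_res; set g := repr _.
have : to_eis (g - f) = 0.
  by rewrite rmorphB /= /to_eis reprK; apply/eqP; rewrite subr_eq0.
move/to_eis_eq0 => /(_ 1%N) [a [b /(congr1 (fun f : pser => f 0%N))]].
rewrite pserB pserD pserM0 pserXM0 addr0 eis_poly0 => E.
apply/eqP; rewrite -subr_eq0 -rmorphB /= E Fp_int_eq0 mulNr abszN abszM natz absz_nat.
exact: dvdn_mulr.
Qed.

Lemma eis_resB : zmod_morphism eis_res.
Proof.
move=> a b; have [f ->] := to_eisP a; have [g ->] := to_eisP b.
by rewrite -rmorphB !eis_resE pserB rmorphB.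
Qed.

Lemma eis_resM : monoid_morphism eis_res.
Proof.
split=> [|a b]; first by rewrite -(rmorph1 to_eis) eis_resE.
have [f ->] := to_eisP a; have [g ->] := to_eisP b.
by rewrite -rmorphM !eis_resE pserM0 rmorphM.
Qed.

HB.instance Definition _ := GRing.isZmodMorphism.Build eis_ring 'F_p eis_res eis_resB.
HB.instance Definition _ := GRing.isMonoidMorphism.Build eis_ring 'F_p eis_res eis_resM.

Lemma eis_resX : eis_res eisX = 0.
Proof. by rewrite eis_resE. Qed.

(** A constant coefficient c p can be traded for c X^(e+1), since p is a power of X in the quotient;
    what remains is divisible by X already as a series. *)
Lemma eis_kerX a : eis_res a = 0 -> exists b, a = eisX * b.
Proof.
have [f ->] := to_eisP a; rewrite eis_resE => /eqP; rewrite Fp_int_eq0 => /dvdnP [m hm].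
have [c hc] : exists c : int, f 0%N = c * p%:R.
  exists (sgz (f 0%N) * m%:Z); rewrite {1}[f 0%N]intEsg hm PoszM mulrA.
  by rewrite natz.
have E : (f - pser_const c * p%:R) = pserX * pser_shift (f - pser_const c * p%:R).
  by apply: pser_splitX; rewrite pserB pserM0 pserMn hc pser1 subrr.
exists (to_eis (pser_shift (f - pser_const c * p%:R)) + to_eis (pser_const c) * eisX ^+ e).
rewrite mulrDr -rmorphM -E mulrCA -exprS eisXe rmorphB rmorphM rmorph_nat.
by rewrite subrK.
Qed.

Lemma eis_res_surj c : exists a, eis_res a = c.
Proof.
by exists (nat_of_ord c)%:R; rewrite rmorph_nat; exact: natr_Zp.
Qed.

(** If X f = P g + X^(n+1) h with P the Eisenstein polynomial, degree zero gives p g(0) = 0. So g is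
    divisible by X, and one factor X cancels at the cost of one degree of precision. *)
Lemma eis_regX a : eisX * a = 0 -> a = 0.
Proof.
have [f ->] := to_eisP a; rewrite -rmorphM => /to_eis_eq0 H; apply/to_eis_eq0 => n.
have [g [h E]] := H n.+1.
have : g 0%N = 0.
  have := congr1 (fun f : pser => f 0%N) E.
  rewrite pserXM0 pserD pserM0 eis_poly0 exprS -mulrA pserXM0 addr0 => /esym /eqP.
  by rewrite mulf_eq0 oppr_eq0 pnatr_eq0 (gtn_eqF (prime_gt0 pr)) /= => /eqP.
move/pser_splitX => Eg; exists (pser_shift g), h; apply: pserX_inj.
by rewrite E {1}Eg exprS mulrDr -mulrA mulrCA.
Qed.

Lemma eis_sepX a : (forall n, exists b, a = eisX ^+ n * b) -> a = 0.
Proof.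
have [f ->] := to_eisP a => H; apply/to_eis_eq0 => n.
have [b] := H n; have [g ->] := to_eisP b.
rewrite -rmorphXn -rmorphM => /eqP; rewrite -subr_eq0 -rmorphB => /eqP/to_eis_eq0 /(_ n).
by move=> [u [w E]]; exists u, (w + g); rewrite mulrDr addrA -E subrK.
Qed.

Lemma eis_compX (d : nat -> eis_ring) : exists s, forall N, exists r,
  s = \sum_(i < N) eisX ^+ i * d i + eisX ^+ N * r.
Proof.
have [s hs] := pser_series (fun i => repr (d i)).
exists (to_eis s) => N; have [r ->] := hs N; exists (to_eis r).
rewrite rmorphD rmorphM rmorphXn rmorph_sum; congr (_ + _); apply: eq_bigr => i _.
by rewrite rmorphM rmorphXn /= [to_eis (repr _)]reprK.
Qed.

Definition eis_unit : pred eis_ring := fun u => eis_res u != 0.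

Definition eis_inv (u : eis_ring) : eis_ring :=
  if pselect (exists w, w * u = 1) is left h then projT1 (cid h) else u.

Lemma eis_mulVr : {in eis_unit, left_inverse 1 eis_inv *%R}.
Proof.
move=> u hu; rewrite /eis_inv; case: pselect => [h|[]]; first by case: cid.
exact: (dvr_unit eis_kerX eis_res_surj eis_sepX eis_compX hu).
Qed.

Lemma eis_unitP (u w : eis_ring) : w * u = 1 -> eis_unit u.
Proof.
move=> h; apply/negP => /eqP u0; have := congr1 eis_res h.
by rewrite rmorphM rmorph1 /= u0 mulr0 => /esym/eqP; rewrite oner_eq0.
Qed.

Lemma eis_inv_out : {in [predC eis_unit], eis_inv =1 id}.
Proof.
move=> u hu; rewrite /eis_inv; case: pselect => // h.
by case/negP: hu; case: h => w hw; exact: (eis_unitP hw).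
Qed.

HB.instance Definition _ :=
  GRing.ComNzRing_hasMulInverse.Build eis_ring eis_mulVr eis_unitP eis_inv_out.

Lemma eis_domain (a b : eis_ring) : a * b = 0 -> (a == 0) || (b == 0).
Proof. exact: (dvr_domain eis_kerX eis_regX eis_sepX). Qed.

HB.instance Definition _ := GRing.ComUnitRing_isIntegral.Build eis_ring eis_domain.

End EisensteinRing.

(** * The fraction field with its valuation and residue map *)

Lemma fraction_repr (R : idomainType) (x : {fraction R}) :
  exists a b : R, b != 0 /\ x = FracField.tofrac a / FracField.tofrac b.
Proof.
elim/quotW: x => x; exists (x : R * R).1, (x : R * R).2; split; first exact: denom_ratioP.
have d0 := denom_ratioP x.
have D0 : FracField.tofrac (x : R * R).2 != 0 by rewrite tofrac_eq0.
apply: (mulIf D0); rewrite divfK //; rewrite ![LHS]piE.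
apply/eqP; rewrite !piE FracField.equivfE.
by rewrite !numden_Ratio ?mulr1 ?oner_neq0 ?mulf_neq0 // mulrC.
Qed.

Section EisensteinField.
Variables (p : nat) (pr : prime p) (e : nat).
Local Notation O := (eis_ring pr e).
Local Notation X := (eisX pr e).
Local Notation res := (@eis_res p pr e).
Local Notation "x %:F" := (@FracField.tofrac O x).

Definition eis_field : fieldType := {fraction O}.
Local Notation K := eis_field.

Definition eisXF : K := X%:F.
Local Notation XF := eisXF.

Lemma eisXF_neq0 : XF != 0.
Proof.
rewrite /XF tofrac_eq0; apply/eqP => X0.
have /eis_regX/eqP : X * 1 = 0 by rewrite X0 mul0r.
by rewrite oner_eq0.
Qed.

Lemma tofrac_eisX n a : (X ^+ n * a)%:F = XF ^ n%:Z * a%:F.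
Proof. by rewrite rmorphM rmorphXn. Qed.

Definition eis_rep (x : K) (n : int) := exists u, res u != 0 /\ x = XF ^ n * u%:F.

Lemma res_unit (u : O) : res u != 0 -> exists2 w, res w != 0 & w%:F = (u%:F)^-1.
Proof.
move=> hu; exists u^-1.
  apply/eqP => h; have : res (u^-1 * u) = 0 by rewrite rmorphM /= h mul0r.
  by rewrite mulVr ?rmorph1 => // [/eqP|]; rewrite ?oner_eq0.
have u0 : u%:F != 0.
  by rewrite tofrac_eq0; apply: contraNneq hu => ->; rewrite rmorph0.
by apply: (mulIf u0); rewrite mulVf // -rmorphM mulVr // rmorph1.
Qed.

Lemma eis_rep_exists (x : K) : x != 0 -> exists n, eis_rep x n.
Proof.
have [a [b [b0 ->]]] := fraction_repr x.
rewrite mulf_eq0 invr_eq0 !tofrac_eq0 (negbTE b0) orbF => a0.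
have [n [u [hu ->]]] := dvr_factor (@eis_kerX p pr e) (@eis_sepX p pr e) a0.
have [m [w [hw ->]]] := dvr_factor (@eis_kerX p pr e) (@eis_sepX p pr e) b0.
have [w' hw' E] := res_unit hw.
exists (n%:Z - m%:Z), (u * w'); split; first by rewrite rmorphM mulf_neq0.
rewrite !tofrac_eisX tofracM E expfzDr ?eisXF_neq0 // -invr_expz invfM.
by rewrite mulrACA.
Qed.


Lemma eis_rep_uniq (x : K) n m : eis_rep x n -> eis_rep x m -> n = m.
Proof.
wlog le_nm : n m / n <= m.
  by move=> H hn hm; case: (lerP n m) => [|/ltW] le; [exact: H | symmetry; exact: H].
move=> [u [hu ->]] [w [hw]]; have [k ->] : exists k : nat, m = n + k%:Z.
  by exists `|m - n|%N; rewrite gez0_abs ?subr_ge0 // addrCA subrr addr0.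
rewrite expfzDr ?eisXF_neq0 // -mulrA => /mulfI -/(_ (expfz_neq0 _ eisXF_neq0)).
rewrite -tofrac_eisX => /eqP; rewrite tofrac_eq => /eqP uw.
case: k uw => [|k] uw; first by rewrite addr0.
by case/eqP: hu; rewrite uw rmorphM rmorphXn /= eis_resX expr0n mul0r.
Qed.

Definition eis_val (x : K) : vgroup :=
  if pselect (exists n, eis_rep x n) is left h then Some (projT1 (cid h)) else None.

Lemma eis_valE x n : eis_rep x n -> eis_val x = Some n.
Proof.
move=> hx; rewrite /eis_val; case: pselect => [h|[]]; last by exists n.
by case: cid => m hm /=; rewrite (eis_rep_uniq hm hx).
Qed.

Lemma eis_rep0 n : ~ eis_rep 0 n.
Proof.
move=> [u [hu /esym/eqP]]; rewrite mulf_eq0 (negbTE (expfz_neq0 _ eisXF_neq0)) /=.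
by rewrite tofrac_eq0 => u0; move: hu; rewrite (eqP u0) rmorph0 eqxx.
Qed.

Lemma eis_val0 : eis_val 0 = None.
Proof. by rewrite /eis_val; case: pselect => // -[n hn]; case: (eis_rep0 hn). Qed.

Lemma eis_val_geP x n : geZ (eis_val x) n <-> exists a, x = XF ^ n * a%:F.
Proof.
have [->|x0] := eqVneq x 0.
  by rewrite eis_val0; split=> // _; exists 0; rewrite rmorph0 mulr0.
have [m hm] := eis_rep_exists x0; have [u [hu E]] := hm; rewrite (eis_valE hm) /=; split.
  move=> nm; exists (X ^+ `|m - n| * u); rewrite tofrac_eisX mulrA.
  by rewrite -expfzDr ?eisXF_neq0 // gez0_abs ?subr_ge0 // addrCA subrr addr0.
move=> [a xa].
have a0 : a != 0 by apply: contraNneq x0 => a0; rewrite xa a0 rmorph0 mulr0.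
have [k [w [hw aw]]] := dvr_factor (@eis_kerX p pr e) (@eis_sepX p pr e) a0.
have hk : eis_rep x (n + k%:Z).
  by exists w; split=> //; rewrite xa aw tofrac_eisX mulrA expfzDr ?eisXF_neq0.
by rewrite (eis_rep_uniq hm hk) lerDl.
Qed.

Definition eis_Fres (x : K) : 'F_p :=
  if pselect (exists a, x = a%:F) is left h then res (projT1 (cid h)) else 0.

Lemma eis_FresE a : eis_Fres a%:F = res a.
Proof.
rewrite /eis_Fres; case: pselect => [h|[]]; last by exists a.
by case: cid => b hb /=; congr res; apply/esym/eqP; rewrite -tofrac_eq; apply/eqP.
Qed.

Definition eis_vfield : VField := Build_VField eis_val eis_Fres.

End EisensteinField.

(** [ratr] works with the reduced numerator and denominator, so the fractions are compared by
    cross-multiplication in Z, and the equation is then pushed to F. *)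
Lemma ratr_fracXn (F : fieldType) (q : nat) (z : int) m :
  (forall n, (0 < n)%N -> (n%:R : F) != 0) -> (0 < q)%N ->
  ratr (z%:~R / q%:R ^+ m) = (z%:~R : F) / q%:R ^+ m.
Proof.
move=> ch0 q0.
have chz (y : int) : y != 0 -> (y%:~R : F) != 0.
  case: y => n y0; first by apply: ch0; rewrite lt0n.
  by rewrite NegzE rmorphN oppr_eq0; exact: (ch0 n.+1).
set r : rat := _ / _.
have p0 : (q%:R ^+ m : F) != 0 by rewrite expf_neq0 ?ch0.
have pq : (q%:R ^+ m : rat) != 0 by rewrite expf_neq0 // pnatr_eq0 -lt0n.
have E : (numq r * q%:Z ^+ m)%:~R = (z * denq r)%:~R :> rat.
  rewrite !rmorphM /= rmorphXn /=; apply/eqP.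
  by rewrite -eqr_div ?intr_eq0 ?denq_neq0 // divq_num_den.
rewrite /ratr; apply/eqP; rewrite eqr_div ?chz ?denq_neq0 //; apply/eqP.
move/eqP: E; rewrite eqr_int => /eqP /(congr1 (fun y : int => y%:~R : F)).
by rewrite !rmorphM /= rmorphXn /=.
Qed.

(** * Verification of the axioms of a p-adic field *)

Section EisensteinPadic.
Variables (p : nat) (pr : prime p) (e : nat).
Local Notation O := (eis_ring pr e).
Local Notation X := (eisX pr e).
Local Notation res := (@eis_res p pr e).
Local Notation "x %:F" := (@FracField.tofrac O x).
Local Notation K := (eis_field pr e).
Local Notation XF := (eisXF pr e).
Local Notation v := (@eis_val p pr e).

Lemma eis_valM (x y : K) : v (x * y) = addG (v x) (v y).
Proof.
have [->|x0] := eqVneq x 0; first by rewrite mul0r eis_val0.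
have [->|y0] := eqVneq y 0; first by rewrite mulr0 eis_val0; case: (v x).
have [n hn] := eis_rep_exists x0; have [m hm] := eis_rep_exists y0.
rewrite (eis_valE hn) (eis_valE hm); apply: eis_valE.
have [u [hu ->]] := hn; have [w [hw ->]] := hm.
exists (u * w); split; first by rewrite rmorphM mulf_neq0.
by rewrite tofracM expfzDr ?eisXF_neq0 // mulrACA.
Qed.

Lemma eis_val_ge0 (x : K) : geZ (v x) 0 <-> exists a, x = a%:F.
Proof.
split; first by move/eis_val_geP => [a ->]; exists a; rewrite expr0z mul1r.
by move=> [a ->]; apply/eis_val_geP; exists a; rewrite expr0z mul1r.
Qed.

Lemma eis_val_geD (x y : K) n : geZ (v x) n -> geZ (v y) n -> geZ (v (x + y)) n.
Proof.
move=> /eis_val_geP [a ->] /eis_val_geP [b ->]; apply/eis_val_geP.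
by exists (a + b); rewrite tofracD mulrDr.
Qed.

Lemma eis_val_unit (u : O) : res u != 0 -> v u%:F = Some 0.
Proof. by move=> hu; apply: eis_valE; exists u; rewrite expr0z mul1r. Qed.

Lemma natr_tofrac n : (n%:R : K) = (n%:R)%:F.
Proof. by rewrite rmorph_nat. Qed.

Lemma res_nat n : (res n%:R == 0) = (p %| n)%N.
Proof. by rewrite rmorph_nat; exact: (Fp_int_eq0 pr n). Qed.

Lemma eisXF_pow : XF ^+ e.+1 = p%:R.
Proof. by rewrite natr_tofrac -eisXe rmorphXn. Qed.

Lemma eis_val_X n : v (XF ^ n) = Some n.
Proof.
apply: eis_valE; exists 1; rewrite rmorph1 oner_eq0; split=> //.
by rewrite rmorph1 mulr1.
Qed.

Lemma eis_val_p : v p%:R = Some e.+1%:Z.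
Proof. by rewrite -eisXF_pow; exact: eis_val_X e.+1%:Z. Qed.

Lemma eis_char0 n : (0 < n)%N -> (n%:R : K) != 0.
Proof.
move=> n0; have [m cop nE] := pfactor_coprime pr n0.
rewrite nE natrM mulf_neq0 //; last first.
  by rewrite natrX expf_neq0 // -eisXF_pow expf_neq0 ?eisXF_neq0.
apply/eqP => m0; have : v m%:R = Some 0.
  by rewrite natr_tofrac eis_val_unit // res_nat -prime_coprime.
by rewrite m0 eis_val0.
Qed.

Lemma ratr_fracp (z : int) m :
  ratr (z%:~R / p%:R ^+ m) = (z%:~R : K) / p%:R ^+ m.
Proof. by apply: ratr_fracXn; [exact: eis_char0 | exact: prime_gt0]. Qed.

Lemma eis_complete (a : nat -> K) :
  (forall N : int, exists M : nat, forall i j, (M <= i)%N -> (M <= j)%N ->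
     geZ (v (a i - a j)) N) ->
  exists l : K, forall N : int, exists M : nat, forall i, (M <= i)%N ->
     geZ (v (a i - l)) N.
Proof.
move=> cau; have [M hM] := choice (fun N : nat => cau N%:Z).
(* Cumulative sums give increasing indices, so consecutive terms at [m N] and [m N.+1] both lie in
   the range where differences are divisible by X^N. The limit is then a series of such
   differences. *)
pose m N := (\sum_(k < N.+1) M k)%N.
have mM N : (M N <= m N)%N by rewrite /m big_ord_recr leq_addl.
have mS N : (m N <= m N.+1)%N by rewrite /m [X in (_ <= X)%N]big_ord_recr leq_addr.
have step N : exists d, a (m N.+1) - a (m N) = XF ^ N%:Z * d%:F.
  by apply/eis_val_geP/hM; rewrite ?(leq_trans (mM N)).
have [d hd] := choice step; have [s hs] := eis_compX d.
have dist N : exists r, a (m N) - (a (m 0%N) + s%:F) = XF ^ N%:Z * r%:F.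
  have [r E] := hs N; exists (- r).
  have -> : a (m N) = a (m 0%N) + (\sum_(i < N) X ^+ i * d i)%:F.
    elim: N {r E} => [|N IH]; first by rewrite big_ord0 tofrac0 addr0.
    rewrite big_ord_recr /= tofracD addrA -IH tofrac_eisX -hd.
    by rewrite addrCA subrr addr0.
  by rewrite E tofracD tofrac_eisX tofracN mulrN; ring.
exists (a (m 0%N) + s%:F) => N; have [n Nn] : exists n : nat, N <= n%:Z.
  by exists `|N|%N; rewrite abszE ler_norm.
exists (m n) => i hi.
have : geZ (v (a i - (a (m 0%N) + s%:F))) n%:Z.
  have -> : a i - (a (m 0%N) + s%:F) = (a i - a (m n)) + (a (m n) - (a (m 0%N) + s%:F)).
    by rewrite [RHS]addrA subrK.
  apply: eis_val_geD; last exact/eis_val_geP.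
  by apply: hM; rewrite ?(leq_trans (mM n)).
by case: (v _) => //= k; apply: le_trans.
Qed.

(** The monomials are sorted by their exponent modulo e.+1. Each section is a series in X^(e+1),
    which is p in the quotient, so it represents an element of the closure of Q. *)
Lemma pser_sections (f : pser) :
  f = \sum_(i < e.+1) pserX ^+ i *
        ((fun k => if (e.+1 %| k)%N then f (k + i)%N else 0) : pser).
Proof.
apply/funext => k; rewrite pser_sum.
pose i0 := Ordinal (ltn_pmod k (ltn0Sn e)).
rewrite (bigD1 i0) //= big1 ?addr0 => [|i ne].
  have Hd : (e.+1 %| k - k %% e.+1)%N by rewrite {1}(divn_eq k e.+1) addnK dvdn_mull.
  by rewrite pserXnM ltnNge leq_mod /= Hd subnK ?leq_mod.
rewrite pserXnM; case: ltnP => // ik; case: ifP => // dv; case/eqP: ne.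
apply: val_inj => /=; rewrite -(subnK ik) -modnDml (eqP dv) add0n.
by rewrite modn_small.
Qed.

Lemma to_eis_const c : to_eis pr e (pser_const c) = c%:~R.
Proof.
have H n : pser_const n%:Z = n%:R.
  by apply/funext => k; rewrite pserMn pser1; case: k => [|k]; rewrite ?natz ?mul0rn.
case: c => n; first by rewrite H rmorph_nat.
have -> : pser_const (Negz n) = - pser_const n.+1%:Z.
  by apply/funext => -[|k]; rewrite pserN //= oppr0.
by rewrite H NegzE !rmorphN rmorph_nat.
Qed.

(** Substituting p for X^(e+1) turns a truncation into an integer, and the error is divisible by the
    first omitted power. *)
Lemma pser_lacunary_approx (g : pser) j : (forall k, ~~ (e.+1 %| k)%N -> g k = 0) ->
  exists z : int, exists h, to_eis pr e g = z%:~R + X ^+ (e.+1 * j)%N * h.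
Proof.
move=> g0; exists (\sum_(q < j) p%:R ^+ q * g (e.+1 * q)%N).
pose g' := \sum_(q < j) pserX ^+ (e.+1 * q)%N * pser_const (g (e.+1 * q)%N).
have [h hh] : exists h, g - g' = pserX ^+ (e.+1 * j)%N * h.
  apply: pserX_dvd => k kj; rewrite pserB /g' pser_sum.
  have tm (q : 'I_j) : (pserX ^+ (e.+1 * q)%N * pser_const (g (e.+1 * q)%N)) k =
      if k == (e.+1 * q)%N then g k else 0.
    rewrite pserXnM; case: (ltngtP k (e.+1 * q)%N) => // [|->]; last by rewrite subnn.
    by move=> lt; rewrite -(subnKC lt) addSnnS addKn.
  rewrite (eq_bigr _ (fun q _ => tm q)); have [dv|nd] := boolP (e.+1 %| k)%N; last first.
    by rewrite g0 // big1 ?subrr // => q _; case: ifP.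
  have [q kq] := dvdnP dv; have qj : (q < j)%N.
    by move: kj; rewrite kq mulnC ltn_mul2l.
  rewrite (bigD1 (Ordinal qj)) //= kq mulnC eqxx big1 ?addr0 ?subrr // => i ne.
  by move: ne; rewrite -val_eqE /= eqn_mul2l /= eq_sym => /negbTE ->.
exists (to_eis pr e h); rewrite -rmorphXn -rmorphM -hh rmorphB /=.
have -> : to_eis pr e g' = (\sum_(q < j) p%:R ^+ q * g (e.+1 * q)%N)%:~R.
  rewrite rmorph_sum [RHS]rmorph_sum; apply: eq_bigr => q _.
  by rewrite !rmorphM /= !rmorphXn /= to_eis_const exprM eisXe rmorph_nat.
by rewrite addrCA subrr addr0.
Qed.

(** The spanning family is 1, X, ..., X^e. A power of p clears the denominator, and the sections of
    the numerator are p-adic limits of integers. *)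
Lemma eis_fin_dim : exists (n : nat) (b : 'I_n -> K), forall x : K,
  exists c : 'I_n -> K,
    (forall i, exists r : nat -> rat, forall N : int, exists M : nat,
       forall j, (M <= j)%N -> geZ (v (ratr (r j) - c i)) N) /\
    x = \sum_(i < n) c i * b i.
Proof.
exists e.+1, (fun i => XF ^+ i) => x.
have [m [f xE]] : exists m f, x = (to_eis pr e f)%:F / p%:R ^+ m.
  have [x0|x0] := eqVneq x 0.
    by exists 0%N, 0; rewrite x0 rmorph0 tofrac0 mul0r.
  have [n [u [_ ->]]] := eis_rep_exists x0.
  (* Multiplying by p^|n| = X^((e+1)|n|) removes any pole of order at most |n|. *)
  have [k E] : exists k : nat, n + (e.+1 * `|n|)%N%:Z = k%:Z.
    exists (absz (n + (e.+1 * `|n|)%N%:Z)); rewrite gez0_abs // mulSn PoszD addrA.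
    by rewrite addr_ge0 // abszE -lerBlDl sub0r ler_normr lexx orbT.
  have [f hf] := to_eisP (X ^+ k * u); exists `|n|%N, f.
  rewrite -hf tofrac_eisX -E.
  rewrite (expfzDr _ _ (eisXF_neq0 pr e)).
  have P : (p%:R : K) ^+ `|n| = XF ^ (e.+1 * `|n|)%N%:Z.
    rewrite -eisXF_pow.
    by rewrite -exprM.
  rewrite P.
  have P0 : XF ^ (e.+1 * `|n|)%N%:Z != 0 by exact: expfz_neq0 (eisXF_neq0 pr e).
  rewrite mulrAC.
  by rewrite (mulfK P0).
pose g (i : 'I_e.+1) : pser := fun k => if (e.+1 %| k)%N then f (k + i)%N else 0.
have p0 : (p%:R ^+ m : K) != 0 by rewrite expf_neq0 ?eis_char0 ?prime_gt0.
exists (fun i => (to_eis pr e (g i))%:F / p%:R ^+ m); split; last first.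
  rewrite xE [f in LHS]pser_sections rmorph_sum rmorph_sum mulr_suml; apply: eq_bigr => i _.
  have T : (to_eis pr e (pserX ^+ i * g i))%:F = XF ^+ i * (to_eis pr e (g i))%:F.
    by rewrite (rmorphM (to_eis pr e)) tofracM (rmorphXn (to_eis pr e)) tofracXn.
  by rewrite [LHS](congr1 (fun y : K => y / p%:R ^+ m) T) -mulrA mulrC.
move=> i.
have gl k : ~~ (e.+1 %| k)%N -> g i k = 0 by rewrite /g => /negbTE ->.
have [z hz] := choice (fun j => @pser_lacunary_approx (g i) j gl).
exists (fun j => (z j)%:~R / p%:R ^+ m) => N.
(* The error has valuation at least (e+1)(j - m) >= j - m >= |N|; the m compensates the denominator
   p^m. *)
exists (`|N| + m)%N => j hj; have [h E] := hz j.
have G : geZ (v (ratr ((z j)%:~R / p%:R ^+ m) - (to_eis pr e (g i))%:F / p%:R ^+ m))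
    ((e.+1 * j)%N%:Z - (e.+1 * m)%N%:Z).
  apply/eis_val_geP; exists (- h); rewrite ratr_fracp E -mulrBl tofracD tofrac_eisX.
  rewrite -[(z j)%:~R](rmorph_int (@FracField.tofrac O)) opprD addrA subrr add0r.
  by rewrite expfzDr ?eisXF_neq0 // -eisXF_pow -exprM tofracN mulrN mulNr mulrAC -invr_expz.
move: G; case: (v _) => //= k; apply: le_trans.
rewrite -[X in X - _]natz -[X in _ - X]natz -natrB; last first.
  by rewrite leq_mul2l (leq_trans _ hj) ?leq_addl.
rewrite natz -mulnBr (le_trans (ler_norm N)) // -abszE lez_nat.
by rewrite (leq_trans (_ : _ <= j - m)%N) ?leq_pmull // leq_subRL ?(leq_trans _ hj) ?leq_addl // addnC.
Qed.

Lemma eis_padic : is_padic_field p (eis_vfield pr e).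
Proof.
rewrite /is_padic_field /=; repeat (apply: conj).
- move=> x; split; last by move=> ->; exact: eis_val0.
  move=> vx; apply/eqP/negP => /negP x0.
  by have [n hn] := eis_rep_exists x0; move: vx; rewrite (eis_valE hn).
- exact: eis_valM.
- exact: eis_val_geD.
- by move=> n; exists (XF ^ n); exact: eis_val_X.
- move=> x y /eis_val_ge0 [a ->] /eis_val_ge0 [b ->].
  by rewrite -tofracD !eis_FresE rmorphD.
- move=> x y /eis_val_ge0 [a ->] /eis_val_ge0 [b ->].
  by rewrite -tofracM !eis_FresE rmorphM.
- by rewrite -tofrac1 eis_FresE rmorph1.
- move=> x /eis_val_ge0 [a xa]; split.
    by rewrite xa eis_FresE => /eis_kerX [b ->]; apply/eis_val_geP; exists b; rewrite tofracM.
  by move=> /eis_val_geP [b ->]; rewrite expr1z -tofracM eis_FresE rmorphM /= eis_resX mul0r.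
- move=> x hx; rewrite /eis_Fres; case: pselect => // -[a xa].
  by case: hx; apply/eis_val_ge0; exists a.
- move=> c; have [a <-] := @eis_res_surj p pr e c; exists a%:F; rewrite eis_FresE; split=> //.
  by apply/eis_val_ge0; exists a.
- exact: eis_char0.
- by move=> n hn; rewrite natr_tofrac eis_val_unit // res_nat.
- by exists e.+1%:Z; rewrite eis_val_p.
- exact: eis_complete.
- exact: eis_fin_dim.
Qed.

End EisensteinPadic.

(** * Pairwise non-isomorphism of these fields *)

Lemma field_iso_span (F1 F2 E : fieldType) : field_iso F1 E -> field_iso F2 E ->
  exists f : F1 -> F2, (forall x y, f (x + y) = f x + f y) /\
    (forall x y, f (x * y) = f x * f y) /\ f 1 = 1.
Proof.
move=> [f [_ [fD [fM f1]]]] [g [[h gK hK] [gD [gM g1]]]].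
have gi : injective g := can_inj gK.
exists (h \o f); split; last split.
- by move=> x y; apply: gi; rewrite /= hK fD gD !hK.
- by move=> x y; apply: gi; rewrite /= hK fM gM !hK.
- by apply: gi; rewrite /= hK f1 g1.
Qed.

Section EisensteinIso.
Variables (p : nat) (pr : prime p).

(* A field morphism carries the e-th root of p to an e-th root of p, so e divides e'. *)
Lemma eis_field_hom_dvd e e' (f : eis_field pr e -> eis_field pr e') :
  (forall x y, f (x + y) = f x + f y) -> (forall x y, f (x * y) = f x * f y) ->
  f 1 = 1 -> (e.+1 %| e'.+1)%N.
Proof.
move=> fD fM f1.
have f0 : f 0 = 0 by apply: (addIr (f 0)); rewrite -fD !add0r.
have fn n : f n%:R = n%:R by elim: n => [|n IH] //; rewrite !mulrSr fD IH f1.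
have fX x n : f (x ^+ n) = f x ^+ n.
  by elim: n => [|n IH]; rewrite ?expr0 // !exprS fM IH.
have E : f (eisXF pr e) ^+ e.+1 = p%:R by rewrite -fX eisXF_pow fn.
have [z0|nz] := eqVneq (f (eisXF pr e)) 0.
  by have := eis_char0 pr e' (prime_gt0 pr); rewrite -E z0 expr0n eqxx.
have [n hn] := eis_rep_exists nz; have vn := eis_valE hn.
have vX k : eis_val (f (eisXF pr e) ^+ k.+1) = Some (k.+1%:Z * n).
  elim: k => [|k IH]; first by rewrite expr1 vn mul1r.
  by rewrite exprS eis_valM IH vn /=; congr Some; rewrite -[in RHS]add1n PoszD mulrDl mul1r.
have := vX e; rewrite E eis_val_p => -[h].
apply/dvdnP; exists `|n|%N.
by rewrite -[LHS]absz_nat h abszM absz_nat mulnC.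
Qed.

(** Pigeonhole: if n + 1 consecutive indices all met n forbidden classes, two of the fields would
    share a class, and divisibility in both directions would make their indices equal. *)
Lemma eis_field_avoid (n N0 : nat) (E : nat -> fieldType) : exists e, (N0 <= e)%N /\
  forall i, (i < n)%N -> ~ field_iso (eis_field pr e) (E i).
Proof.
apply: contrapT => H.
have G (k : 'I_n.+1) : exists i : 'I_n, field_iso (eis_field pr (N0 + k)) (E i).
  apply: contrapT => K; apply: H; exists (N0 + k)%N; rewrite leq_addr; split=> // i hi iso.
  by apply: K; exists (Ordinal hi).
have [c hc] := choice G.
have : ~~ injectiveb c.
  apply/negP => /injectiveP /leq_card; rewrite !card_ord; lia.
move/injectivePn => [k [k' ne eq]].
have [f [fD [fM f1]]] := field_iso_span (hc k) (eq_ind_r (fun i => field_iso _ (E (nat_of_ord i))) (hc k') eq).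
have [g [gD [gM g1]]] := field_iso_span (hc k') (eq_ind (c k) (fun i => field_iso _ (E (nat_of_ord i))) (hc k) _ eq).
have d1 := eis_field_hom_dvd fD fM f1; have d2 := eis_field_hom_dvd gD gM g1.
have /eqP : (N0 + k).+1 = (N0 + k').+1 by apply/eqP; rewrite eqn_dvd d1 d2.
by rewrite eqSS eqn_add2l => /eqP kk; case/eqP: ne; apply: val_inj.
Qed.

End EisensteinIso.

(** * An Artin-Schreier criterion *)

Definition prel (p m n : nat) : Prop :=
  [/\ (0 < m)%N, (0 < n)%N & exists k, m = (n * p ^ k)%N \/ n = (m * p ^ k)%N].

Section ArtinSchreier.
Variables (K : fieldType) (v : K -> vgroup) (s : int -> K) (p : nat) (e : int).
Hypothesis v0 : forall x, v x = None <-> x = 0.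
Hypothesis vM : forall x y, v (x * y) = addG (v x) (v y).
Hypothesis vD : forall x y n, geZ (v x) n -> geZ (v y) n -> geZ (v (x + y)) n.
Hypothesis pr : prime p.
Hypothesis vp : v p%:R = Some e.
Hypothesis e_gt0 : 0 < e.
Hypothesis vs : forall n, v (s n) = Some n.
Hypothesis sD : forall m n, s (m + n) = s m * s n.

Local Notation ge x n := (geZ (v x) n).

Lemma val_some x : x != 0 -> exists n, v x = Some n.
Proof. by case E: (v x) => [n|]; [exists n | rewrite (proj1 (v0 x) E) eqxx]. Qed.

Lemma val1 : v 1 = Some 0.
Proof.
have [n hn] := val_some (oner_neq0 K).
have := vM 1 1; rewrite mulr1 hn /= => -[h]; congr Some; lia.
Qed.

Lemma valN x : v (- x) = v x.
Proof.
have [n hn] : exists n, v (-1) = Some n by apply: val_some; rewrite oppr_eq0 oner_eq0.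
have : v (-1 * -1) = Some 0 by rewrite mulrNN mulr1 val1.
rewrite vM hn => -[h]; have n0 : n = 0 by lia.
by rewrite -mulN1r vM hn n0; case: (v x) => //= m; rewrite add0r.
Qed.

Lemma geN x n : ge x n -> ge (- x) n.
Proof. by rewrite valN. Qed.

Lemma geB x y n : ge x n -> ge y n -> ge (x - y) n.
Proof. by move=> hx /geN; exact: vD. Qed.

Lemma ge_le x m n : m <= n -> ge x n -> ge x m.
Proof. by case: (v x) => //= k; lia. Qed.

Lemma geM x y m n : ge x m -> ge y n -> ge (x * y) (m + n).
Proof. by rewrite vM; case: (v x) => //= a; case: (v y) => //= b; lia. Qed.

Lemma ge0 n : ge 0 n.
Proof. by have /v0 -> : (0 : K) = 0 by []. Qed.

Lemma geX x n k : ge x n -> ge (x ^+ k) (n * k%:Z).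
Proof.
move=> hx; elim: k => [|k IH]; first by rewrite expr0 val1 mulr0.
by rewrite exprS; have := geM hx IH; rewrite -addn1 PoszD; congr geZ; lia.
Qed.

Lemma ge_nat n : ge n%:R 0.
Proof.
elim: n => [|n IH]; first exact: ge0.
by rewrite mulrSr; apply: vD => //; rewrite val1.
Qed.

Lemma ge_sum (I : Type) (r : seq I) (P : pred I) (F : I -> K) n :
  (forall i, P i -> ge (F i) n) -> ge (\sum_(i <- r | P i) F i) n.
Proof.
move=> H; elim/big_rec: _ => [|i x Pi hx]; first exact: ge0.
by apply: vD => //; exact: H.
Qed.

Lemma valX x n k : v x = Some n -> v (x ^+ k) = Some (n * k%:Z).
Proof.
move=> hx; elim: k => [|k IH]; first by rewrite expr0 val1 mulr0.
by rewrite exprS vM hx IH /=; congr Some; lia.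
Qed.

Lemma val_strict x y n : v x = Some n -> ge y (n + 1) -> v (x + y) = Some n.
Proof.
move=> hx hy; have : ge (x + y) n.
  by apply: vD; [rewrite hx /= | apply: ge_le hy; lia].
have : ~ ge (x + y) (n + 1).
  by move=> h; have := geB h hy; rewrite addrK hx /=; lia.
case: (v (x + y)) => [m|] //= h1 h2; congr Some; lia.
Qed.

(** Pole order at most e/p: this is what makes p times a product of p such elements integral. *)
Definition small x := exists n, ge x n /\ - e <= p%:Z * n.

Lemma smallN x : small x -> small (- x).
Proof. by move=> [n [h1 h2]]; exists n; split=> //; exact: geN. Qed.

Lemma small2 x y : small x -> small y -> exists n, [/\ ge x n, ge y n & - e <= p%:Z * n].
Proof.
move=> [n [h1 h2]] [m [h3 h4]]; exists (Num.min n m).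
case: (leP n m) => nm; split=> //; first exact: ge_le h3.
exact: ge_le (ltW nm) h1.
Qed.

Lemma smallD x y : small x -> small y -> small (x + y).
Proof. by move=> hx hy; have [n [h1 h2 h3]] := small2 hx hy; exists n; split=> //; exact: vD. Qed.

Lemma small0 : small 0.
Proof. by exists 0; split; [exact: ge0 | lia]. Qed.

Definition wp (z : K) := z ^+ p - z.

(** Each mixed binomial coefficient is divisible by p and contributes valuation e, while the p small
    factors lose at most e. *)
Lemma frobenius_ge0 x y : small x -> small y -> ge ((x + y) ^+ p - (x ^+ p + y ^+ p)) 0.
Proof.
move=> hx hy; have [n [h1 h2 h3]] := small2 hx hy.
rewrite exprDn; case: p pr h3 vp => // q prq h3 vq.
rewrite big_ord_recl big_ord_recr /= bin0 binn subn0 subnn !expr0 mulr1 mul1r.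
set S := \sum_(i < q) _.
have -> : x ^+ q.+1 *+ 1 + (S + y ^+ (0 + q.+1)%N *+ 1) - (x ^+ q.+1 + y ^+ q.+1) = S.
  by rewrite !mulr1n add0n; ring.
apply: ge_sum => i _; rewrite /bump /= add1n.
have /dvdnP [c ->] : (q.+1 %| 'C(q.+1, i.+1))%N.
  by apply: prime_dvd_bin => //; rewrite !ltnS ltn_ord.
rewrite -mulr_natr natrM.
have gq : ge q.+1%:R e by rewrite vq /=.
have := geM (geM (geX (q.+1 - i.+1) h1) (geX i.+1 h2)) (geM (ge_nat c) gq); apply: ge_le.
rewrite -mulrDr -PoszD subnK ?ltnS 1?ltnW // add0r; lia.
Qed.

Lemma wpD x y : small x -> small y -> ge (wp (x + y) - (wp x + wp y)) 0.
Proof.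
move=> hx hy; have := frobenius_ge0 hx hy.
by rewrite /wp; set a := (x + y) ^+ p; congr (geZ (v _) _); ring.
Qed.

(** Congruence modulo integral elements and the Artin-Schreier image of small elements. Restricting
    z to small elements is what makes it an equivalence relation, by [wpD]. *)
Definition asim a b := exists z, small z /\ ge (wp z - (a - b)) 0.

Lemma asim_refl a : asim a a.
Proof.
exists 0; split; first exact: small0.
by rewrite /wp expr0n (gtn_eqF (prime_gt0 pr)) !subrr; exact: ge0.
Qed.

Lemma asim_sym a b : asim a b -> asim b a.
Proof.
move=> [z [sz hz]]; exists (- z); split; first exact: smallN.
have := vD (wpD sz (smallN sz)) hz; rewrite subrr {1}/wp expr0n (gtn_eqF (prime_gt0 pr)).
by move/geN; congr (geZ (v _) _); rewrite /=; ring.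
Qed.

Lemma asim_trans b a c : asim a b -> asim b c -> asim a c.
Proof.
move=> [z [sz hz]] [w [sw hw]]; exists (z + w); split; first exact: smallD.
by have := vD (wpD sz sw) (vD hz hw); congr (geZ (v _) _); ring.
Qed.

Lemma cross0 : s 0 = 1.
Proof.
have s00 : s 0 != 0 by apply/eqP => /v0; rewrite vs.
by apply: (mulfI s00); rewrite -sD addr0 mulr1.
Qed.

Lemma crossX n k : s n ^+ k = s (n * k%:Z).
Proof.
elim: k => [|k IH]; first by rewrite mulr0 cross0.
by rewrite exprS IH -sD; congr s; lia.
Qed.

(** The witness is s(-n) itself, because its p-th power is s(-np). *)
Lemma asim_step n : n%:Z * p%:Z <= e -> asim (s (- (n * p)%N%:Z)) (s (- n%:Z)).
Proof.
move=> le; exists (s (- n%:Z)); split; first by exists (- n%:Z); rewrite vs /=; split=> //; lia.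
by rewrite /wp crossX PoszM mulNr subrr; exact: ge0.
Qed.

Lemma asim_pow n k : (n * p ^ k)%N%:Z <= e -> asim (s (- (n * p ^ k)%N%:Z)) (s (- n%:Z)).
Proof.
have p1 := prime_gt0 pr; elim: k => [|k IH] le; first by rewrite muln1; exact: asim_refl.
have E : (n * p ^ k.+1 = n * p ^ k * p)%N by rewrite expnSr mulnA.
have le' : ((n * p ^ k)%N%:Z * p%:Z <= e) by rewrite -PoszM -E.
apply: asim_trans (IH _); first by rewrite E; exact: asim_step.
by apply: le_trans le'; rewrite -PoszM lez_nat leq_pmulr.
Qed.

(** The larger pole order r would be the pole order of z^p - z, but such a pole has order divisible
    by p. *)
Lemma asim_coprime r t : ~~ (p %| r)%N -> ~~ (p %| t)%N -> (0 < r)%N -> (t < r)%N ->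
  ~ asim (s (- r%:Z)) (s (- t%:Z)).
Proof.
move=> pnr pnt r0 tr [z [_ hz]].
have V : v (s (- r%:Z) - s (- t%:Z)) = Some (- r%:Z).
  by apply: val_strict; rewrite ?vs ?valN ?vs //=; lia.
have W : v (wp z) = Some (- r%:Z).
  by rewrite -(subrK (s (- r%:Z) - s (- t%:Z)) (wp z)) addrC; apply: val_strict => //; apply: ge_le hz; lia.
have : ~ ge (wp z) 0 by rewrite W /=; lia.
case E: (v z) => [k|]; last first.
  by case; rewrite /wp (proj1 (v0 z) E) expr0n (gtn_eqF (prime_gt0 pr)) subrr; exact: ge0.
have [k0|k0] := lerP 0 k.
  have hk : ge z 0 by rewrite E.
  by have := geX p hk; rewrite mul0r => hp; case; exact: geB hp hk.
have : v (wp z) = Some (k * p%:Z).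
  apply: val_strict; first exact: valX.
  by rewrite valN E /=; have := prime_gt1 pr; nia.
rewrite W => -[h] _; case/negP: pnr; apply/dvdnP; exists `|k|%N; lia.
Qed.

(** Smallness of the witness is automatic, so the formula does not have to state it: a pole of order
    k of z becomes one of order pk, and the other side has poles of order at most e. *)
Lemma wp_small m n z : (0 < m)%N -> (0 < n)%N -> m%:Z <= e -> n%:Z <= e ->
  ge (wp z - (s (- m%:Z) - s (- n%:Z))) 0 -> small z.
Proof.
move=> m0 n0 me ne hz; case E: (v z) => [k|]; last by exists 0; rewrite E; split=> //; lia.
exists k; rewrite E /=; split=> //.
have [k0|k0] := lerP 0 k; first by nia.
have V : v (wp z) = Some (k * p%:Z).
  apply: val_strict; first exact: valX.
  by rewrite valN E /=; have := prime_gt1 pr; nia.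
have : ge (wp z) (- e).
  rewrite -(subrK (s (- m%:Z) - s (- n%:Z)) (wp z)); apply: vD; first by apply: ge_le hz; lia.
  by apply: geB; rewrite vs /=; lia.
by rewrite V /= mulrC.
Qed.

Lemma artin_schreier m n : (0 < m)%N -> (0 < n)%N -> m%:Z <= e -> n%:Z <= e ->
  (exists z, ge (z ^+ p - (z + (s (- m%:Z) - s (- n%:Z)))) 0) <-> prel p m n.
Proof.
move=> m0 n0 me ne; split; last first.
  case=> _ _ [k E]; have [z [_ hz]] : asim (s (- m%:Z)) (s (- n%:Z)).
    by case: E => E; [rewrite E in me * | rewrite E in ne *; apply: asim_sym]; apply: asim_pow.
  by exists z; rewrite opprD addrA.
move=> [z hz]; split=> //.
have : asim (s (- m%:Z)) (s (- n%:Z)).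
  have hz' : ge (wp z - (s (- m%:Z) - s (- n%:Z))) 0 by rewrite /wp -addrA -opprD.
  by exists z; split=> //; exact: wp_small hz'.
(* Both exponents are replaced by their parts prime to p; if these differed, [asim_coprime] would
   apply in one order or the other. *)
have [r cr Er] := pfactor_coprime pr m0; have [t ct Et] := pfactor_coprime pr n0.
rewrite !prime_coprime // in cr ct.
move: (logn p m) (logn p n) Er Et => a b Er Et.
have A1 : asim (s (- m%:Z)) (s (- r%:Z)) by rewrite Er; apply: asim_pow; rewrite -Er.
have A2 : asim (s (- n%:Z)) (s (- t%:Z)) by rewrite Et; apply: asim_pow; rewrite -Et.
move=> A; have B : asim (s (- r%:Z)) (s (- t%:Z)).
  exact: asim_trans (asim_trans (asim_sym A1) A) A2.
have r0 : (0 < r)%N by move: m0; rewrite Er muln_gt0 => /andP [].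
have t0 : (0 < t)%N by move: n0; rewrite Et muln_gt0 => /andP [].
have rt : r = t.
  case: (ltngtP r t) => // lt.
    by case: (asim_coprime ct cr t0 lt); exact: asim_sym.
  by case: (asim_coprime cr ct r0 lt).
case: (leqP a b) => ab.
  by exists (b - a)%N; right; rewrite Et Er -rt -mulnA -expnD subnKC.
by exists (a - b)%N; left; rewrite Et Er -rt -mulnA -expnD subnKC // ltnW.
Qed.

End ArtinSchreier.

Local Close Scope quotient_scope.
Local Close Scope ring_scope.
Local Open Scope nat_scope.

(** * Arithmetic with powers of p *)

Fixpoint encode W (f : nat -> nat) T :=
  if T is T'.+1 then f 0 + encode W (fun i => f i.+1) T' * W else 0.

Lemma encode_lt W f T : (forall i, i < T -> f i < W) -> encode W f T < W ^ T.
Proof.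
elim: T f => [|T IH] f fW //=; rewrite expnSr.
have := IH _ (fun i (h : i < T) => fW i.+1 h); have := fW 0 isT; nia.
Qed.

Lemma encode_digit W f T i : (forall i, i < T -> f i < W) -> i < T ->
  (encode W f T %/ W ^ i) %% W = f i.
Proof.
elim: T f i => [|T IH] f i fW //= iT.
have W0 : 0 < W by have := fW 0 isT; lia.
case: i iT => [|i] iT; first by rewrite divn1 addnC modnMDl modn_small ?fW.
rewrite expnS divnMA addnC divnMDl // (divn_small (fW 0 isT)) addn0.
by rewrite (IH (fun i => f i.+1)) // => k kT; exact: fW.
Qed.

Lemma digit_unique x q W v y y' d : v < q -> d < W -> x = v + y * q -> y = d + y' * W ->
  d = (x %/ q) %% W.
Proof.
move=> vq dW -> ->; rewrite addnC divnMDl; last by lia.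
by rewrite divn_small // addn0 addnC modnMDl modn_small.
Qed.

Lemma pow_pred_dvd d i : 0 < d -> d %| d.+1 ^ i - 1.
Proof.
move=> d0; rewrite -eqn_mod_dvd ?expn_gt0 //; elim: i => [|i IH]; first by rewrite expn0.
by rewrite expnS -modnMmr (eqP IH) modnMmr muln1 -[d.+1]addn1 modnDl.
Qed.

Definition repunit W i := (W ^ i - 1) %/ (W - 1).

(** The geometric sum in a form free of subtraction and division, as it can be stated by linear
    atoms. *)
Lemma repunitE W i : 1 < W -> W ^ i + repunit W i = 1 + repunit W i * W.
Proof.
move=> W1; have := @pow_pred_dvd (W - 1) i; rewrite subn_gt0 W1 => /(_ isT) /divnK.
have -> : (W - 1).+1 = W by lia.
have : 0 < W ^ i by rewrite expn_gt0; lia.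
by rewrite /repunit; nia.
Qed.

Lemma repunit_mod W i : 1 < W -> repunit W i = i %[mod W - 1].
Proof.
move=> W1; elim: i => [|i IH]; first by rewrite /repunit expn0 subnn div0n.
have E := repunitE i W1; have E' := repunitE i.+1 W1.
have -> : repunit W i.+1 = repunit W i * (W - 1) + (1 + repunit W i).
  by rewrite expnS in E'; nia.
by rewrite modnMDl -modnDmr IH modnDmr add1n.
Qed.

Lemma repunit_le W i : 1 < W -> repunit W i <= W ^ i.
Proof. by move=> W1; rewrite (leq_trans (leq_div _ _)) // leq_subr. Qed.

Section PowerArithmetic.
Variable p : nat.
Hypothesis pr : prime p.
Let p1 : 1 < p := prime_gt1 pr.
Let p0 : 0 < p := prime_gt0 pr.

Lemma prel1 q : prel p 1 q <-> exists k, q = p ^ k.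
Proof.
split; first by move=> [_ q0 [k [E|->]]]; [exists 0; nia | exists k; rewrite mul1n].
by move=> [k ->]; split; rewrite ?expn_gt0 ?p0 //; exists k; right; rewrite mul1n.
Qed.

Lemma pow_coprime_eq a b u w : ~~ (p %| u) -> ~~ (p %| w) -> u * p ^ a = w * p ^ b ->
  a = b /\ u = w.
Proof.
move=> pu pw E.
have u0 : 0 < u by case: u pu {E} => //; rewrite dvdn0.
have w0 : 0 < w by case: w pw {E} => //; rewrite dvdn0.
have lu : logn p u = 0 by apply/eqP; rewrite -leqn0 leqNgt logn_gt0 mem_primes pr u0 (negbTE pu).
have lw : logn p w = 0 by apply/eqP; rewrite -leqn0 leqNgt logn_gt0 mem_primes pr w0 (negbTE pw).
have ab : a = b.
  by have := congr1 (logn p) E; rewrite !lognM ?expn_gt0 ?p0 // lu lw !pfactorK.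
split=> //; move/eqP: E; rewrite ab eqn_pmul2r ?expn_gt0 ?p0 //; by move/eqP.
Qed.

Lemma ndvd_powS a : 0 < a -> ~~ (p %| p ^ a + 1).
Proof.
case: a => // a _; rewrite dvdn_addr ?expnS ?dvdn_mulr //.
by rewrite dvdn1; apply/eqP => h; move: p1; rewrite h.
Qed.

(* Comparing Y + 1 with Y' + q forces Y' = Y * q; since n < Y and m < Y', comparing Y + n with
   Y' + m then forces the same multiplier q, that is m = n * q. *)
Definition shifted_mul (n q m Y Y' : nat) : Prop :=
  [/\ prel p 1 q, prel p 1 Y, prel p 1 Y' & 1 < Y] /\
  [/\ q < Y', prel p (Y + 1) (Y' + q), n < Y, m < Y' & prel p (Y + n) (Y' + m)].

Lemma shifted_mul_sound n q m Y Y' : shifted_mul n q m Y Y' -> m = n * q.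
Proof.
move=> [[/prel1 [c ->] /prel1 [a ->] /prel1 [b ->] Y1] [qY' [_ _ [k E]] nY mY' [_ _ [l F]]]].
have cb : c < b by rewrite ltn_exp2l in qY'.
have a0 : 0 < a by case: a Y1 {E F nY}.
have bc0 : 0 < b - c by rewrite subn_gt0.
(* Since c < b the first factor is prime to p, and so is p^a + 1; hence the parts prime to p can be
   compared. *)
have Eb : p ^ b + p ^ c = (p ^ (b - c) + 1) * p ^ c by rewrite mulnDl mul1n -expnD subnK // ltnW.
have Y'E : p ^ b = p ^ a * p ^ c.
  case: E => E.
    rewrite Eb -mulnA -expnD -[LHS]muln1 -(expn0 p) in E.
    have [h1 h2] := pow_coprime_eq (ndvd_powS a0) (ndvd_powS bc0) E.
    have c0 : c = 0 by lia.
    rewrite c0 subn0 in h2 *; rewrite muln1; lia.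
  rewrite Eb in E; have [h1 h2] := pow_coprime_eq (ndvd_powS bc0) (ndvd_powS a0) E.
  have h3 : p ^ (b - c) = p ^ a by lia.
  by rewrite -h3 -expnD subnK // ltnW.
rewrite Y'E in F mY'.
have pk k' : 0 < p ^ k' by rewrite expn_gt0 p0.
(* In the first case Y + n < 2Y is a multiple of Y' + m >= Y q, which leaves only q = 1 and
   equality. *)
case: F => F.
  have c0 : c = 0.
    case: c {qY' cb bc0 Eb E Y'E} F mY' => // c F mY'; exfalso.
    have : 2 * p ^ a <= p ^ a * p ^ c.+1 by rewrite mulnC leq_mul2l (leq_trans p1) ?orbT // expnS leq_pmulr.
    by have := pk l; nia.
  rewrite c0 !muln1 in F mY' *.
  have l0 : l = 0.
    case: l F => // l F; exfalso; have : 2 <= p ^ l.+1 by rewrite (leq_trans p1) // expnS leq_pmulr.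
    by nia.
  by rewrite l0 muln1 in F; lia.
(* Here Y <= Y + n < 2Y and Y q <= Y' + m < 2Y q, so p^l and p^c differ by a factor strictly between
   1/2 and 2, which forces l = c. *)
have [lc|cl|lc] := ltngtP l c.
- exfalso; have : 2 * p ^ l <= p ^ c.
    by rewrite (leq_trans (leq_mul p1 (leqnn _))) // -expnS leq_exp2l.
  by have := pk l; have := pk a; nia.
- exfalso; have : 2 * p ^ c <= p ^ l.
    by rewrite (leq_trans (leq_mul p1 (leqnn _))) // -expnS leq_exp2l.
  by have := pk c; have := pk a; nia.
- by rewrite lc in F; nia.
Qed.

(** A power of p above n. At n = 0 it is p and not 1, because [shifted_mul] asks for 1 < Y. *)
Definition ceil_pow n := p ^ (trunc_log p n).+1.

Lemma shifted_mul_complete n q : prel p 1 q ->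
  shifted_mul n q (n * q) (ceil_pow n) (ceil_pow n * q).
Proof.
move=> /[dup] hq /prel1 [c qE].
have q0 : 0 < q by rewrite qE expn_gt0 p0.
have nY : n < ceil_pow n by exact: trunc_log_ltn.
have Y1 : 1 < ceil_pow n by rewrite /ceil_pow (leq_trans p1) // expnS leq_pmulr // expn_gt0 p0.
split; split=> //.
- by apply/prel1; exists (trunc_log p n).+1.
- by apply/prel1; exists ((trunc_log p n).+1 + c); rewrite expnD qE.
- nia.
- split; try lia; exists c; right; rewrite -qE; nia.
- nia.
- split; try lia; exists c; right; rewrite -qE; nia.
Qed.

(** The auxiliary powers exceed the numbers being multiplied by at most a factor p, so they still
    fit into a window enlarged by p. *)
Lemma ceil_pow_le n q : ceil_pow n * q <= p * maxn (n * q) q.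
Proof.
rewrite /ceil_pow expnS -mulnA leq_mul2l; apply/orP; right.
case: n => [|n]; first by rewrite trunc_log0 expn0 mul1n leq_maxr.
by apply: leq_trans (leq_maxl _ _); rewrite leq_mul2r trunc_logP ?orbT.
Qed.

(** Modulo p^w - 1 the power p^j reduces to p^(j mod w), which is below p^w and therefore has to be
    1. *)
Lemma pow_pred_dvd_exp w j : 0 < w -> p ^ w - 1 %| p ^ j - 1 -> w %| j.
Proof.
move=> w0 dv; have W1 : 1 < p ^ w by rewrite -(expn0 p) ltn_exp2l.
have [d dE] : exists d, p ^ w = d.+1 by exists (p ^ w).-1; lia.
have d0 : 0 < d by lia.
rewrite dE subn1 /= in dv; rewrite /dvdn.
have r0 : 0 < p ^ (j %% w) by rewrite expn_gt0 p0.
have jE : p ^ j = p ^ (j %% w) * d.+1 ^ (j %/ w).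
  by rewrite -dE -expnM -expnD mulnC addnC -divn_eq.
have : d %| p ^ (j %% w) - 1.
  have dv' : p ^ j == 1 %[mod d] by rewrite eqn_mod_dvd // expn_gt0 p0.
  rewrite -eqn_mod_dvd //.
  have : d.+1 ^ (j %/ w) == 1 %[mod d] by rewrite eqn_mod_dvd ?expn_gt0 // pow_pred_dvd.
  move/eqP => h; rewrite jE -modnMmr h modnMmr muln1 in dv'; exact: dv'.
have lt : p ^ (j %% w) - 1 < d.
  have : p ^ (j %% w) < p ^ w by rewrite ltn_exp2l // ltn_mod.
  by rewrite dE; lia.
move/dvdn_leq => h; have : p ^ (j %% w) <= 1 by case: (posnP (p ^ (j %% w) - 1)) => [|/h]; lia.
by rewrite -(expn0 p) leq_exp2l // leqn0.
Qed.

(* q = W ^ i is recognised by W - 1 | q - 1; the quotient b = 1 + W + ... + W ^ (i - 1) is congruent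
   to i modulo W - 1, which recovers t = i from q as long as i < W - 1. *)
Definition row_index (W q t b b' c c' : nat) : Prop :=
  [/\ prel p 1 q, b' = b * W, q + b = 1 + b', c' = c * W & b + c = t + c' /\ t + 1 < W].

Lemma row_index_sound w q t b b' c c' : 0 < w -> row_index (p ^ w) q t b b' c c' ->
  exists i, q = (p ^ w) ^ i /\ t = i %% (p ^ w - 1).
Proof.
move=> w0 [/prel1 [j ->] -> E1 -> [E2 tW]].
have W1 : 1 < p ^ w by rewrite -(expn0 p) ltn_exp2l.
have : p ^ w - 1 %| p ^ j - 1 by apply/dvdnP; exists b; nia.
move/(pow_pred_dvd_exp w0)/dvdnP => [i ji]; exists i.
have jE : p ^ j = (p ^ w) ^ i by rewrite ji mulnC expnM.
split=> //; have E := repunitE i W1; rewrite -jE in E.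
have bE : b = repunit (p ^ w) i by nia.
rewrite -repunit_mod // -bE.
have -> : b = c * (p ^ w - 1) + t by nia.
by rewrite modnMDl modn_small //; lia.
Qed.

Lemma row_index_complete w i : 0 < w -> let W := p ^ w in
  let b := repunit W i in let c := b %/ (W - 1) in
  row_index W (W ^ i) (i %% (W - 1)) b (b * W) c (c * W).
Proof.
move=> w0 W b c.
have W1 : 1 < W by rewrite -(expn0 p) ltn_exp2l.
split=> //; first by apply/prel1; exists (w * i); rewrite expnM.
  exact: repunitE.
rewrite -repunit_mod // -/b; have := divn_eq b (W - 1); rewrite -/c.
have := ltn_pmod b (_ : 0 < W - 1); rewrite subn_gt0 => /(_ W1).
by split; nia.
Qed.

(** w is the least exponent with j/w + 2 <= p^w. The lower bound on W = p^w leaves room for indices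
    and digits up to T; minimality gives the upper bound, which keeps T from being small. *)
Lemma window_parameters j : 1 < j -> exists w T r,
  [/\ 0 < w, 0 < T, j = w * T + r & r < w] /\ T + 2 <= p ^ w <= 2 * p * (T + 2).
Proof.
move=> j1.
have ex : exists w, (0 < w) && (j %/ w + 2 <= p ^ w).
  exists j.+1; rewrite divn_small //= add0n.
  by rewrite (leq_trans p1) // -{1}(expn1 p) leq_exp2l.
case: (ex_minnP ex) => w /andP [w0 hw] min.
have jE := divn_eq j w; have rw := ltn_pmod j w0.
have main : 0 < j %/ w /\ p ^ w <= 2 * p * (j %/ w + 2).
  case: w w0 hw min jE rw => // -[_ _ _ _ _|w _ hw min jE rw].
    by rewrite divn1 expn1; split; nia.
  have nm : p ^ w.+1 < j %/ w.+1 + 2.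
    by rewrite ltnNge; apply/negP => h; have := min w.+1; rewrite h /= ltnn => /(_ isT).
  have d1 : j %/ w.+1 * w.+1 <= j by exact: leq_trunc_div.
  have pw : w.+2 <= p ^ w.+1 by exact: ltn_expl.
  have T0 : 0 < j %/ w.+2.
    rewrite divn_gt0 //; case: w {hw min jE rw} nm d1 pw => [|w] nm d1 pw; first by lia.
    by nia.
  split=> //; rewrite expnS.
  (* Raising the divisor by one at most about halves the quotient, which gives the factor 2; raising
     the exponent by one gives the factor p. *)
  have : j %/ w.+1 <= 2 * (j %/ w.+2) + 1 by nia.
  by nia.
exists w, (j %/ w), (j %% w); rewrite hw mulnC; case: main => T0 ->; split=> //.
Qed.

End PowerArithmetic.

(** * Formulas over the value group *)

Inductive lterm := LV of nat | LZ | LA of lterm & lterm.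
Inductive lform :=
  | LEq of lterm & lterm | LLt of lterm & lterm
  | LAnd of lform & lform | LImp of lform & lform | LFalse.
Inductive atom := AF of lform | AR of lterm & lterm.

Fixpoint lconst c := if c is c'.+1 then LA (lconst c') (LV 0) else LZ.
Fixpoint lmul c t := if c is c'.+1 then LA (lmul c' t) t else LZ.

Fixpoint lev (r : nat -> nat) t :=
  match t with LV i => r i | LZ => 0 | LA a b => lev r a + lev r b end.

Fixpoint lsem r f : Prop :=
  match f with
  | LEq a b => lev r a = lev r b
  | LLt a b => lev r a < lev r b
  | LAnd f g => lsem r f /\ lsem r g
  | LImp f g => lsem r f -> lsem r g
  | LFalse => False
  end.

Definition asem p r a : Prop :=
  match a with AF f => lsem r f | AR a b => prel p (lev r a) (lev r b) end.

Fixpoint csem p r (s : seq atom) : Prop :=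
  if s is a :: s' then asem p r a /\ csem p r s' else True.

Lemma csem_cat p r s1 s2 : csem p r (s1 ++ s2) <-> csem p r s1 /\ csem p r s2.
Proof. by elim: s1 => [|a s IH] /=; tauto. Qed.

Lemma csem_flatten p r (I : eqType) (F : I -> seq atom) (s : seq I) :
  csem p r (flatten (map F s)) <-> forall i, i \in s -> csem p r (F i).
Proof.
elim: s => [|a s IH] /=; first by split.
rewrite csem_cat IH; split.
  by move=> [h1 h2] i; rewrite inE => /orP [/eqP ->|/h2].
by move=> h; split; [apply: h; rewrite inE eqxx | move=> i si; apply: h; rewrite inE si orbT].
Qed.

Lemma lev_const r c : r 0 = 1 -> lev r (lconst c) = c.
Proof. by move=> r0; elim: c => //= c ->; rewrite r0 addn1. Qed.

Lemma lev_mul r c t : lev r (lmul c t) = c * lev r t.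
Proof. by elim: c => //= c ->; rewrite mulSn addnC. Qed.

Fixpoint lterm_ok n t : bool :=
  match t with LV i => i < n | LZ => true | LA a b => lterm_ok n a && lterm_ok n b end.
Fixpoint lform_ok n f : bool :=
  match f with
  | LEq a b | LLt a b => lterm_ok n a && lterm_ok n b
  | LAnd f g | LImp f g => lform_ok n f && lform_ok n g
  | LFalse => true
  end.
(** The Artin-Schreier criterion needs arguments at most v(p). Guarded variables are at most half of
    it, so a sum of two is still allowed; variable 1 carries the parameter N, which has no guard. *)
Definition small_arg t : bool :=
  match t with LV i => i != 1 | LA (LV i) (LV j) => (i != 1) && (j != 1) | _ => false end.
Definition atom_ok n a : bool :=
  match a with
  | AF f => lform_ok n f
  | AR a b => [&& lterm_ok n a, lterm_ok n b, small_arg a & small_arg b]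
  end.

Lemma lterm_ok_const n c : 0 < n -> lterm_ok n (lconst c).
Proof. by move=> n0; elim: c => //= c ->. Qed.

Lemma lterm_ok_mul n c t : lterm_ok n t -> lterm_ok n (lmul c t).
Proof. by move=> h; elim: c => //= c ->. Qed.

(* A natural number n is represented by the element -n of the value group. *)
Fixpoint lg t : term SG :=
  match t with LV i => Var SG i | LZ => GZero | LA a b => GAdd (lg a) (lg b) end.

Fixpoint ltr f : formula :=
  match f with
  | LEq a b => FEq (lg a) (lg b)
  | LLt a b => FLt (lg b) (lg a)
  | LAnd f g => FAnd (ltr f) (ltr g)
  | LImp f g => FImp (ltr f) (ltr g)
  | LFalse => FLt GZero GZero
  end.

Fixpoint kpow n t := if n is n'.+1 then KMul t (kpow n' t) else KOne.
Fixpoint knat n := if n is n'.+1 then KAdd (knat n') KOne else KZero.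

(* The field variable 0 holds -1, as the language has no subtraction. *)
Definition ksub a b := KAdd a (KMul (Var SK 0) b).

(** Integrality is a negated strict inequality, which also covers the value infinity. *)
Definition as_formula p k a b :=
  FAnd (FLt (lg a) GZero) (FAnd (FLt (lg b) GZero)
    (FNeg (FLt (Val (ksub (kpow p (Var SK k))
       (KAdd (Var SK k) (ksub (Sec (lg a)) (Sec (lg b)))))) GZero))).

Definition atr p k a := match a with AF f => ltr f | AR a b => as_formula p k a b end.

(** Every position of the list owns one field variable for its Artin-Schreier witness, which keeps
    the numbering uniform. *)
Fixpoint ctr p k (s : seq atom) : formula :=
  if s is a :: s' then FAnd (atr p k a) (ctr p k.+1 s') else FEq GZero GZero.

Section Evaluation.
Variables (p : nat) (P : VField) (sec : int -> VK P) (E : nat).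
Definition encG (e : env P) n (r : nat -> nat) :=
  forall i, i < n -> envG e i = Some (- (r i)%:Z)%R.

Lemma lg_eval e n r t : encG e n r -> lterm_ok n t ->
  teval sec e (lg t) = Some (- (lev r t)%:Z)%R.
Proof.
move=> he; elim: t => [i|//|a IHa b IHb] /=; first exact: he.
by move=> /andP [/IHa -> /IHb ->] /=; congr Some; rewrite PoszD; lia.
Qed.

Lemma ltr_sat e n r f : encG e n r -> lform_ok n f -> sat sec e (ltr f) <-> lsem r f.
Proof.
move=> he; elim: f => [a b|a b|f IHf g IHg|f IHf g IHg|] //=.
- move=> /andP [ha hb]; rewrite (lg_eval he ha) (lg_eval he hb).
  by split=> [[/oppr_inj []]|->].
- move=> /andP [ha hb]; rewrite (lg_eval he ha) (lg_eval he hb) /=.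
  by split; lia.
- by move=> /andP [/IHf h1 /IHg h2]; tauto.
- by move=> /andP [/IHf h1 /IHg h2]; tauto.
Qed.

Lemma kpow_eval e n t : teval sec e (kpow n t) = (teval sec e t ^+ n)%R.
Proof. by elim: n => [|n IH] /=; rewrite ?expr0 // exprS -IH. Qed.

Lemma knat_eval e n : teval sec e (knat n) = (n%:R)%R.
Proof. by elim: n => [|n IH] //=; rewrite IH -mulrSr. Qed.

Lemma ksub_eval e a b : envK e 0 = (-1)%R ->
  teval sec e (ksub a b) = (teval sec e a - teval sec e b)%R.
Proof. by move=> h /=; rewrite h mulN1r. Qed.

Lemma ltG0 a : ~ ltG a (Some 0%R) <-> geZ a 0%R.
Proof. by case: a => [z|] /=; split=> //; lia. Qed.

Lemma as_formula_sat e n r k a b : encG e n r -> envK e 0 = (-1)%R ->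
  lterm_ok n a -> lterm_ok n b ->
  sat sec e (as_formula p k a b) <-> [/\ 0 < lev r a, 0 < lev r b &
    geZ (Vv (envK e k ^+ p - (envK e k + (sec (- (lev r a)%:Z) - sec (- (lev r b)%:Z))))%R) 0%R].
Proof.
move=> he h1 ha hb; rewrite /as_formula.
have -> : forall f g h, sat sec e (FAnd f (FAnd g (FNeg h))) =
  (sat sec e f /\ sat sec e g /\ ~ sat sec e h) by [].
have -> : forall x, sat sec e (FLt (Val x) GZero) = ltG (Vv (teval sec e x)) (Some 0%R) by [].
rewrite ksub_eval // kpow_eval ltG0.
have -> : teval sec e (KAdd (Var SK k) (ksub (Sec (lg a)) (Sec (lg b)))) =
  (envK e k + (sec (- (lev r a)%:Z) - sec (- (lev r b)%:Z)))%R.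
  change (teval sec e (KAdd (Var SK k) (ksub (Sec (lg a)) (Sec (lg b))))) with
    (envK e k + teval sec e (ksub (Sec (lg a)) (Sec (lg b))))%R.
  by rewrite ksub_eval //= (lg_eval he ha) (lg_eval he hb).
rewrite /= (lg_eval he ha) (lg_eval he hb) /=.
by split=> [[h2 [h3 h4]]|[h2 h3 h4]]; [split=> //; lia | split; [lia | split=> //; lia]].
Qed.

Hypothesis pr : prime p.
Hypothesis hP : is_padic_field p P.
Hypothesis hs : cross_section sec.
Hypothesis vpE : Vv (p%:R : VK P)%R = Some (Posz E).
Hypothesis E0 : 0 < E.

Lemma as_prel m n : 0 < m -> 0 < n -> m <= E -> n <= E ->
  (exists z, geZ (Vv (z ^+ p - (z + (sec (- m%:Z) - sec (- n%:Z))))%R) 0%R) <-> prel p m n.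
Proof.
move: hP => [v0 [vM [vD _]]] m0 n0 mE nE; move: hs => [vs sD].
by apply: (artin_schreier v0 vM vD pr vpE _ vs sD) => //; lia.
Qed.

Definition guarded n (r : nat -> nat) := forall i, i < n -> i != 1 -> 2 * r i <= E.

Lemma small_arg_le n r t : guarded n r -> lterm_ok n t -> small_arg t -> lev r t <= E.
Proof.
move=> hg; case: t => [i|//|[i| |]] //=; first by move=> /hg h /h; lia.
by case=> //= j /andP [/hg hi /hg hj] /andP [/hi h1 /hj h2]; lia.
Qed.

Lemma ctr_sound e n r k s : encG e n r -> guarded n r -> envK e 0 = (-1)%R ->
  all (atom_ok n) s -> sat sec e (ctr p k s) -> csem p r s.
Proof.
move=> he hg h1; elim: s k => [//|a s IH] k /= /andP [ha hs'] [sa /(IH _ hs') ss].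
split=> //; case: a ha sa => [f|a b] /=; first by move=> hf /(ltr_sat he hf).
move=> /and4P [ha hb sma smb] /(as_formula_sat _ he h1 ha hb) [a0 b0 hz].
by apply/(as_prel a0 b0 (small_arg_le hg ha sma) (small_arg_le hg hb smb)); eexists; exact: hz.
Qed.

(** The witnesses depend on r alone and are chosen before any environment, so they can later be
    supplied to a quantifier block of either kind. *)
Lemma ctr_complete n r k s : guarded n r -> all (atom_ok n) s -> csem p r s ->
  exists z : nat -> VK P, forall e : env P, encG e n r -> envK e 0 = (-1)%R ->
    (forall i, k <= i < k + size s -> envK e i = z i) -> sat sec e (ctr p k s).
Proof.
move=> hg; elim: s k => [|a s IH] k /=; first by move=> *; exists (fun _ => 0%R).
move=> /andP [ha hs'] [sa ss]; have [z hz] := IH k.+1 hs' ss.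
have [w hw] : exists w, forall e : env P, encG e n r -> envK e 0 = (-1)%R ->
    envK e k = w -> sat sec e (atr p k a).
  case: a ha sa => [f|a b] /= ha sa; first by exists 0%R => e he _ _; apply/(ltr_sat he ha).
  move: ha => /and4P [ha hb sma smb]; have [a0 b0 _] := sa.
  have [w hw] := proj2 (as_prel a0 b0 (small_arg_le hg ha sma) (small_arg_le hg hb smb)) sa.
  by exists w => e he h1 ek; apply/(as_formula_sat _ he h1 ha hb); rewrite ek.
exists (fun i => if i == k then w else z i) => e he h1 hk; split.
  by apply: hw => //; rewrite hk ?eqxx // leqnn /= addnS ltnS leq_addr.
apply: hz => // i /andP [ki ik]; rewrite hk ?gtn_eqF //.
by rewrite (ltnW ki) addnS -addSn.
Qed.

End Evaluation.

(** * Blocks of quantifiers *)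

Fixpoint exB s i n f := if n is n'.+1 then FEx s i (exB s i.+1 n' f) else f.
Fixpoint allB s i n f := if n is n'.+1 then FAll s i (allB s i.+1 n' f) else f.

Lemma ffree_exB s i n f s' m :
  ffree (exB s i n f) s' m = ffree f s' m && ~~ (sort_eqb s s' && (i <= m < i + n)).
Proof.
elim: n i => [|n IH] i /=; first by rewrite (_ : (i <= m < i + 0) = false) ?andbF ?andbT //; lia.
by rewrite IH; case: (ffree f s' m) => //=; case: (sort_eqb s s') => //=; lia.
Qed.

Lemma ffree_allB s i n f s' m :
  ffree (allB s i n f) s' m = ffree f s' m && ~~ (sort_eqb s s' && (i <= m < i + n)).
Proof.
elim: n i => [|n IH] i /=; first by rewrite (_ : (i <= m < i + 0) = false) ?andbF ?andbT //; lia.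
by rewrite IH; case: (ffree f s' m) => //=; case: (sort_eqb s s') => //=; lia.
Qed.

Lemma is_EA_exB s i n f : is_EA (exB s i n f) = is_EA f.
Proof. by elim: n i => //= n IH i. Qed.

Lemma is_univ_EA f : is_univ f -> is_EA f.
Proof. by elim: f. Qed.

Lemma is_univ_allB s i n f : is_univ (allB s i n f) = is_univ f.
Proof. by elim: n i => //= n IH i. Qed.

Lemma is_qf_univ f : is_qf f -> is_univ f.
Proof. by elim: f. Qed.

Section BlockSemantics.
Variables (P : VField) (sec : int -> VK P).

Definition setG (e : env P) i n g : env P :=
  Env (envK e) (fun m => if i <= m < i + n then g m else envG e m) (envk e).
Definition setK (e : env P) i n z : env P :=
  Env (fun m => if i <= m < i + n then z m else envK e m) (envG e) (envk e).

Lemma setG0 e i g : setG e i 0 g = e.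
Proof.
case: e => a b c; rewrite /setG /=; congr Env; apply/funext => m.
by case: ifP => //; lia.
Qed.

Lemma setK0 e i g : setK e i 0 g = e.
Proof.
case: e => a b c; rewrite /setK /=; congr Env; apply/funext => m.
by case: ifP => //; lia.
Qed.

Lemma setGS e i n x g :
  setG (@update P e SG i x) i.+1 n g = setG e i n.+1 (fun m => if m == i then x else g m).
Proof.
rewrite /setG /=; congr Env; apply/funext => m.
by case: eqP => [->|ne]; repeat (case: ifP => //); lia.
Qed.

Lemma setKS e i n x g :
  setK (@update P e SK i x) i.+1 n g = setK e i n.+1 (fun m => if m == i then x else g m).
Proof.
rewrite /setK /=; congr Env; apply/funext => m.
by case: eqP => [->|ne]; repeat (case: ifP => //); lia.
Qed.

Lemma setG_head e i n g : setG (@update P e SG i (g i)) i.+1 n g = setG e i n.+1 g.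
Proof. by rewrite setGS; congr setG; apply/funext => m; case: eqP => [->|]. Qed.

Lemma setK_head e i n g : setK (@update P e SK i (g i)) i.+1 n g = setK e i n.+1 g.
Proof. by rewrite setKS; congr setK; apply/funext => m; case: eqP => [->|]. Qed.

Lemma sat_exG e i n f : sat sec e (exB SG i n f) <-> exists g, sat sec (setG e i n g) f.
Proof.
elim: n e i => [|n IH] e i /=.
  by split=> [h|[g]]; [exists (fun _ => None) | ]; rewrite setG0.
split=> [[x /IH [g]]|[g h]]; first by rewrite setGS => h; eexists; exact: h.
by exists (g i); apply/IH; exists g; rewrite setG_head.
Qed.

Lemma sat_exK e i n f : sat sec e (exB SK i n f) <-> exists g, sat sec (setK e i n g) f.
Proof.
elim: n e i => [|n IH] e i /=.
  by split=> [h|[g]]; [exists (fun _ => 0%R) | ]; rewrite setK0.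
split=> [[x /IH [g]]|[g h]]; first by rewrite setKS => h; eexists; exact: h.
by exists (g i); apply/IH; exists g; rewrite setK_head.
Qed.

Lemma sat_allG e i n f : sat sec e (allB SG i n f) <-> forall g, sat sec (setG e i n g) f.
Proof.
elim: n e i => [|n IH] e i /=.
  by split=> [h g|/(_ (fun _ => None))]; rewrite setG0.
split=> [h g|h x]; first by have /IH/(_ g) := h (g i); rewrite setG_head.
by apply/IH => g; rewrite setGS.
Qed.

Lemma sat_allK e i n f : sat sec e (allB SK i n f) <-> forall g, sat sec (setK e i n g) f.
Proof.
elim: n e i => [|n IH] e i /=.
  by split=> [h g|/(_ (fun _ => 0%R))]; rewrite setK0.
split=> [h g|h x]; first by have /IH/(_ g) := h (g i); rewrite setK_head.
by apply/IH => g; rewrite setKS.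
Qed.

End BlockSemantics.

(** * The coded sentence: closedness and prenex form *)

Definition ftrue := FEq GZero GZero.
Definition fconj (s : seq formula) : formula := foldr FAnd ftrue s.

Section Sentence.
Variables (p nE nG : nat) (csE csA : seq atom) (Phi : lform).

Definition vpt := Val (knat p).
Definition guard_formula i :=
  FAnd (FOr (FLt (Var SG i) GZero) (FEq (Var SG i) GZero))
       (FNeg (FLt (GAdd (GAdd (Var SG i) (Var SG i)) vpt) GZero)).
(** Variable nG is universally quantified, so variable 0 becomes the greatest negative value, which
    is the code of the number 1. *)
Definition unit_formula :=
  FAnd (FLt (Var SG 0) GZero)
       (FImp (FLt (Var SG nG) GZero) (FNeg (FLt (Var SG 0) (Var SG nG)))).
(* Fields whose window is too small to start the coding satisfy the sentence vacuously. *)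
Definition small_formula := FLt (GAdd vpt (lg (lconst (4 * p ^ 3)))) GZero.
(** The constant 4p is 2 * p * 2: the guard doubles, [ceil_pow] costs a factor p, and the repunit
    products cost another 2. The upper bound, larger by p, singles out the largest admissible power
    of p. *)
Definition window_formula :=
  FAnd (FNeg (FLt (GAdd vpt (lg (lmul (4 * p) (LV 2)))) GZero))
       (FLt (GAdd vpt (lg (lmul (4 * p ^ 2) (LV 2)))) GZero).
Definition exK_count := (size csE).+1.
Definition allK_count := size csA.

(** The atoms [csA] occur only to the left of an implication, so their witnesses are universally
    quantified; those of [csE] are existential. *)
Definition coded_body : formula :=
  FAnd unit_formula (FOr small_formula
   (FAnd (FEq (KAdd (Var SK 0) KOne) KZero)
   (FAnd (fconj (map guard_formula (iota 2 (nE - 2))))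
   (FAnd window_formula
   (FAnd (ctr p 1 csE)
   (FImp (FAnd (fconj (map guard_formula (iota nE (nG - nE)))) (ctr p exK_count csA)) (ltr Phi))))))).

(** N occurs in this one equation only, so the code of the sentence is easily computed from N and
    the code of the body. *)
Definition coded_matrix N B := FAnd (FEq (Var SG 1) (lg (lconst N))) B.

Definition prefix f :=
  exB SG 0 nE (exB SK 0 exK_count (allB SG nE (nG.+1 - nE) (allB SK exK_count allK_count f))).

Definition coded_sentence N := prefix (coded_matrix N coded_body).

Hypothesis nE2 : 2 < nE.
Hypothesis nEG : nE <= nG.
Hypothesis okE : all (atom_ok nE) csE.
Hypothesis okA : all (atom_ok nG) csA.
Hypothesis okPhi : lform_ok nG Phi.

Definition fbound f := forall s m, ffree f s m ->
  match s with SK => m < exK_count + allK_count | SG => m <= nG | Sk => false end.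
Definition tbound s (t : term s) := forall s' m, tfree t s' m ->
  match s' with SK => m < exK_count + allK_count | SG => m <= nG | Sk => false end.

Lemma tbound_G i : i <= nG -> tbound (Var SG i).
Proof. by move=> h [] //= m /eqP <-. Qed.
Lemma tbound_K i : i < exK_count + allK_count -> tbound (Var SK i).
Proof. by move=> h [] //= m /eqP <-. Qed.
Lemma tbound_KAdd a b : tbound a -> tbound b -> tbound (KAdd a b).
Proof. by move=> ha hb s m /= /orP [/ha|/hb]. Qed.
Lemma tbound_KMul a b : tbound a -> tbound b -> tbound (KMul a b).
Proof. by move=> ha hb s m /= /orP [/ha|/hb]. Qed.
Lemma tbound_GAdd a b : tbound a -> tbound b -> tbound (GAdd a b).
Proof. by move=> ha hb s m /= /orP [/ha|/hb]. Qed.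
Lemma tbound_Sec a : tbound a -> tbound (Sec a). Proof. by []. Qed.
Lemma tbound_Val a : tbound a -> tbound (Val a). Proof. by []. Qed.
Lemma tbound_lg n t : n <= nG.+1 -> lterm_ok n t -> tbound (lg t).
Proof.
move=> hn; elim: t => [i|//|a IHa b IHb] /=; first by move=> h; apply: tbound_G; lia.
by move=> /andP [/IHa h1 /IHb h2]; exact: tbound_GAdd.
Qed.
Lemma tbound_knat n : tbound (knat n).
Proof. by elim: n => //= n IH; exact: tbound_KAdd. Qed.
Lemma tbound_kpow n t : tbound t -> tbound (kpow n t).
Proof. by move=> ht; elim: n => //= n IH; exact: tbound_KMul. Qed.
Lemma tbound_ksub a b : tbound a -> tbound b -> tbound (ksub a b).
Proof. by move=> ha hb; apply: tbound_KAdd => //; apply: tbound_KMul => //; exact: tbound_K. Qed.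

Lemma fbound_eq s (a b : term s) : tbound a -> tbound b -> fbound (FEq a b).
Proof. by move=> ha hb s' m /= /orP [/ha|/hb]. Qed.
Lemma fbound_lt a b : tbound a -> tbound b -> fbound (FLt a b).
Proof. by move=> ha hb s' m /= /orP [/ha|/hb]. Qed.
Lemma fbound_and f g : fbound f -> fbound g -> fbound (FAnd f g).
Proof. by move=> ha hb s' m /= /orP [/ha|/hb]. Qed.
Lemma fbound_or f g : fbound f -> fbound g -> fbound (FOr f g).
Proof. by move=> ha hb s' m /= /orP [/ha|/hb]. Qed.
Lemma fbound_imp f g : fbound f -> fbound g -> fbound (FImp f g).
Proof. by move=> ha hb s' m /= /orP [/ha|/hb]. Qed.
Lemma fbound_neg f : fbound f -> fbound (FNeg f).
Proof. by []. Qed.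
Lemma fbound_conj s : (forall f, List.In f s -> fbound f) -> fbound (fconj s).
Proof.
elim: s => [|f s IH] h; first by apply: fbound_eq.
by apply: fbound_and; [apply: h; left | apply: IH => g sg; apply: h; right].
Qed.

Lemma fbound_ltr n f : n <= nG.+1 -> lform_ok n f -> fbound (ltr f).
Proof.
move=> hn; elim: f => [a b|a b|f IHf g IHg|f IHf g IHg|] /=.
- by move=> /andP [ha hb]; apply: fbound_eq; exact: tbound_lg hn _.
- by move=> /andP [ha hb]; apply: fbound_lt; exact: tbound_lg hn _.
- by move=> /andP [/IHf h1 /IHg h2]; exact: fbound_and.
- by move=> /andP [/IHf h1 /IHg h2]; exact: fbound_imp.
- by move=> _; exact: fbound_lt.
Qed.

Lemma fbound_ctr n k s : n <= nG.+1 -> all (atom_ok n) s -> k + size s <= exK_count + allK_count ->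
  fbound (ctr p k s).
Proof.
move=> hn; elim: s k => [|a s IH] k /=; first by move=> _ _; exact: fbound_eq.
move=> /andP [ha hs] hk; apply: fbound_and; last by apply: IH => //; lia.
case: a ha => [f|a b] /=; first exact: fbound_ltr.
move=> /and4P [ha hb _ _]; have la := tbound_lg hn ha; have lb := tbound_lg hn hb.
have zk : tbound (Var SK k) by apply: tbound_K; lia.
apply: fbound_and; first exact: fbound_lt.
apply: fbound_and; first exact: fbound_lt.
apply/fbound_neg/fbound_lt => //; apply/tbound_Val/tbound_ksub; first exact: tbound_kpow.
by apply: tbound_KAdd => //; apply: tbound_ksub; exact: tbound_Sec.
Qed.

Lemma fbound_guard a b : a + b <= nG -> fbound (fconj (map guard_formula (iota a b))).
Proof.
move=> h; apply: fbound_conj => f /List.in_map_iff [i [<- hi]].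
have ib : tbound (Var SG i).
  apply: tbound_G; suff : i \in iota a b by rewrite mem_iota; lia.
  by elim: (iota a b) hi => //= j s IH [->|/IH]; rewrite inE ?eqxx // => ->; rewrite orbT.
apply: fbound_and; first by apply: fbound_or; [exact: fbound_lt | exact: fbound_eq].
apply/fbound_neg/fbound_lt => //.
by apply: tbound_GAdd; [exact: tbound_GAdd | exact/tbound_Val/tbound_knat].
Qed.

Lemma fbound_coded_matrix N : fbound (coded_matrix N coded_body).
Proof.
have G0 : tbound (Var SG 0) by apply: tbound_G; lia.
have GN : tbound (Var SG nG) by apply: tbound_G; lia.
have V : tbound vpt by apply/tbound_Val/tbound_knat.
have C c : tbound (lg (lconst c)) by apply: (@tbound_lg nG) => //; apply: lterm_ok_const; lia.
have M c : tbound (lg (lmul c (LV 2))).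
  by apply: (@tbound_lg nG) => //; apply: lterm_ok_mul => /=; lia.
apply: fbound_and; first by apply: fbound_eq => //; apply: tbound_G; lia.
apply: fbound_and.
  apply: fbound_and; first exact: fbound_lt.
  by apply: fbound_imp; [|apply: fbound_neg]; exact: fbound_lt.
apply: fbound_or; first by apply: fbound_lt => //; exact: tbound_GAdd.
apply: fbound_and; first by apply: fbound_eq => //; apply: tbound_KAdd => //; exact: tbound_K.
apply: fbound_and; first by apply: fbound_guard; lia.
apply: fbound_and.
  by apply: fbound_and; [apply: fbound_neg|]; apply: fbound_lt => //; exact: tbound_GAdd.
apply: fbound_and; first by apply: (@fbound_ctr nE) => //; rewrite /exK_count; lia.
apply: fbound_imp; last exact: (@fbound_ltr nG).
by apply: fbound_and; [apply: fbound_guard; lia | apply: (@fbound_ctr nG)].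
Qed.

Lemma coded_sentence_closed N : sentence (coded_sentence N).
Proof.
move=> s m; rewrite /coded_sentence /prefix !(ffree_exB, ffree_allB).
case F: (ffree _ s m) => //; have := @fbound_coded_matrix N s m F.
by case: s {F} => //=; lia.
Qed.

Lemma is_qf_ltr f : is_qf (ltr f).
Proof. by elim: f => //= f -> g ->. Qed.

Lemma is_qf_ctr k s : is_qf (ctr p k s).
Proof. by elim: s k => //= -[f|a b] s IH k; rewrite IH /= ?is_qf_ltr. Qed.

Lemma is_qf_guards s : is_qf (fconj (map guard_formula s)).
Proof. by elim: s. Qed.

Lemma coded_sentence_EA N : is_EA (coded_sentence N).
Proof.
rewrite /coded_sentence /prefix !is_EA_exB; apply: is_univ_EA.
rewrite !is_univ_allB; apply: is_qf_univ.
by rewrite /= !is_qf_ctr !is_qf_guards is_qf_ltr.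
Qed.

End Sentence.

(** * The coded sentence as a statement about natural numbers *)

Lemma mem_iota_sub a b i : a <= b -> (i \in iota a (b - a)) = (a <= i < b).
Proof. by move=> ab; rewrite mem_iota subnKC. Qed.

Section SentenceSemantics.
Variables (p nE nG : nat) (csE csA : seq atom) (Phi : lform).
Hypothesis nE2 : 2 < nE.
Hypothesis nEG : nE <= nG.
Hypothesis okE : all (atom_ok nE) csE.
Hypothesis okA : all (atom_ok nG) csA.
Hypothesis okPhi : lform_ok nG Phi.
Variables (P : VField) (sec : int -> VK P) (E : nat).
Hypothesis pr : prime p.
Hypothesis hP : is_padic_field p P.
Hypothesis hs : cross_section sec.
Hypothesis vpE : Vv (p%:R : VK P)%R = Some (Posz E).
Hypothesis E0 : 0 < E.

Local Notation kE := (exK_count csE).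
Local Notation kA := (allK_count csA).

Lemma small_sat e r : encG e 1 r -> r 0 = 1 ->
  sat sec e (small_formula p) <-> E < 4 * p ^ 3.
Proof.
move=> he r0; rewrite /small_formula; move: (4 * p ^ 3) => c.
change (sat sec e (FLt (GAdd (vpt p) (lg (lconst c))) GZero)) with
  (ltG (addG (Vv (teval sec e (knat p))) (teval sec e (lg (lconst c)))) (Some 0%R)).
rewrite knat_eval vpE (lg_eval sec he) ?lterm_ok_const // lev_const //=; lia.
Qed.

Lemma window_sat e r : encG e nE r ->
  sat sec e (window_formula p) <-> 4 * p * r 2 <= E < 4 * p ^ 2 * r 2.
Proof.
move=> he; rewrite /window_formula; move: (4 * p) (4 * p ^ 2) => c d.
change (sat sec e (FAnd (FNeg (FLt (GAdd (vpt p) (lg (lmul c (LV 2)))) GZero))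
    (FLt (GAdd (vpt p) (lg (lmul d (LV 2)))) GZero))) with
  (~ ltG (addG (Vv (teval sec e (knat p))) (teval sec e (lg (lmul c (LV 2))))) (Some 0%R) /\
   ltG (addG (Vv (teval sec e (knat p))) (teval sec e (lg (lmul d (LV 2))))) (Some 0%R)).
by rewrite knat_eval vpE !(lg_eval sec he) ?lterm_ok_mul // !lev_mul /=; lia.
Qed.

Lemma guard_sat e i : sat sec e (guard_formula p i) <->
  exists2 x, envG e i = Some (- x%:Z)%R & 2 * x <= E.
Proof.
change (sat sec e (guard_formula p i)) with
  ((ltG (envG e i) (Some 0%R) \/ envG e i = Some 0%R) /\
   ~ ltG (addG (addG (envG e i) (envG e i)) (Vv (teval sec e (knat p)))) (Some 0%R)).
rewrite knat_eval vpE; case: (envG e i) => [z|] /=; last by split=> [[[]]|[]].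
split=> [[h1 h2]|[x [->] hx]].
  have z0 : (z <= 0)%R by case: h1 => [|[->]]; lia.
  by exists `|z|; [congr Some; lia | lia].
split; last by lia.
by case: x {hx} => [|x]; [right | left; lia].
Qed.

Lemma guards_sat e s : sat sec e (fconj (map (guard_formula p) s)) <->
  forall i, i \in s -> exists2 x, envG e i = Some (- x%:Z)%R & 2 * x <= E.
Proof.
elim: s => [|i s IH] /=; first by split.
split.
  by move=> [/guard_sat h1 /IH h2] j; rewrite inE => /orP [/eqP ->|/h2].
move=> h; split; first by apply/guard_sat/h; rewrite inE eqxx.
by apply/IH => j js; apply: h; rewrite inE js orbT.
Qed.

Definition final_env (e : env P) gE zE gA zA : env P :=
  setK (setG (setK (setG e 0 nE gE) 0 kE zE) nE (nG.+1 - nE) gA) kE kA zA.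

Lemma coded_sentence_sat e N : sat sec e (coded_sentence p nE nG csE csA Phi N) <->
  exists gE zE, forall gA zA,
    sat sec (final_env e gE zE gA zA) (coded_matrix N (coded_body p nE nG csE csA Phi)).
Proof.
rewrite /coded_sentence /prefix sat_exG; split.
  move=> [gE /sat_exK [zE /sat_allG h]]; exists gE, zE => gA zA.
  by have /sat_allK := h gA; exact.
move=> [gE [zE h]]; exists gE; apply/sat_exK; exists zE; apply/sat_allG => gA.
by apply/sat_allK => zA; exact: h.
Qed.

Lemma final_envG e gE zE gA zA i : i <= nG ->
  envG (final_env e gE zE gA zA) i = if i < nE then gE i else gA i.
Proof.
move=> hi; rewrite /final_env /=.
have -> : (nE <= i < nE + (nG.+1 - nE)) = ~~ (i < nE) by lia.
by rewrite ?add0n /=; case: ltnP.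
Qed.

Lemma final_envK e gE zE gA zA i : i < kE + kA ->
  envK (final_env e gE zE gA zA) i = if i < kE then zE i else zA i.
Proof.
move=> hi; rewrite /final_env /=.
have -> : (kE <= i < kE + kA) = ~~ (i < kE) by lia.
by rewrite ?add0n /=; case: ltnP.
Qed.

(** The arithmetic content of the sentence outside small fields; neither the field nor the
    cross-section appears in it any more. *)
Definition solution N (r : nat -> nat) :=
  [/\ r 0 = 1, r 1 = N, guarded E nE r, csem p r csE & 4 * p * r 2 <= E < 4 * p ^ 2 * r 2] /\
  forall r', (forall i, i < nE -> r' i = r i) -> guarded E nG r' -> csem p r' csA -> lsem r' Phi.

Lemma two_le_E : 4 * p ^ 3 <= E -> 2 <= E.
Proof. by apply: leq_trans; have := prime_gt1 pr; case: p => [|[|q]] // _; rewrite !expnS; lia. Qed.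

Lemma models_solution N : models sec (coded_sentence p nE nG csE csA Phi N) ->
  4 * p ^ 3 <= E -> exists r, solution N r.
Proof.
move=> M big; pose e0 : env P := Env (fun _ => 0%R) (fun _ => None) (fun _ => 0%R).
have /coded_sentence_sat [gE [zE H]] := M e0.
pose r i := if gE i is Some z then `|z| else 0; exists r.
(* Any universal values would reveal the existential part; the value -1 at nG also pins variable 0
   to -1. *)
have := H (fun _ => Some (-1)%R) (fun _ => 0%R).
set e := final_env _ _ _ _ _.
have eG i : i < nE -> envG e i = gE i by move=> h; rewrite final_envG ?h //; lia.
have eN : envG e nG = Some (-1)%R by rewrite final_envG ?ltnNge ?nEG.
have eK0 : envK e 0 = zE 0 by rewrite final_envK.
move=> [h1 [[h2 h3] h4]].
have {}h1 : envG e 1 = teval sec e (lg (lconst N)) by [].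
have {}h2 : ltG (envG e 0) (Some 0%R) by [].
have {}h3 : ltG (envG e nG) (Some 0%R) -> ~ ltG (envG e 0) (envG e nG) by [].
rewrite eN eG in h3; last by lia.
rewrite eG in h2; last by lia.
rewrite eG in h1; last by lia.
have g0 : gE 0 = Some (-1)%R.
  by case: (gE 0) h2 h3 => [z|] //= z0 /(_ isT) z1; congr Some; lia.
have r0 : r 0 = 1 by rewrite /r g0.
have enc1 : encG e 1 r by case=> // _; rewrite eG; [rewrite g0 r0 | lia].
have r1 : r 1 = N.
  by move: h1; rewrite (lg_eval sec enc1) ?lterm_ok_const // lev_const // /r => -> /=; lia.
case: h4 => [/(small_sat enc1 r0)|]; first by lia.
move=> [h5 [/guards_sat h6 [h7 [h8 _]]]].
have guard i : i < nE -> i != 1 -> gE i = Some (- (r i)%:Z)%R /\ 2 * r i <= E.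
  case: (ltnP i 2) => [|i2 iE _].
    by case: i => [|[|]] // _ _ _; rewrite r0 g0; have := two_le_E big.
  have /h6 [x] : i \in iota 2 (nE - 2) by rewrite mem_iota_sub ?(ltnW nE2) // i2.
  by rewrite eG // /r => -> /=; rewrite abszN absz_nat.
have encE : encG e nE r.
  move=> i iE; rewrite eG //; case: (eqVneq i 1) => [->|/(guard i iE) []//].
  by move: h1; rewrite (lg_eval sec enc1) ?lterm_ok_const // lev_const // r1.
have gE' : guarded E nE r by move=> i iE i1; case: (guard i iE i1).
have m1 : zE 0 = (-1)%R by apply/eqP; rewrite -addr_eq0 -eK0; apply/eqP; exact: h5.
split.
  split=> //.
  - by apply: (ctr_sound pr hP hs vpE E0 encE gE' _ okE h8); rewrite eK0.
  - exact/(window_sat encE).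
move=> r' rr' gr' cr'.
(* To use the implication its premise has to be made true, so the universal field variables receive
   the Artin-Schreier witnesses of r'. *)
have [z hz] := ctr_complete pr hP hs vpE E0 kE gr' okA cr'.
pose gA i : vgroup := Some (- (r' i)%:Z)%R.
have := H gA z; set e' := final_env _ _ _ _ _.
have enc' : encG e' nG r'.
  move=> i iG; rewrite final_envG; last exact: ltnW.
  by case: (ltnP i nE) => // iE; rewrite rr' // -eG // encE.
have enc'1 : encG e' 1 r' by case=> // _; apply: enc'; lia.
have r'0 : r' 0 = 1 by rewrite rr' //; lia.
move=> [_ [_ [/(small_sat enc'1 r'0)|]]]; first by lia.
move=> [_ [_ [_ [_ h]]]].
apply/(ltr_sat sec enc' okPhi)/h; split.
  apply/guards_sat => i; rewrite mem_iota_sub // => /andP [i1 i2].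
  by exists (r' i); [exact: enc' | apply: gr'; rewrite // gtn_eqF // (leq_trans _ i1) // ltnW].
apply: (hz e' enc'); first by rewrite final_envK.
by move=> i /andP [ki ik]; rewrite final_envK // ltnNge ki.
Qed.

Lemma solution_models N : (4 * p ^ 3 <= E -> exists r, solution N r) ->
  models sec (coded_sentence p nE nG csE csA Phi N).
Proof.
move=> H e; apply/coded_sentence_sat.
pose smallE := E < 4 * p ^ 3.
have [r [r0 r1 hr]] : exists r, [/\ r 0 = 1, r 1 = N & ~~ smallE -> solution N r].
  have [s|b] := boolP smallE.
    by exists (fun i => if i == 0 then 1 else N).
  have /H [r hr] : 4 * p ^ 3 <= E by rewrite leqNgt.
  by have [[? ?]] := hr; exists r.
have [z hz] : exists z : nat -> VK P, z 0 = (-1)%R /\ (~~ smallE ->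
    forall e : env P, encG e nE r -> envK e 0 = (-1)%R ->
    (forall i, 1 <= i < 1 + size csE -> envK e i = z i) -> sat sec e (ctr p 1 csE)).
  have [s|b] := boolP smallE; first by exists (fun _ => (-1)%R).
  have [[_ _ g c _] _] := hr b.
  have [z hz] := ctr_complete pr hP hs vpE E0 1 g okE c.
  exists (fun i => if i == 0 then (-1)%R else z i); split=> // _ e' h1 h2 h3.
  by apply: hz => // -[|i] hi; rewrite h3.
exists (fun i => Some (- (r i)%:Z)%R), z => gA zA.
set e' := final_env _ _ _ _ _.
have encE : encG e' nE r by move=> i iE; rewrite final_envG ?iE //; lia.
have enc1 : encG e' 1 r by case=> // _; apply: encE; lia.
have eK0 : envK e' 0 = (-1)%R by rewrite final_envK //= (proj1 hz).
split.
  change (envG e' 1 = teval sec e' (lg (lconst N))).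
  by rewrite (lg_eval sec enc1) ?lterm_ok_const // lev_const // encE ?r1 //; lia.
split.
  change (ltG (envG e' 0) (Some 0%R) /\ (ltG (envG e' nG) (Some 0%R) -> ~ ltG (envG e' 0) (envG e' nG))).
  rewrite enc1 // r0; split=> //; case: (envG e' nG) => //= x; lia.
have [s|b] := boolP smallE; first by left; exact/(small_sat enc1 r0).
right; have [[_ _ g c w] h] := hr b.
split; first by change (envK e' 0 + 1 = 0)%R; rewrite eK0 addNr.
split.
  apply/guards_sat => i; rewrite mem_iota_sub ?(ltnW nE2) // => /andP [i1 i2].
  by exists (r i); [exact: encE | apply: g; rewrite // gtn_eqF].
split; first exact/(window_sat encE).
split.
  apply: (proj2 hz b) => // i hi; rewrite final_envK; last by rewrite /exK_count; lia.
  by rewrite ifT // /exK_count; lia.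
move=> [/guards_sat hg hc].
pose r' i := if i < nE then r i else if gA i is Some z then `|z| else 0.
have gA' i : nE <= i < nG -> exists2 x, gA i = Some (- x%:Z)%R & 2 * x <= E.
  move=> /andP [h1 h2]; have [|x] := hg i; first by rewrite mem_iota_sub // h1.
  by rewrite final_envG; [rewrite ltnNge h1 /= => hx; exists x | exact: ltnW].
have enc' : encG e' nG r'.
  move=> i iG; rewrite final_envG /r'; last exact: ltnW.
  case: (ltnP i nE) => // iE.
  by have [|x -> _] := gA' i; rewrite ?iE //= abszN absz_nat.
have gr' : guarded E nG r'.
  move=> i iG i1; rewrite /r'; case: ltnP => iE; first exact: g.
  by have [|x -> hx] := gA' i; rewrite ?iE //= abszN absz_nat.
apply/(ltr_sat sec enc' okPhi)/h => //; first by move=> i iE; rewrite /r' iE.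
exact: (ctr_sound pr hP hs vpE E0 enc' gr' eK0 okA hc).
Qed.

End SentenceSemantics.

(** * Coding unary functions *)

Section AtomLists.

Local Notation "i +l j" := (LA (LV i) (LV j)) (at level 50).

Definition mul_atoms n q m Y Y' : seq atom :=
  [:: AR (LV 0) (LV q); AR (LV 0) (LV Y); AR (LV 0) (LV Y'); AF (LLt (LV 0) (LV Y));
      AF (LLt (LV q) (LV Y')); AR (Y +l 0) (Y' +l q); AF (LLt (LV n) (LV Y));
      AF (LLt (LV m) (LV Y')); AR (Y +l n) (Y' +l m)].

Definition row_atoms W q t b b' c c' a1 a2 a3 a4 : seq atom :=
  [:: AR (LV 0) (LV q); AF (LEq (q +l b) (0 +l b')); AF (LEq (b +l c) (t +l c'));
      AF (LLt (t +l 0) (LV W))] ++ mul_atoms b W b' a1 a2 ++ mul_atoms c W c' a3 a4.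

Definition digit_atoms x q W v y Y0 y' Y1 d a1 a2 a3 a4 : seq atom :=
  [:: AF (LLt (LV v) (LV q)); AF (LLt (LV d) (LV W)); AF (LEq (LV x) (v +l Y0));
      AF (LEq (LV y) (d +l Y1))] ++ mul_atoms y q Y0 a1 a2 ++ mul_atoms y' W Y1 a3 a4.

(* Variables: 0 = unit, 1 = parameter, 2 = window Q0, 3 = Q = W^T, 4 = W, 5 = Q0/Q, 6 = T,
   11, 12, 13 = the tables of left components, right components and facts. *)
Definition nExist := 20.
(** W <= 2p(T + 2) and Q0/Q < W are the two constraints that prevent a short table; the last atoms
    say that Q is the row of index T and that Q0 = Q (Q0/Q). *)
Definition exist_atoms p : seq atom :=
  [:: AF (LLt (LV 0) (LV 4)); AR (LV 0) (LV 5); AF (LLt (LV 5) (LV 4));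
      AF (LLt (LV 4) (LA (lmul (2 * p) (LA (LV 6) (0 +l 0))) (LV 0)));
      AF (LLt (LV 11) (LV 3)); AF (LLt (LV 12) (LV 3)); AF (LLt (LV 13) (LV 3))] ++
  row_atoms 4 3 6 7 8 9 10 14 15 16 17 ++ mul_atoms 3 5 2 18 19.

End AtomLists.

(** A node is a universally chosen position t of the tables, with 40 variables: offset 0 is W^t, 1
    is t, 2 to 9 serve the row index, and 10, 20, 30 start the digit extractions from the three
    tables, whose digits sit at 15, 25, 35. *)
Definition nbase k := 20 + 40 * k.
Definition nvar k o := nbase k + o.
Definition node_digits k x o :=
  digit_atoms x (nvar k 0) 4 (nvar k o) (nvar k (o + 1)) (nvar k (o + 2)) (nvar k (o + 3))
    (nvar k (o + 4)) (nvar k (o + 5)) (nvar k (o + 6)) (nvar k (o + 7)) (nvar k (o + 8))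
    (nvar k (o + 9)).
Definition node_atoms k : seq atom :=
  AF (LLt (LV (nvar k 0)) (LV 3)) ::
  row_atoms 4 (nvar k 0) (nvar k 1) (nvar k 2) (nvar k 3) (nvar k 4) (nvar k 5) (nvar k 6)
    (nvar k 7) (nvar k 8) (nvar k 9) ++
  node_digits k 11 10 ++ node_digits k 12 20 ++ node_digits k 13 30.

Definition nTotal m := 20 + 40 * m.
Definition all_node_atoms m : seq atom := flatten (map node_atoms (iota 0 m)).

Definition tvar k := LV (nvar k 1).
Definition lvar k := LV (nvar k 15).
Definition rvar k := LV (nvar k 25).
Definition svar k := LV (nvar k 35).

(* Forces T < W: otherwise rows 0 and W - 1 would carry the same index. *)
Definition inj_clause := LImp (LEq (tvar 0) (tvar 1)) (LEq (LV (nvar 0 0)) (LV (nvar 1 0))).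

Definition node_view m (r : nat -> nat) (tau L R S : nat -> nat) := forall k, k < m ->
  [/\ r (nvar k 1) = tau k, r (nvar k 15) = L (tau k), r (nvar k 25) = R (tau k) &
      r (nvar k 35) = S (tau k)].

Lemma exist_atoms_ok p : all (atom_ok nExist) (exist_atoms p).
Proof. by rewrite /= !lterm_ok_mul. Qed.

Lemma nvar_lt m k o : k < m -> o < 40 -> nvar k o < nTotal m.
Proof. by rewrite /nvar /nbase /nTotal; lia. Qed.

Lemma node_atoms_ok m k : k < m -> all (atom_ok (nTotal m)) (node_atoms k).
Proof.
move=> km.
have V o : o < 40 -> nvar k o < nTotal m by exact: nvar_lt.
have S i : i < 20 -> i < nTotal m by rewrite /nTotal; lia.
have N1 o : (nvar k o == 1) = false by rewrite /nvar /nbase; lia.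
by rewrite /node_atoms /node_digits /= !V // !S // !N1.
Qed.

Lemma all_node_atoms_ok m : all (atom_ok (nTotal m)) (all_node_atoms m).
Proof.
have : all (fun k => k < m) (iota 0 m) by apply/allP => k; rewrite mem_iota.
rewrite /all_node_atoms; elim: (iota 0 m) => // k s IH /andP [km /IH h].
change (all (atom_ok (nTotal m)) (node_atoms k ++ flatten (map node_atoms s))).
by rewrite all_cat h andbT node_atoms_ok.
Qed.

(** * Arithmetic meaning of the atom lists *)

Section Constraints.
Variable p : nat.
Hypothesis pr : prime p.
Local Notation csem := (csem p).

Lemma mul_atomsP r n q m Y Y' : r 0 = 1 ->
  csem r (mul_atoms n q m Y Y') <-> shifted_mul p (r n) (r q) (r m) (r Y) (r Y').
Proof.
move=> r0; rewrite /shifted_mul /mul_atoms /= r0; split.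
  by move=> [h1 [h2 [h3 [h4 [h5 [h6 [h7 [h8 [h9 _]]]]]]]]]; split; split.
by move=> [[h1 h2 h3 h4] [h5 h6 h7 h8 h9]]; do !apply: conj.
Qed.

Lemma mul_atoms_sound r n q m Y Y' : r 0 = 1 ->
  csem r (mul_atoms n q m Y Y') -> r m = r n * r q.
Proof. by move=> r0 /(mul_atomsP _ _ _ _ _ r0) /(shifted_mul_sound pr). Qed.

Lemma mul_atoms_complete r n q m Y Y' : r 0 = 1 -> prel p 1 (r q) -> r m = r n * r q ->
  r Y = ceil_pow p (r n) -> r Y' = ceil_pow p (r n) * r q -> csem r (mul_atoms n q m Y Y').
Proof. by move=> r0 hq hm hY hY'; apply/mul_atomsP => //; rewrite hm hY hY'; exact: shifted_mul_complete. Qed.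

Lemma row_atoms_sound r W q t b b' c c' a1 a2 a3 a4 w : r 0 = 1 -> r W = p ^ w -> 0 < w ->
  csem r (row_atoms W q t b b' c c' a1 a2 a3 a4) ->
  exists i, r q = r W ^ i /\ r t = i %% (r W - 1).
Proof.
move=> r0 rW w0; rewrite /row_atoms csem_cat csem_cat.
move=> [A [/(mul_atoms_sound r0) h5 /(mul_atoms_sound r0) h6]].
move: A; rewrite /= r0 => -[h1 [h2 [h3 [h4 _]]]].
rewrite rW; apply: (@row_index_sound p pr w _ _ (r b) (r b') (r c) (r c') w0).
by split=> //; rewrite -?rW //; split=> //; lia.
Qed.

Lemma row_atoms_complete r W q t b b' c c' a1 a2 a3 a4 w i :
  r 0 = 1 -> r W = p ^ w -> 0 < w -> r q = r W ^ i -> r t = i %% (r W - 1) ->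
  r b = repunit (r W) i -> r b' = r b * r W -> r c = r b %/ (r W - 1) -> r c' = r c * r W ->
  r a1 = ceil_pow p (r b) -> r a2 = ceil_pow p (r b) * r W ->
  r a3 = ceil_pow p (r c) -> r a4 = ceil_pow p (r c) * r W ->
  csem r (row_atoms W q t b b' c c' a1 a2 a3 a4).
Proof.
move=> r0 rW w0 hq ht hb hb' hc hc' h1 h2 h3 h4.
have RI := row_index_complete pr i w0.
rewrite /= -rW -hq -ht -hb -hb' -hc -hc' in RI; case: RI => [g1 _ g2 _ [g3 g4]].
have pW : prel p 1 (r W) by apply/(prel1 pr); exists w.
rewrite /row_atoms csem_cat csem_cat; split; first by rewrite /= r0; do !apply: conj=> //; lia.
by split; apply: mul_atoms_complete.
Qed.

Lemma digit_atoms_sound r x q W v y Y0 y' Y1 d a1 a2 a3 a4 : r 0 = 1 ->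
  csem r (digit_atoms x q W v y Y0 y' Y1 d a1 a2 a3 a4) -> r d = (r x %/ r q) %% r W.
Proof.
move=> r0; rewrite /digit_atoms csem_cat csem_cat.
move=> [[h1 [h2 [h3 [h4 _]]]] [/(mul_atoms_sound r0) h5 /(mul_atoms_sound r0) h6]].
rewrite /= in h1 h2 h3 h4.
by apply: (@digit_unique _ _ _ (r v) (r y) (r y')); lia.
Qed.

Lemma digit_atoms_complete r x q W v y Y0 y' Y1 d a1 a2 a3 a4 : r 0 = 1 ->
  prel p 1 (r q) -> prel p 1 (r W) -> r v = r x %% r q -> r y = r x %/ r q ->
  r Y0 = r y * r q -> r y' = r y %/ r W -> r Y1 = r y' * r W -> r d = r y %% r W ->
  r a1 = ceil_pow p (r y) -> r a2 = ceil_pow p (r y) * r q ->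
  r a3 = ceil_pow p (r y') -> r a4 = ceil_pow p (r y') * r W ->
  csem r (digit_atoms x q W v y Y0 y' Y1 d a1 a2 a3 a4).
Proof.
move=> r0 pq pW hv hy hY0 hy' hY1 hd h1 h2 h3 h4.
have q0 : 0 < r q by case: pq.
have W0 : 0 < r W by case: pW.
rewrite /digit_atoms csem_cat csem_cat; split; last by split; exact: mul_atoms_complete.
rewrite /=; split; first by rewrite hv ltn_pmod.
split; first by rewrite hd ltn_pmod.
split; first by rewrite hv hY0 hy addnC -divn_eq.
by split=> //; rewrite hd hY1 hy' addnC -divn_eq.
Qed.

End Constraints.

(** * From solutions to tables and back *)

Section Tables.
Variables (p m : nat) (Psi : lform) (E N : nat).
Hypothesis pr : prime p.
Hypothesis m1 : 1 < m.
Let p1 : 1 < p := prime_gt1 pr.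
Local Notation csem := (csem p).
Local Notation nG := (nTotal m).
Local Notation sol := (solution p nExist nG (exist_atoms p) (all_node_atoms m)
                         (LAnd inj_clause Psi) E N).

(** The lists of values follow the order of the variables in the atom lists, so that an assignment
    is just a concatenation. *)
Definition row_values W i :=
  let b := repunit W i in let c := b %/ (W - 1) in
  [:: i %% (W - 1); b; b * W; c; c * W].
Definition row_aux W i :=
  let b := repunit W i in let c := b %/ (W - 1) in
  [:: ceil_pow p b; ceil_pow p b * W; ceil_pow p c; ceil_pow p c * W].
Definition digit_values W q x :=
  let y := x %/ q in let y' := y %/ W in
  [:: x %% q; y; y * q; y'; y' * W; y %% W;
      ceil_pow p y; ceil_pow p y * q; ceil_pow p y'; ceil_pow p y' * W].
Definition node_values W x1 x2 x3 i :=
  let q := W ^ i in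
  q :: row_values W i ++ row_aux W i ++
  digit_values W q x1 ++ digit_values W q x2 ++ digit_values W q x3.

Lemma ceil_pow_bound n q B : n * q <= B -> q <= B -> ceil_pow p n * q <= p * B.
Proof.
by move=> h1 h2; apply: leq_trans (ceil_pow_le pr n q) _; rewrite leq_mul2l geq_max h1 h2 orbT.
Qed.

Lemma ceil_pow_bound1 n B : n <= B -> 0 < B -> ceil_pow p n <= p * B.
Proof. by move=> h1 h2; have := @ceil_pow_bound n 1 B; rewrite !muln1; apply. Qed.

(** The largest product is b W = W^i + b - 1 <= 2 W^i, whence the 2 in the hypothesis. *)
Lemma row_values_bound W i B : 1 < W -> W <= B -> 2 * W ^ i <= B ->
  all (fun v => v <= p * B) (row_values W i ++ row_aux W i).
Proof.
move=> W1 WB qB; have E1 := repunitE i W1; have E2 := repunit_le i W1.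
have E3 := repunit_mod i W1; have E4 := divn_eq (repunit W i) (W - 1).
rewrite /row_values /row_aux /=; move: E1 E2 E3 E4; set b := repunit W i.
set c := b %/ _ => E1 E2 <- E4.
have B0 : 0 < B by lia.
have Bp : B <= p * B by rewrite leq_pmull // ltnW.
have hb : b * W <= B by lia.
have hb' : b <= B by lia.
have hc : c * W <= B by nia.
have hc' : c <= B by nia.
have hm : b %% (W - 1) <= B by nia.
rewrite !(ceil_pow_bound, ceil_pow_bound1) // andbT.
by rewrite !(leq_trans _ Bp).
Qed.

Lemma digit_values_bound W q x B : 0 < q -> 1 < W -> q <= B -> W <= B -> x < B ->
  all (fun v => v <= p * B) (digit_values W q x).
Proof.
move=> q0 W1 qB WB xB; have E1 := divn_eq x q; have E2 := divn_eq (x %/ q) W.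
rewrite /digit_values /=; move: E1 E2; set y := x %/ q; set y' := y %/ W => E1 E2.
have B0 : 0 < B by lia.
have Bp : B <= p * B by rewrite leq_pmull // ltnW.
have h1 : x %% q <= B by lia.
have h2 : y * q <= B by lia.
have h3 : y <= B by nia.
have h4 : y' * W <= B by lia.
have h5 : y' <= B by nia.
have h6 : y %% W <= B by lia.
rewrite !(ceil_pow_bound, ceil_pow_bound1) // andbT.
by rewrite !(leq_trans _ Bp).
Qed.

Lemma node_values_bound W x1 x2 x3 i Q : 1 < W -> W ^ i * W <= Q ->
  x1 < Q -> x2 < Q -> x3 < Q ->
  all (fun v => v <= p * Q) (node_values W x1 x2 x3 i).
Proof.
move=> W1 qQ h1 h2 h3.
have q0 : 0 < W ^ i by rewrite expn_gt0; lia.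
have qQ' : 2 * W ^ i <= Q by nia.
have WQ : W <= Q by nia.
have qQ1 : W ^ i <= Q by nia.
rewrite /node_values -cat1s !all_cat.
have := row_values_bound W1 WQ qQ'; rewrite all_cat => /andP [-> ->].
rewrite !digit_values_bound // !andbT /= andbT.
by rewrite (leq_trans qQ1) // leq_pmull // ltnW.
Qed.

(** The intended values of all node variables once the positions tau are chosen; the offset inside a
    node is an index into [node_values]. *)
Definition extend (r : nat -> nat) (tau : nat -> nat) i :=
  if i < nExist then r i else
  nth 0 (node_values (r 4) (r 11) (r 12) (r 13) (tau ((i - nExist) %/ 40))) ((i - nExist) %% 40).

Lemma extend_nvar r tau k o : o < 40 ->
  extend r tau (nvar k o) = nth 0 (node_values (r 4) (r 11) (r 12) (r 13) (tau k)) o.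
Proof.
move=> o40; rewrite /extend /nvar /nbase.
have -> : (20 + 40 * k + o < nExist) = false by rewrite /nExist; lia.
have -> : 20 + 40 * k + o - nExist = k * 40 + o by rewrite /nExist; lia.
by rewrite divnMDl // divn_small // addn0 modnMDl modn_small.
Qed.

Lemma extend_exist r tau i : i < nExist -> extend r tau i = r i.
Proof. by rewrite /extend => ->. Qed.

Lemma node_digits_complete r tau k x o w :
  r 0 = 1 -> r 4 = p ^ w -> x < nExist ->
  (forall j, j < 10 -> extend r tau (nvar k (o + j)) = nth 0 (digit_values (r 4) (r 4 ^ tau k) (r x)) j) ->
  csem (extend r tau) (node_digits k x o).
Proof.
move=> r0 r4 hx H; have r0' : extend r tau 0 = 1 by [].
have r4' : extend r tau 4 = r 4 by [].
have q' : extend r tau (nvar k 0) = r 4 ^ tau k by rewrite extend_nvar.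
have x' : extend r tau x = r x by exact: extend_exist.
have H0 := H 0 isT; have H1 := H 1 isT; have H2 := H 2 isT; have H3 := H 3 isT.
have H4 := H 4 isT; have H5 := H 5 isT; have H6 := H 6 isT; have H7 := H 7 isT.
have H8 := H 8 isT; have H9 := H 9 isT; rewrite /= addn0 in H0 H1 H2 H3 H4 H5 H6 H7 H8 H9.
apply: digit_atoms_complete => //; rewrite ?x' ?q' ?r4' ?H0 ?H1 ?H2 ?H3 ?H4 ?H5 ?H6 ?H7 ?H8 ?H9 //.
  by apply/(prel1 pr); exists (w * tau k); rewrite r4 expnM.
by apply/(prel1 pr); exists w.
Qed.

Lemma node_atoms_complete r tau k w :
  r 0 = 1 -> r 4 = p ^ w -> 0 < w -> r 4 ^ tau k < r 3 -> csem (extend r tau) (node_atoms k).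
Proof.
move=> r0 r4 w0 qQ; have r0' : extend r tau 0 = 1 by [].
have r4' : extend r tau 4 = r 4 by [].
change (lsem (extend r tau) (LLt (LV (nvar k 0)) (LV 3)) /\ csem (extend r tau)
 (row_atoms 4 (nvar k 0) (nvar k 1) (nvar k 2) (nvar k 3) (nvar k 4) (nvar k 5) (nvar k 6)
    (nvar k 7) (nvar k 8) (nvar k 9) ++
  node_digits k 11 10 ++ node_digits k 12 20 ++ node_digits k 13 30)).
split; first by change (extend r tau (nvar k 0) < extend r tau 3); rewrite extend_nvar.
apply/csem_cat; split.
  by apply: (row_atoms_complete pr (w := w) (i := tau k)); rewrite ?extend_nvar ?r4'.
apply/csem_cat; split; first by apply: (node_digits_complete r0 r4) => // -[|[|[|[|[|[|[|[|[|[|]]]]]]]]]] // _; rewrite extend_nvar.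
by apply/csem_cat; split; apply: (node_digits_complete r0 r4) => // -[|[|[|[|[|[|[|[|[|[|]]]]]]]]]] // _; rewrite extend_nvar.
Qed.

Lemma node_atoms_sound r k w : r 0 = 1 -> r 4 = p ^ w -> 0 < w -> csem r (node_atoms k) ->
  exists i, [/\ r (nvar k 0) = r 4 ^ i, r 4 ^ i < r 3, r (nvar k 1) = i %% (r 4 - 1) &
   [/\ r (nvar k 15) = (r 11 %/ r 4 ^ i) %% r 4, r (nvar k 25) = (r 12 %/ r 4 ^ i) %% r 4 &
       r (nvar k 35) = (r 13 %/ r 4 ^ i) %% r 4]].
Proof.
move=> r0 r4 w0 H; have {H}[h0 H] : r (nvar k 0) < r 3 /\ csem r
 (row_atoms 4 (nvar k 0) (nvar k 1) (nvar k 2) (nvar k 3) (nvar k 4) (nvar k 5) (nvar k 6)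
    (nvar k 7) (nvar k 8) (nvar k 9) ++
  node_digits k 11 10 ++ node_digits k 12 20 ++ node_digits k 13 30) by [].
move/csem_cat: H => [/(row_atoms_sound pr r0 r4 w0) [i [hq ht]]].
move=> /csem_cat [/(digit_atoms_sound pr r0) d1].
move=> /csem_cat [/(digit_atoms_sound pr r0) d2 /(digit_atoms_sound pr r0) d3].
by exists i; rewrite -hq.
Qed.

(** If T < N0, then W <= 2p(N0 + 2) and Q0 <= W^(T+1), so v(p) < 4p^2 Q0 is below this number. *)
Definition window_bound N0 := 4 * p ^ 2 * (2 * p * (N0 + 2)) ^ N0.+1.

(** The existential choice is arbitrary here: whatever it is, its digits define three functions on a
    long initial segment, and the universal block can realise every choice of positions in it. *)
Lemma solution_tables r N0 : sol r -> window_bound N0 <= E ->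
  exists T L R S, N0 <= T /\ forall tau, (forall k, k < m -> tau k < T) ->
    exists r', [/\ r' 0 = 1, r' 1 = N, node_view m r' tau L R S & lsem r' Psi].
Proof.
move=> [[r0 r1 gE cE /andP [win1 win2]] H] big.
move/csem_cat: cE => [[e1 [e2 [e3 [e4 [e5 [e6 [e7 _]]]]]]]].
move=> /csem_cat [e8 e9]; rewrite /= r0 in e1 e2 e3 e4 e5 e6 e7.
have [w r4] : exists w, r 4 = p ^ w.
  apply/(prel1 pr); move/csem_cat: e8 => [_ /csem_cat [/(mul_atomsP _ _ _ _ _ _ r0) M _]].
  by case: M => [[]].
have w0 : 0 < w by rewrite lt0n; apply/eqP => w00; move: e1; rewrite r4 w00.
have [T [QT tT]] := row_atoms_sound pr r0 r4 w0 e8.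
have Q0E := mul_atoms_sound pr r0 e9.
have {e4} e4 : r 4 <= 2 * p * (r 6 + 2) by move: e4; rewrite lev_mul /= r0; lia.
have W0 : 0 < r 4 by lia.
have Q0 : 0 < r 3 by rewrite QT expn_gt0 W0.
have V0 : 0 < r 5 by case: e2.
have QQ0 : r 3 <= r 2 by rewrite Q0E leq_pmulr.
have row tau : (forall k, k < m -> tau k < T) ->
    lsem (extend r tau) (LAnd inj_clause Psi).
  move=> hT.
  have qQ k : k < m -> r 4 ^ tau k * r 4 <= r 3.
    by move=> /hT h; rewrite QT -expnSr leq_exp2l.
  apply: H; first by move=> i; exact: extend_exist.
    move=> i iG i1; rewrite /extend; case: (ltnP i nExist) => iE; first exact: gE.
    set k := (_ - _) %/ 40; have km : k < m.
      by rewrite /k ltn_divLR //; move: iG; rewrite /nTotal /nExist in iE *; lia.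
    have B := node_values_bound e1 (qQ k km) e5 e6 e7.
    set o := _ %% 40.
    have o40 : o < size (node_values (r 4) (r 11) (r 12) (r 13) (tau k)) by rewrite ltn_pmod.
    by have := all_nthP 0 B o o40; nia.
  apply/csem_flatten => k; rewrite mem_iota /= => km.
  apply: (node_atoms_complete r0 r4 w0).
  by rewrite (leq_trans _ (qQ k km)) // ltn_Pmulr // expn_gt0 W0.
have TW : T < r 4.
  rewrite ltnNge; apply/negP => WT.
  have [|inj _] := row (fun k => if k == 0 then 0 else r 4 - 1).
    by move=> k _; case: ifP => _; lia.
  move: inj; rewrite /= !extend_nvar // /= modnn mod0n => /(_ erefl) /eqP.
  by rewrite eqn_exp2l //; lia.
pose dig x t := (x %/ r 4 ^ t) %% r 4.
exists T, (dig (r 11)), (dig (r 12)), (dig (r 13)); split.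
  rewrite leqNgt; apply/negP => TN.
  have r6 : r 6 <= T by rewrite tT leq_mod.
  have r4B : r 4 <= 2 * p * (N0 + 2) by apply: leq_trans e4 _; rewrite leq_mul2l; lia.
  have : r 2 <= (2 * p * (N0 + 2)) ^ N0.+1.
    have : r 2 <= r 4 ^ T.+1 by rewrite Q0E QT expnSr leq_mul2l ltnW ?orbT.
    move/leq_trans; apply; apply: leq_trans (_ : _ <= (2 * p * (N0 + 2)) ^ T.+1) _.
      by rewrite leq_exp2r.
    by rewrite leq_pexp2l //; lia.
  by move: big win2; rewrite /window_bound; nia.
move=> tau hT; exists (extend r tau); split=> //; last by case: (row tau hT).
move=> k km; rewrite !extend_nvar //=; split=> //.
by rewrite modn_small //; have := hT k km; lia.
Qed.

(** The bounds on L, R and S make all entries at positions below T digits in base W, as T < W. *)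
Lemma tables_solution (L R S : nat -> nat) :
  (forall t, L t <= t) -> (forall t, R t <= t) -> (forall t, S t <= 1) ->
  (forall r tau, r 0 = 1 -> r 1 = N -> node_view m r tau L R S -> lsem r Psi) ->
  4 * p ^ 3 <= E -> exists r, sol r.
Proof.
move=> hL hR hS H big.
have p0 : 0 < p by lia.
pose D := E %/ (4 * p); have D2 : p ^ 2 <= D.
  by rewrite leq_divRL ?muln_gt0 // mulnC -mulnA -expnS.
have D0 : 0 < D by apply: leq_trans D2; rewrite expn_gt0 p0.
(* p^j is the largest power with 4p p^j <= v(p). The assumption 4p^3 <= v(p) yields j >= 2, as
   [window_parameters] requires. *)
pose j := trunc_log p D.
have jD : p ^ j <= D by exact: trunc_logP.
have Dj : D < p ^ j.+1 by exact: trunc_log_ltn.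
have j2 : 1 < j by have := leq_ltn_trans D2 Dj; rewrite ltn_exp2l.
have [w [T [s [[w0 T0 jE sw] /andP [TW WT]]]]] := window_parameters pr j2.
pose W := p ^ w; pose Q := W ^ T; pose V := p ^ s.
have W1 : 1 < W by rewrite /W -(expn0 p) ltn_exp2l.
have Q0E : p ^ j = Q * V by rewrite jE expnD expnM.
have V0 : 0 < V by rewrite expn_gt0 p0.
have VW : V < W by rewrite ltn_exp2l.
have Tm : T %% (W - 1) = T by rewrite modn_small // /W; lia.
have lt1 t : t < T -> t < W by rewrite /W; lia.
have hL' t : t < T -> L t < W by move=> h; rewrite (leq_ltn_trans (hL t)) ?lt1.
have hR' t : t < T -> R t < W by move=> h; rewrite (leq_ltn_trans (hR t)) ?lt1.
have hS' t : t < T -> S t < W by move=> h; rewrite (leq_ltn_trans (hS t)).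
have WQ : W <= Q by rewrite /Q -{1}(expn1 W) leq_exp2l.
have Qpos : 0 < Q by lia.
pose x1 := encode W L T; pose x2 := encode W R T; pose x3 := encode W S T.
have x1Q : x1 < Q by exact: encode_lt.
have x2Q : x2 < Q by exact: encode_lt.
have x3Q : x3 < Q by exact: encode_lt.
pose vals := [:: 1; N; p ^ j; Q; W; V] ++ row_values W T ++ [:: x1; x2; x3] ++
  row_aux W T ++ [:: ceil_pow p Q; ceil_pow p Q * V].
pose r i := nth 0 vals i; exists r.
have VQ0 : V <= p ^ j by rewrite Q0E leq_pmull.
have QQ0 : Q <= p ^ j by rewrite Q0E leq_pmulr.
have bnd : forall i, i < nExist -> i != 1 -> r i <= p * (2 * p ^ j).
  have B1 : all (fun v => v <= p * (2 * p ^ j)) (row_values W T ++ row_aux W T).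
    by apply: row_values_bound => //; lia.
  have B2 : all (fun v => v <= p * (2 * p ^ j)) [:: 1; p ^ j; Q; W; V; x1; x2; x3;
      ceil_pow p Q; ceil_pow p Q * V].
    have pj : p ^ j <= p * (2 * p ^ j) by nia.
    have c1 : ceil_pow p Q <= p * (2 * p ^ j) by apply: ceil_pow_bound1; clear -QQ0 Qpos; lia.
    have c2 : ceil_pow p Q * V <= p * (2 * p ^ j) by apply: ceil_pow_bound; rewrite -?Q0E; clear -VQ0; lia.
    by rewrite /= c1 c2 !(leq_trans _ pj) //; lia.
  move=> i iE i1; have : r i \in (row_values W T ++ row_aux W T) ++
      [:: 1; p ^ j; Q; W; V; x1; x2; x3; ceil_pow p Q; ceil_pow p Q * V].
    move: iE i1; rewrite /r /vals.
    by do 20 (case: i => [|i]; first by rewrite /= ?inE ?eqxx ?orbT).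
  by move=> ri; have /allP := B1; rewrite mem_cat in ri; case/orP: ri => [/[swap] /[apply]//|ri _]; exact: (allP B2).
have r0 : r 0 = 1 by [].
have r4 : r 4 = p ^ w by [].
have winE : 4 * p * p ^ j <= E < 4 * p ^ 2 * p ^ j.
  have fp : 0 < 4 * p by rewrite muln_gt0.
  apply/andP; split.
    by apply: leq_trans (leq_trunc_div E (4 * p)); rewrite mulnC leq_mul2r jD orbT.
  apply: leq_trans (ltn_ceil E fp) _; rewrite -/D.
  have -> : 4 * p ^ 2 * p ^ j = p ^ j.+1 * (4 * p) by rewrite -mulnn [p ^ j.+1]expnS; ring.
  by rewrite leq_mul2r Dj orbT.
split.
  split; [exact: r0 | by [] | | | exact: winE].
  - move=> i iE i1; have := bnd i iE i1; case/andP: winE; clear; lia.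
  - apply/csem_cat; split; last (apply/csem_cat; split).
    + have pV : prel p 1 V by apply/(prel1 pr); exists s.
      rewrite /= !lev_mul /=; do !apply: conj => //.
      by change (W < 2 * p * (T %% (W - 1) + (1 + 1)) + 1); rewrite Tm /W; lia.
    + by apply: (row_atoms_complete pr (w := w) (i := T)).
    + by apply: mul_atoms_complete => //; apply/(prel1 pr); exists s.
move=> r' rr' gr' /csem_flatten cr'.
have r'0 : r' 0 = 1 by rewrite rr'.
have r'4 : r' 4 = p ^ w by rewrite rr'.
(* The universal values are arbitrary, but the atoms force each node to be a genuine row i < T;
   since T + 2 <= W, the index i is not altered by reduction modulo W - 1. *)
have nd k : k < m -> exists i, [/\ r' (nvar k 0) = W ^ i, i < T, r' (nvar k 1) = i &
   [/\ r' (nvar k 15) = L i, r' (nvar k 25) = R i & r' (nvar k 35) = S i]].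
  move=> km; have [|i] := node_atoms_sound r'0 r'4 w0 (cr' k _); first by rewrite mem_iota.
  rewrite (rr' 4) // (rr' 3) // (rr' 11) // (rr' 12) // (rr' 13) //.
  have -> : r 4 = W by []. have -> : r 3 = Q by []. have -> : r 11 = x1 by [].
  have -> : r 12 = x2 by []. have -> : r 13 = x3 by [].
  move=> [h1 h2 h3 [h4 h5 h6]]; exists i.
  have iT : i < T by move: h2; rewrite ltn_exp2l.
  have iW : i < W - 1.
    by rewrite ltn_subRL (leq_trans _ TW) // add1n addn2 !ltnS ltnW.
  rewrite h1 h3 h4 h5 h6 (modn_small iW); split; [by []|exact: iT|by []|].
  by split; exact: encode_digit.
split.
  have [i0 [q0 _ t0 _]] := nd 0 (ltnW m1); have [i1 [q1 _ t1 _]] := nd 1 m1.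
  by rewrite /= q0 q1 t0 t1 => ->.
pose tau k := r' (nvar k 1); apply: (H r' tau) => //; first by rewrite rr'.
by move=> k km; have [i [_ _ h1 [h2 h3 h4]]] := nd k km; rewrite /tau h1.
Qed.

End Tables.

(** * Recursive functions as Horn clauses *)

(** The successor in the Cantor enumeration: along an antidiagonal, then to the start of the next
    one. It involves only a test for zero and successors, so linear formulas can impose it. *)
Definition unpair_step (x : nat * nat) := if x.1 is a.+1 then (a, x.2.+1) else (x.2.+1, 0).
Definition unpair t := iter t unpair_step (0, 0).
Definition cfst t := (unpair t).1.
Definition csnd t := (unpair t).2.

Definition triangle n := n * n.+1 %/ 2.

Lemma triangleS n : triangle n.+1 = triangle n + n.+1.
Proof.
rewrite /triangle (_ : n.+1 * n.+2 = n.+1 * 2 + n * n.+1); last by lia.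
by rewrite divnMDl // addnC.
Qed.

Lemma cpairE a b : cpair a b = triangle (a + b) + b. Proof. by []. Qed.

Lemma cpair_step x : cpair (unpair_step x).1 (unpair_step x).2 = (cpair x.1 x.2).+1.
Proof.
case: x => [[|a] b] /=; rewrite !cpairE; first by rewrite add0n !addn0 triangleS addnS.
by rewrite addSnnS addnS.
Qed.

Lemma cpair_unpair t : cpair (cfst t) (csnd t) = t.
Proof. by elim: t => // t IH; rewrite /cfst /csnd /unpair iterS cpair_step IH. Qed.

Lemma unpair_cpair a b : unpair (cpair a b) = (a, b).
Proof.
have [n En] := ubnP (cpair a b); elim: n a b En => // n IH a b.
case: b => [|b]; last first.
  have := cpair_step (a.+1, b) => /= -> lt; rewrite /unpair iterS -/(unpair _).
  by rewrite (IH a.+1 b).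
case: a => [|a] //; have := cpair_step (0, a) => /= -> lt.
by rewrite /unpair iterS -/(unpair _) (IH 0 a).
Qed.

Lemma cfst_cpair a b : cfst (cpair a b) = a. Proof. by rewrite /cfst unpair_cpair. Qed.
Lemma csnd_cpair a b : csnd (cpair a b) = b. Proof. by rewrite /csnd unpair_cpair. Qed.

Lemma cpair_inj a b c d : cpair a b = cpair c d -> a = c /\ b = d.
Proof. by move=> /(congr1 unpair); rewrite !unpair_cpair => -[]. Qed.

Lemma triangle_ge n : n <= triangle n.
Proof. by elim: n => // n IH; rewrite triangleS; lia. Qed.

Lemma cfst_le t : cfst t <= t.
Proof.
rewrite -[X in _ <= X]cpair_unpair cpairE; have := triangle_ge (cfst t + csnd t); lia.
Qed.

Lemma csnd_le t : csnd t <= t.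
Proof. by rewrite -[X in _ <= X]cpair_unpair cpairE leq_addl. Qed.

(* Tags: 0-5 are the constructors of mrec, 6 is simultaneous evaluation of a list of functions,
   7 records how far an unbounded search has progressed. *)
Fixpoint mcode (g : mrec) : nat :=
  match g with
  | MZero => cpair 0 0
  | MSucc => cpair 1 0
  | MProj i => cpair 2 i
  | MComp f gs => cpair 3 (cpair (mcode f)
      ((fix codes gs := if gs is g :: gs' then (cpair (mcode g) (codes gs')).+1 else 0) gs))
  | MPrim f g => cpair 4 (cpair (mcode f) (mcode g))
  | MMu f => cpair 5 (mcode f)
  end.

Fixpoint mcodes gs := if gs is g :: gs' then (cpair (mcode g) (mcodes gs')).+1 else 0.
Fixpoint lcode l := if l is x :: l' then (cpair x (lcode l')).+1 else 0.

(* HT k c is the value of node k plus c, and HX is the parameter N. A clause is a list of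
   hypotheses with a conclusion: HPair k a b says that node k is the pair (a, b), HHold k that the
   fact coded by node k holds, and the conclusion None is falsity. *)
Inductive htm := HC of nat | HT of nat & nat | HX.
Inductive hitem := HPair of nat & htm & htm | HHold of nat.
Definition clause := (seq hitem * option nat)%type.

Section ClauseSemantics.
Variables (N : nat) (S : nat -> Prop) (tau : nat -> nat).
Definition hev a := match a with HC c => c | HT k c => tau k + c | HX => N end.
Definition hitem_sem i : Prop :=
  match i with HPair k a b => tau k = cpair (hev a) (hev b) | HHold k => S (tau k) end.
Fixpoint clause_sem its c : Prop :=
  if its is i :: its' then hitem_sem i -> clause_sem its' c
  else if c is Some k then S (tau k) else False.
End ClauseSemantics.

Definition htr a := match a with HC c => lconst c | HT k c => LA (tvar k) (lconst c) | HX => LV 1 end.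
Definition hitem_tr i :=
  match i with
  | HPair k a b => LAnd (LEq (lvar k) (htr a)) (LEq (rvar k) (htr b))
  | HHold k => LEq (svar k) (LV 0)
  end.
Definition clause_tr (c : clause) : lform :=
  foldr (fun i f => LImp (hitem_tr i) f) (if c.2 is Some k then LEq (svar k) (LV 0) else LFalse) c.1.

Definition htm_ok m a := if a is HT k _ then k < m else true.
Definition hitem_ok m i :=
  match i with HPair k a b => [&& k < m, htm_ok m a & htm_ok m b] | HHold k => k < m end.
Definition clause_ok m (c : clause) :=
  all (hitem_ok m) c.1 && (if c.2 is Some k then k < m else true).

Lemma hitem_tr_ok m i : hitem_ok m i -> lform_ok (nTotal m) (hitem_tr i).
Proof.
have n0 : 0 < nTotal m by rewrite /nTotal.
have n1 : 1 < nTotal m by rewrite /nTotal.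
have T a : htm_ok m a -> lterm_ok (nTotal m) (htr a).
  by case: a => [c|k c|] //= h; rewrite ?nvar_lt // lterm_ok_const.
by case: i => [k a b|k] /= => [/and3P [hk /T -> /T ->]|hk]; rewrite !nvar_lt.
Qed.

Lemma clause_tr_ok m c : clause_ok m c -> lform_ok (nTotal m) (clause_tr c).
Proof.
case: c => its c; rewrite /clause_ok /clause_tr /= => /andP [].
elim: its => [_|i its IH] /=; first by case: c => //= k hk; rewrite !nvar_lt.
by move=> /andP [/hitem_tr_ok -> /IH h] /h.
Qed.

Lemma clause_trP m N r (tau L R S : nat -> nat) (P : nat -> Prop) c :
  r 0 = 1 -> r 1 = N -> node_view m r tau L R S ->
  (forall k, k < m -> L (tau k) = cfst (tau k)) -> (forall k, k < m -> R (tau k) = csnd (tau k)) ->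
  (forall k, k < m -> S (tau k) = 1 <-> P (tau k)) ->
  clause_ok m c -> lsem r (clause_tr c) <-> clause_sem N P tau c.1 c.2.
Proof.
move=> r0 r1 V HL HR HS; case: c => its c /andP [/= hits hc].
have sv k : k < m -> lsem r (LEq (svar k) (LV 0)) <-> P (tau k).
  by move=> km; have [_ _ _ h] := V k km; rewrite /= h r0; exact: HS.
have tm a : htm_ok m a -> lev r (htr a) = hev N tau a.
  case: a => [b|k b|] //= h; first by rewrite lev_const.
  by have [-> _ _ _] := V k h; rewrite lev_const.
have it i : hitem_ok m i -> lsem r (hitem_tr i) <-> hitem_sem N P tau i.
  case: i => [k a b|k] /=; last exact: sv.
  move=> /and3P [km /tm -> /tm ->]; have [_ -> -> _] := V k km; rewrite HL // HR //.
  split; first by move=> [<- <-]; rewrite cpair_unpair.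
  by move=> ->; rewrite cfst_cpair csnd_cpair.
elim: its hits => [_|i its IH] /=; first by case: c hc => // k; exact: sv.
by move=> /andP [/it h1 /IH h2]; rewrite /clause_tr /= in h2 *; tauto.
Qed.

(** Together with [pair_succ_clause] this determines the component tables by recursion on the
    position; the quadratic formula of [cpair] is never expressed. *)
Definition pair_zero_clause := LImp (LEq (tvar 0) LZ) (LAnd (LEq (lvar 0) LZ) (LEq (rvar 0) LZ)).
Definition pair_succ_clause :=
  LImp (LEq (tvar 1) (LA (tvar 0) (LV 0)))
   (LAnd (LImp (LEq (lvar 0) LZ) (LAnd (LEq (lvar 1) (LA (rvar 0) (LV 0))) (LEq (rvar 1) LZ)))
         (LImp (LLt LZ (lvar 0))
           (LAnd (LEq (LA (lvar 1) (LV 0)) (lvar 0)) (LEq (rvar 1) (LA (rvar 0) (LV 0)))))).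

Section Rules.

Local Notation T k := (HT k 0).
Local Notation "T+ k" := (HT k 1) (at level 10).
Local Notation "k <~ a & b" := (HPair k a b) (at level 60, a at level 9, b at level 9).
Local Notation H := HHold.

(** In each rule the low nodes are free parameters and the others assemble codes from them. A shift
    by one builds a nonempty list, since [lcode] and [mcodes] add 1 to the pair of head and tail. *)
Definition rule_zero : clause :=
  ([:: 1 <~ (HC 0) & (HC 0); 2 <~ (T 0) & (HC 0); 3 <~ (T 1) & (T 2)], Some 3).
Definition rule_succ : clause :=
  ([:: 2 <~ (T 0) & (T 1); 3 <~ (HC 1) & (HC 0); 4 <~ (T+ 2) & (T+ 0); 5 <~ (T 3) & (T 4)], Some 5).
Definition rule_proj_nil : clause :=
  ([:: 1 <~ (HC 2) & (T 0); 2 <~ (HC 0) & (HC 0); 3 <~ (T 1) & (T 2)], Some 3).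
Definition rule_proj0 : clause :=
  ([:: 2 <~ (T 0) & (T 1); 3 <~ (HC 2) & (HC 0); 4 <~ (T+ 2) & (T 0); 5 <~ (T 3) & (T 4)], Some 5).
Definition rule_projS : clause :=
  ([:: 4 <~ (HC 2) & (T 0); 5 <~ (T 2) & (T 3); 6 <~ (T 4) & (T 5); H 6; 7 <~ (T 1) & (T 2);
       8 <~ (HC 2) & (T+ 0); 9 <~ (T+ 7) & (T 3); 10 <~ (T 8) & (T 9)], Some 10).
Definition rule_comp : clause :=
  ([:: 5 <~ (T 0) & (T 1); 6 <~ (HC 3) & (T 5); 7 <~ (HC 6) & (T 1); 8 <~ (T 2) & (T 3);
       9 <~ (T 7) & (T 8); H 9; 10 <~ (T 3) & (T 4); 11 <~ (T 0) & (T 10); H 11;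
       12 <~ (T 2) & (T 4); 13 <~ (T 6) & (T 12)], Some 13).
Definition rule_prim0 : clause :=
  ([:: 4 <~ (T 0) & (T 1); 5 <~ (HC 4) & (T 4); 6 <~ (T 2) & (T 3); 7 <~ (T 0) & (T 6); H 7;
       8 <~ (HC 0) & (T 2); 9 <~ (T+ 8) & (T 3); 10 <~ (T 5) & (T 9)], Some 10).
Definition rule_primS : clause :=
  ([:: 6 <~ (T 0) & (T 1); 7 <~ (HC 4) & (T 6); 8 <~ (T 2) & (T 3); 9 <~ (T+ 8) & (T 4);
       10 <~ (T 7) & (T 9); H 10; 11 <~ (T 4) & (T 3); 12 <~ (T 2) & (T+ 11);
       13 <~ (T+ 12) & (T 5); 14 <~ (T 1) & (T 13); H 14; 15 <~ (T+ 2) & (T 3);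
       16 <~ (T+ 15) & (T 5); 17 <~ (T 7) & (T 16)], Some 17).
Definition rule_search0 : clause :=
  ([:: 2 <~ (HC 7) & (T 0); 3 <~ (T 1) & (HC 0); 4 <~ (T 2) & (T 3)], Some 4).
Definition rule_searchS : clause :=
  ([:: 4 <~ (HC 7) & (T 0); 5 <~ (T 1) & (T 2); 6 <~ (T 4) & (T 5); H 6; 7 <~ (T 2) & (T 1);
       8 <~ (T+ 7) & (T+ 3); 9 <~ (T 0) & (T 8); H 9; 10 <~ (T 1) & (T+ 2);
       11 <~ (T 4) & (T 10)], Some 11).
Definition rule_mu : clause :=
  ([:: 3 <~ (HC 7) & (T 0); 4 <~ (T 1) & (T 2); 5 <~ (T 3) & (T 4); H 5; 6 <~ (T 2) & (T 1);
       7 <~ (T+ 6) & (HC 0); 8 <~ (T 0) & (T 7); H 8; 9 <~ (HC 5) & (T 0);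
       10 <~ (T 9) & (T 4)], Some 10).
Definition rule_nil : clause :=
  ([:: 1 <~ (HC 6) & (HC 0); 2 <~ (T 0) & (HC 0); 3 <~ (T 1) & (T 2)], Some 3).
Definition rule_cons : clause :=
  ([:: 5 <~ (T 2) & (T 3); 6 <~ (T 0) & (T 5); H 6; 7 <~ (HC 6) & (T 1); 8 <~ (T 2) & (T 4);
       9 <~ (T 7) & (T 8); H 9; 10 <~ (T 0) & (T 1); 11 <~ (HC 6) & (T+ 10);
       12 <~ (T 3) & (T 4); 13 <~ (T 2) & (T+ 12); 14 <~ (T 11) & (T 13)], Some 14).
Definition rule_goal hc : clause :=
  ([:: 0 <~ HX & (HC 0); 1 <~ (T+ 0) & (HC 1); 2 <~ (HC hc) & (T 1); H 2], None).

End Rules.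

Definition rules : seq clause :=
  [:: rule_zero; rule_succ; rule_proj_nil; rule_proj0; rule_projS; rule_comp; rule_prim0;
      rule_primS; rule_search0; rule_searchS; rule_mu; rule_nil; rule_cons].

(** The longest rule, [rule_primS], mentions nodes 0 to 17. *)
Definition nNodes := 18.

Definition horn_form hc : lform :=
  LAnd pair_zero_clause (LAnd pair_succ_clause
    (foldr LAnd (clause_tr (rule_goal hc)) (map clause_tr rules))).

Lemma rules_ok : all (clause_ok nNodes) rules. Proof. by []. Qed.

Lemma horn_form_ok hc : lform_ok (nTotal nNodes) (horn_form hc).
Proof.
have C : all (lform_ok (nTotal nNodes)) (map clause_tr rules).
  by rewrite all_map; apply: sub_all rules_ok => c; exact: clause_tr_ok.
have G : lform_ok (nTotal nNodes) (clause_tr (rule_goal hc)) by exact: clause_tr_ok.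
rewrite /horn_form; move: C G; set g := clause_tr (rule_goal hc); move: (map _ _) => s C G.
change (true && (true && lform_ok (nTotal nNodes) (foldr LAnd g s))) => /=.
by elim: s C => //= f s IH /andP [-> /IH].
Qed.

(** * Derivations inside a bounded table, and validity of facts *)

Definition fact c l y := cpair c (cpair l y).

Definition closed_below N T S := forall c, List.In c rules -> forall tau,
  (forall k, k < nNodes -> tau k < T) -> clause_sem N S tau c.1 c.2.

Section MevalInduction.
Variables (P : mrec -> seq nat -> nat -> Prop) (Q : list mrec -> seq nat -> seq nat -> Prop).
Hypothesis Pzero : forall l, P MZero l 0.
Hypothesis Psucc : forall x l, P MSucc (x :: l) x.+1.
Hypothesis Pproj : forall i l, P (MProj i) l (nth 0 l i).
Hypothesis Pcomp : forall f gs l ys y, Q gs l ys -> P f ys y -> P (MComp f gs) l y.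
Hypothesis Pprim0 : forall f g l y, P f l y -> P (MPrim f g) (0 :: l) y.
Hypothesis PprimS : forall f g n l r y, P (MPrim f g) (n :: l) r -> P g (n :: r :: l) y ->
  P (MPrim f g) (n.+1 :: l) y.
Hypothesis Pmu : forall f l n, P f (n :: l) 0 ->
  (forall m, m < n -> exists k, P f (m :: l) k.+1) -> P (MMu f) l n.
Hypothesis Qnil : forall l, Q nil l [::].
Hypothesis Qcons : forall g gs l y ys, P g l y -> Q gs l ys -> Q (g :: gs) l (y :: ys).

(* The generated induction principles miss the recursive call under the existential in ev_mu. *)
Fixpoint meval_mut g l y (e : meval g l y) {struct e} : P g l y :=
  match e in meval g l y return P g l y with
  | ev_zero l => Pzero l
  | ev_succ x l => Psucc x l
  | ev_proj i l => Pproj i l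
  | ev_comp f gs l ys y e1 e2 => Pcomp (meval_list_mut e1) (meval_mut e2)
  | ev_prim0 f g l y e1 => Pprim0 g (meval_mut e1)
  | ev_primS f g n l r y e1 e2 => PprimS (meval_mut e1) (meval_mut e2)
  | ev_mu f l n e1 e2 => Pmu (meval_mut e1)
      (fun m h => match e2 m h with ex_intro k e3 => ex_intro _ k (meval_mut e3) end)
  end
with meval_list_mut gs l ys (e : meval_list gs l ys) {struct e} : Q gs l ys :=
  match e in meval_list gs l ys return Q gs l ys with
  | evl_nil l => Qnil l
  | evl_cons g gs l y ys e1 e2 => Qcons (meval_mut e1) (meval_list_mut e2)
  end.

End MevalInduction.

Local Opaque cpair.

(** The sum is a crude common bound, so one inequality places a whole instance of a rule inside the
    table, including the default 0 beyond the list. *)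
Lemma nth_lt_sumn s k T : sumn s < T -> nth 0 s k < T.
Proof.
elim: s k => [|x s IH] [|k] //=; try lia.
by move=> h; apply: IH; lia.
Qed.

Lemma closed_below_nth N T S : closed_below N T S -> forall c, List.In c rules ->
  forall s, sumn s < T -> clause_sem N S (nth 0 s) c.1 c.2.
Proof. by move=> cl c hc s hs; apply: cl => // k _; exact: nth_lt_sumn. Qed.

Ltac in_rules := repeat (first [left; reflexivity | right]).
Ltac fire cl c s :=
  let H := fresh in
  pose proof (@closed_below_nth _ _ _ cl c ltac:(in_rules) s ltac:(lia)) as H;
  rewrite /= ?addn0 ?addn1 in H; apply: H => //.

(** Induction on the derivation: each evaluation step fires a rule at explicit node values, and the
    bounds of the premises add up. The bound is found before N, T and S are given. *)
Lemma meval_fact_bounded :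
  (forall g l y, meval g l y -> exists N0, forall N T S, N0 <= T -> closed_below N T S ->
     S (fact (mcode g) (lcode l) y)) /\
  (forall gs l ys, meval_list gs l ys -> exists N0, forall N T S, N0 <= T -> closed_below N T S ->
     S (fact (cpair 6 (mcodes gs)) (lcode l) (lcode ys))).
Proof.
set P := fun g l y => exists N0, forall N T S, N0 <= T -> closed_below N T S ->
     S (fact (mcode g) (lcode l) y).
set Q := fun gs l ys => exists N0, forall N T S, N0 <= T -> closed_below N T S ->
     S (fact (cpair 6 (mcodes gs)) (lcode l) (lcode ys)).
have Pzero l : P MZero l 0.
  pose s := [:: lcode l; cpair 0 0; cpair (lcode l) 0; fact (cpair 0 0) (lcode l) 0].
  by exists (sumn s).+1 => N T S hT cl; fire cl rule_zero s.
have Psucc x l : P MSucc (x :: l) x.+1.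
  pose s := [:: x; lcode l; cpair x (lcode l); cpair 1 0; cpair (lcode (x :: l)) x.+1;
                fact (cpair 1 0) (lcode (x :: l)) x.+1].
  by exists (sumn s).+1 => N T S hT cl; fire cl rule_succ s.
have Pproj i l : P (MProj i) l (nth 0 l i).
  elim: i l => [|i IH] [|x l] /=.
  - pose s := [:: 0; cpair 2 0; cpair 0 0; fact (cpair 2 0) 0 0].
    by exists (sumn s).+1 => N T S hT cl; fire cl rule_proj_nil s.
  - pose s := [:: x; lcode l; cpair x (lcode l); cpair 2 0; cpair (lcode (x :: l)) x;
                fact (cpair 2 0) (lcode (x :: l)) x].
    by exists (sumn s).+1 => N T S hT cl; fire cl rule_proj0 s.
  - pose s := [:: i.+1; cpair 2 i.+1; cpair 0 0; fact (cpair 2 i.+1) 0 0].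
    by exists (sumn s).+1 => N T S hT cl; fire cl rule_proj_nil s.
  - have [N0 h0] := IH l; pose y := nth 0 l i.
    pose s := [:: i; x; lcode l; y; cpair 2 i; cpair (lcode l) y; fact (cpair 2 i) (lcode l) y;
       cpair x (lcode l); cpair 2 i.+1; cpair (lcode (x :: l)) y;
       fact (cpair 2 i.+1) (lcode (x :: l)) y].
    exists ((sumn s).+1 + N0) => N T S hT cl.
    have h : S (fact (cpair 2 i) (lcode l) y) by apply: h0 cl; lia.
    by fire cl rule_projS s.
have Pcomp f gs l ys y : Q gs l ys -> P f ys y -> P (MComp f gs) l y.
  move=> [N0 h0] [N1 h1]; pose cf := mcode f; pose cg := mcodes gs.
  pose s := [:: cf; cg; lcode l; lcode ys; y; cpair cf cg; cpair 3 (cpair cf cg); cpair 6 cg;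
     cpair (lcode l) (lcode ys); fact (cpair 6 cg) (lcode l) (lcode ys); cpair (lcode ys) y;
     fact cf (lcode ys) y; cpair (lcode l) y; fact (mcode (MComp f gs)) (lcode l) y].
  exists ((sumn s).+1 + N0 + N1) => N T S hT cl.
  have h2 : S (fact (cpair 6 cg) (lcode l) (lcode ys)) by apply: h0 cl; lia.
  have h3 : S (fact cf (lcode ys) y) by apply: h1 cl; lia.
  by fire cl rule_comp s.
have Pprim0 f g l y : P f l y -> P (MPrim f g) (0 :: l) y.
  move=> [N0 h0]; pose cf := mcode f; pose cg := mcode g; pose m := mcode (MPrim f g).
  pose s := [:: cf; cg; lcode l; y; cpair cf cg; m; cpair (lcode l) y; fact cf (lcode l) y;
     cpair 0 (lcode l); cpair (lcode (0 :: l)) y; fact m (lcode (0 :: l)) y].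
  exists ((sumn s).+1 + N0) => N T S hT cl.
  have h2 : S (fact cf (lcode l) y) by apply: h0 cl; lia.
  by fire cl rule_prim0 s.
have PprimS f g n l r y : P (MPrim f g) (n :: l) r -> P g (n :: r :: l) y ->
    P (MPrim f g) (n.+1 :: l) y.
  move=> [N0 h0] [N1 h1]; pose cf := mcode f; pose cg := mcode g; pose m := mcode (MPrim f g).
  pose s := [:: cf; cg; n; lcode l; r; y; cpair cf cg; m; cpair n (lcode l);
     cpair (lcode (n :: l)) r; fact m (lcode (n :: l)) r; cpair r (lcode l);
     cpair n (lcode (r :: l)); cpair (lcode (n :: r :: l)) y; fact cg (lcode (n :: r :: l)) y;
     cpair n.+1 (lcode l); cpair (lcode (n.+1 :: l)) y; fact m (lcode (n.+1 :: l)) y].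
  exists ((sumn s).+1 + N0 + N1) => N T S hT cl.
  have h2 : S (fact m (lcode (n :: l)) r) by apply: h0 cl; lia.
  have h3 : S (fact cg (lcode (n :: r :: l)) y) by apply: h1 cl; lia.
  by fire cl rule_primS s.
have Pmu f l n : P f (n :: l) 0 -> (forall m, m < n -> exists k, P f (m :: l) k.+1) ->
    P (MMu f) l n.
  move=> [N0 h0] hm; pose cf := mcode f.
  (* An inner induction on n follows the search, each step consuming one nonzero value of f. *)
  have [N1 h1] : exists N1, forall N T S, N1 <= T -> closed_below N T S ->
      S (fact (cpair 7 cf) (lcode l) n).
    elim: {h0} n hm => [|n IH] hm.
      pose s := [:: cf; lcode l; cpair 7 cf; cpair (lcode l) 0; fact (cpair 7 cf) (lcode l) 0].
      by exists (sumn s).+1 => N T S hT cl; fire cl rule_search0 s.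
    have [|N1 h1] := IH; first by move=> m mn; apply: hm; lia.
    have [k [N2 h2]] := hm n (ltnSn n).
    pose s := [:: cf; lcode l; n; k; cpair 7 cf; cpair (lcode l) n; fact (cpair 7 cf) (lcode l) n;
      cpair n (lcode l); cpair (lcode (n :: l)) k.+1; fact cf (lcode (n :: l)) k.+1;
      cpair (lcode l) n.+1; fact (cpair 7 cf) (lcode l) n.+1].
    exists ((sumn s).+1 + N1 + N2) => N T S hT cl.
    have h3 : S (fact (cpair 7 cf) (lcode l) n) by apply: h1 cl; lia.
    have h4 : S (fact cf (lcode (n :: l)) k.+1) by apply: h2 cl; lia.
    by fire cl rule_searchS s.
  pose s := [:: cf; lcode l; n; cpair 7 cf; cpair (lcode l) n; fact (cpair 7 cf) (lcode l) n;
    cpair n (lcode l); cpair (lcode (n :: l)) 0; fact cf (lcode (n :: l)) 0; cpair 5 cf;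
    fact (cpair 5 cf) (lcode l) n].
  exists ((sumn s).+1 + N0 + N1) => N T S hT cl.
  have h3 : S (fact (cpair 7 cf) (lcode l) n) by apply: h1 cl; lia.
  have h4 : S (fact cf (lcode (n :: l)) 0) by apply: h0 cl; lia.
  by fire cl rule_mu s.
have Qnil l : Q nil l [::].
  pose s := [:: lcode l; cpair 6 0; cpair (lcode l) 0; fact (cpair 6 0) (lcode l) 0].
  by exists (sumn s).+1 => N T S hT cl; fire cl rule_nil s.
have Qcons g gs l y ys : P g l y -> Q gs l ys -> Q (g :: gs) l (y :: ys).
  move=> [N0 h0] [N1 h1]; pose c := mcode g; pose cs := mcodes gs.
  pose s := [:: c; cs; lcode l; y; lcode ys; cpair (lcode l) y; fact c (lcode l) y; cpair 6 cs;
     cpair (lcode l) (lcode ys); fact (cpair 6 cs) (lcode l) (lcode ys); cpair c cs;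
     cpair 6 (cpair c cs).+1; cpair y (lcode ys); cpair (lcode l) (lcode (y :: ys));
     fact (cpair 6 (cpair c cs).+1) (lcode l) (lcode (y :: ys))].
  exists ((sumn s).+1 + N0 + N1) => N T S hT cl.
  have h2 : S (fact c (lcode l) y) by apply: h0 cl; lia.
  have h3 : S (fact (cpair 6 cs) (lcode l) (lcode ys)) by apply: h1 cl; lia.
  by fire cl rule_cons s.
split.
  exact: (meval_mut Pzero Psucc Pproj Pcomp Pprim0 PprimS Pmu Qnil Qcons).
exact: (meval_list_mut Pzero Psucc Pproj Pcomp Pprim0 PprimS Pmu Qnil Qcons).
Qed.

(** Numbers that code no program or list are vacuously valid, so the rules do not have to check that
    their parameters are well formed. *)
Definition valid c l y :=
  [/\ forall g ls, c = mcode g -> l = lcode ls -> meval g ls y,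
      forall gs ls, c = cpair 6 (mcodes gs) -> l = lcode ls ->
        exists2 ys, y = lcode ys & meval_list gs ls ys &
      forall f ls, c = cpair 7 (mcode f) -> l = lcode ls ->
        forall m, m < y -> exists k, meval f (m :: ls) k.+1].

Definition validS t := valid (cfst t) (cfst (csnd t)) (csnd (csnd t)).

Lemma validSE c l y : validS (cpair c (cpair l y)) = valid c l y.
Proof. by rewrite /validS !(cfst_cpair, csnd_cpair). Qed.

Lemma mcode_inv g t x : mcode g = cpair t x ->
  match g with
  | MZero => t = 0
  | MSucc => t = 1
  | MProj i => t = 2 /\ x = i
  | MComp f gs => t = 3 /\ x = cpair (mcode f) (mcodes gs)
  | MPrim f g => t = 4 /\ x = cpair (mcode f) (mcode g)
  | MMu f => t = 5 /\ x = mcode f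
  end.
Proof. by case: g => [||i|f gs|f g|f] /= /cpair_inj []. Qed.

Lemma valid_low t x l y : t < 6 ->
  (forall g ls, mcode g = cpair t x -> l = lcode ls -> meval g ls y) -> valid (cpair t x) l y.
Proof.
move=> t6 h; split=> [g ls e|gs ls /cpair_inj [e _]|f ls /cpair_inj [e _]].
- exact: h.
- by rewrite e in t6.
- by rewrite e in t6.
Qed.

Lemma valid_list x l y :
  (forall gs ls, x = mcodes gs -> l = lcode ls -> exists2 ys, y = lcode ys & meval_list gs ls ys) ->
  valid (cpair 6 x) l y.
Proof.
move=> h; split=> [g ls /esym /mcode_inv|gs ls /cpair_inj [_]|f ls /cpair_inj []] //; last exact: h.
by case: g => // [i|f gs|f g|f] [].
Qed.

Lemma valid_search x l y :
  (forall f ls, x = mcode f -> l = lcode ls ->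
     forall m, m < y -> exists k, meval f (m :: ls) k.+1) ->
  valid (cpair 7 x) l y.
Proof.
move=> h; split=> [g ls /esym /mcode_inv|gs ls /cpair_inj []|f ls /cpair_inj [_]] //; last exact: h.
by case: g => // [i|f gs|f g|f] [].
Qed.

Lemma lcode_cons a b ls : (cpair a b).+1 = lcode ls -> exists2 ls', ls = a :: ls' & b = lcode ls'.
Proof. by case: ls => // x ls [] /cpair_inj [-> ->]; exists ls. Qed.

(** The code of the conclusion is inverted, which leaves only the constructor treated by the rule;
    the premises then supply its evaluations. No bound on the positions enters. *)
Lemma validS_closed N c : List.In c rules -> forall tau, clause_sem N validS tau c.1 c.2.
Proof.
move=> [<-|[<-|[<-|[<-|[<-|[<-|[<-|[<-|[<-|[<-|[<-|[<-|[<-|[]]]]]]]]]]]]]] tau;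
  rewrite /= ?addn0 ?addn1.
- move=> -> -> ->; rewrite validSE; apply: valid_low => // g ls /mcode_inv.
  case: g => [_ _||i|f gs|f g|f] //; try by case.
  by constructor.
- move=> -> -> -> ->; rewrite validSE; apply: valid_low => // g ls /mcode_inv.
  case: g => [|_|i|f gs|f g|f] //; try by case.
  by move=> /lcode_cons [ls' -> _]; constructor.
- move=> -> -> ->; rewrite validSE; apply: valid_low => // g ls /mcode_inv.
  case: g => [||i|f gs|f g|f] //; try by case.
  case=> _ _; case: ls => // _; rewrite -[X in meval _ _ X](nth_nil 0 i).
  by constructor.
- move=> -> -> -> ->; rewrite validSE; apply: valid_low => // g ls /mcode_inv.
  case: g => [||i|f gs|f g|f] //; try by case.
  case=> _ <- /lcode_cons [ls' -> _].
  by rewrite -[X in meval _ _ X]/(nth 0 (tau 0 :: ls') 0); constructor.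
- move=> -> -> ->; rewrite validSE => -[h _ _] -> -> -> ->; rewrite validSE.
  apply: valid_low => // g ls /mcode_inv.
  case: g => [||i|f gs|f g|f] //; try by case.
  case=> _ <- /lcode_cons [ls' -> e].
  have := h (MProj (tau 0)) ls' erefl e => M; inversion M; subst.
  by rewrite -[nth 0 ls' _]/(nth 0 (tau 1 :: ls') (tau 0).+1); constructor.
- move=> -> -> -> -> ->; rewrite validSE => -[_ h _] -> ->; rewrite validSE => -[h' _ _] -> ->.
  rewrite validSE; apply: valid_low => // g ls /mcode_inv.
  case: g => [||i|f gs|f g|f] //; try by case.
  case=> _ /cpair_inj [ef egs] el; have [ys ey M] := h _ _ (congr1 _ egs) el.
  exact: ev_comp M (h' _ _ ef ey).
- move=> -> -> -> ->; rewrite validSE => -[h _ _] -> -> ->; rewrite validSE.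
  apply: valid_low => // g ls /mcode_inv.
  case: g => [||i|f gs|f g|f] //; try by case.
  case=> _ /cpair_inj [ef eg] /lcode_cons [ls' -> el].
  by constructor; exact: h.
- move=> -> -> -> -> ->; rewrite validSE => -[h _ _] -> -> -> ->.
  rewrite validSE => -[h' _ _] -> -> ->; rewrite validSE; apply: valid_low => // g ls /mcode_inv.
  case: g => [||i|f gs|f g|f] //; try by case.
  case=> _ /cpair_inj [ef eg] /lcode_cons [ls' -> el].
  apply: (ev_primS (r := tau 4)); last by apply: h' => //; rewrite /= el.
  by apply: (h (MPrim f g)) => /=; rewrite ?ef ?eg ?el.
- by move=> -> -> ->; rewrite validSE; exact: valid_search.
- move=> -> -> ->; rewrite validSE => -[_ _ h] -> -> ->; rewrite validSE => -[h' _ _] -> ->.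
  rewrite validSE; apply: valid_search => f ls ef el m; rewrite ltnS leq_eqVlt => /orP [/eqP ->|].
    by exists (tau 3); apply: h' => //=; rewrite el.
  by apply: h => //; rewrite ef.
- move=> -> -> ->; rewrite validSE => -[_ _ h] -> -> ->; rewrite validSE => -[h' _ _] -> ->.
  rewrite validSE; apply: valid_low => // g ls /mcode_inv.
  case: g => [||i|f gs|f g|f] //; try by case.
  case=> _ ef el; constructor; first by apply: h' => //=; rewrite el.
  by apply: h => //; rewrite ef.
- move=> -> -> ->; rewrite validSE; apply: valid_list => -[|g gs] ls // _ _.
  by exists [::] => //; constructor.
- move=> -> ->; rewrite validSE => -[h _ _] -> -> ->; rewrite validSE => -[_ h' _] -> -> -> -> ->.
  rewrite validSE; apply: valid_list => -[|g gs] ls //= [/cpair_inj [eg egs]] el.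
  have [ys ey M] := h' _ _ (congr1 _ egs) el.
  by exists (tau 3 :: ys); [rewrite /= ey | constructor; [exact: h | ]].
Qed.

Lemma lsem_conj r g s :
  lsem r (foldr LAnd g (map clause_tr s)) <->
  (forall c, List.In c s -> lsem r (clause_tr c)) /\ lsem r g.
Proof.
elim: s => [|c s IH] /=; first by split=> [h|[]].
rewrite IH; split=> [[h1 [h2 h3]]|[h1 h2]]; first by split=> // d [<-|/h2].
by split; [apply: h1; left | split=> // d hd; apply: h1; right].
Qed.

Lemma horn_formP r hc : lsem r (horn_form hc) <->
  [/\ lsem r pair_zero_clause, lsem r pair_succ_clause,
      forall c, List.In c rules -> lsem r (clause_tr c) & lsem r (clause_tr (rule_goal hc))].
Proof.
have E f g : lsem r (LAnd f g) <-> lsem r f /\ lsem r g by [].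
rewrite /horn_form E E lsem_conj; split=> [[h1 [h2 [h3 h4]]]|[h1 h2 h3 h4]] //.
Qed.

Lemma rules_ok_In c : List.In c rules -> clause_ok nNodes c.
Proof.
have := rules_ok; elim: rules => //= d s IH /andP [hd /IH h] [<-|] //.
Qed.

Definition valid_fact t : nat := `[< validS t >].

Lemma horn_form_up h N r tau : ~ meval h [:: N] 1 -> r 0 = 1 -> r 1 = N ->
  node_view nNodes r tau cfst csnd valid_fact -> lsem r (horn_form (mcode h)).
Proof.
move=> nh r0 r1 V.
have P c : clause_ok nNodes c -> lsem r (clause_tr c) <-> clause_sem N validS tau c.1 c.2.
  apply: (clause_trP r0 r1 V) => // k _; rewrite /valid_fact.
  by split=> [|/asboolP ->] //; case: asboolP.
have [t0 l0 s0 _] := V 0 isT; have [t1 l1 s1 _] := V 1 isT.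
apply/horn_formP; split; first by rewrite /= t0 l0 s0 => ->.
-   rewrite /= t0 t1 l0 s0 l1 s1 r0 addn1 => ->; rewrite /cfst /csnd /unpair iterS /unpair_step.
  by case: (iter _ _ _) => [[|a] b] /=; rewrite ?addn1.
- by move=> c hc; apply/P; [exact: rules_ok_In | exact: validS_closed].
apply/P => //=; rewrite addn1 addn0 => -> -> ->; rewrite validSE => -[M _ _].
by apply: nh; exact: M.
Qed.

(** The tables are arbitrary, but the pairing clauses fix the first two below T, and closure puts
    every fact with a derivation below T into the third, among them the forbidden one. *)
Lemma horn_form_down h N : meval h [:: N] 1 -> exists N0, forall T (L R S : nat -> nat),
  N0 <= T -> (forall tau, (forall k, k < nNodes -> tau k < T) ->
    exists r, [/\ r 0 = 1, r 1 = N, node_view nNodes r tau L R S & lsem r (horn_form (mcode h))]) ->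
  False.
Proof.
move=> M; have [N0 hN0] := proj1 meval_fact_bounded _ _ _ M.
pose s := [:: cpair N 0; cpair (cpair N 0).+1 1; fact (mcode h) (cpair N 0).+1 1].
exists ((sumn s).+1 + N0) => T L R S hT H.
(* The induction step uses two nodes, at the positions t and t + 1. *)
have LR t : t < T -> L t = cfst t /\ R t = csnd t.
  elim: t => [|t IH] tT.
    have [r [r0 r1 V /horn_formP [h1 _ _ _]]] := H (fun _ => 0) (fun _ _ => tT).
    have [t0 l0 s0 _] := V 0 isT; move: h1; rewrite /= t0 l0 s0.
    by move=> /(_ erefl) [-> ->].
  have tT' := ltnW tT; have [IL IR] := IH tT'.
  have [|r [r0 r1 V /horn_formP [_ h1 _ _]]] := H (fun k => if k == 0 then t else t.+1).
    by move=> k _; case: ifP.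
  have [t0 l0 s0 _] := V 0 isT; have [t1 l1 s1 _] := V 1 isT.
  move: h1; rewrite /= t0 t1 l0 s0 l1 s1 /= r0 addn1 => /(_ erefl).
  rewrite IL IR /cfst /csnd /unpair iterS /unpair_step.
  by case: (iter _ _ _) => [[|a] b] /= [h1 h2]; [have [] := h1 erefl | have [] := h2 isT]; lia.
have P r tau c : (forall k, k < nNodes -> tau k < T) -> r 0 = 1 -> r 1 = N ->
    node_view nNodes r tau L R S -> clause_ok nNodes c ->
    lsem r (clause_tr c) <-> clause_sem N (fun t => S t = 1) tau c.1 c.2.
  move=> hT' r0 r1 V; apply: (clause_trP r0 r1 V) => // k km.
    by case: (LR _ (hT' k km)).
  by case: (LR _ (hT' k km)).
have cl : closed_below N T (fun t => S t = 1).
  move=> c hc tau htau; have [r [r0 r1 V /horn_formP [_ _ h1 _]]] := H tau htau.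
  by apply/(P r tau c htau r0 r1 V (rules_ok_In hc)); exact: h1.
have hs k : k < nNodes -> nth 0 s k < T by move=> _; apply: nth_lt_sumn; lia.
have [r [r0 r1 V /horn_formP [_ _ _ g]]] := H (nth 0 s) hs.
have gok : clause_ok nNodes (rule_goal (mcode h)) by [].
move/(P r _ _ hs r0 r1 V gok): g; rewrite /= addn1 addn0; apply=> //.
by apply: (hN0 N T _ _ cl); lia.
Qed.

(** * The diagonal sentence *)

Lemma meval_functional g l y y' : meval g l y -> meval g l y' -> y = y'.
Proof.
move=> M; move: y'; move: g l y M.
apply: (@meval_mut (fun g l y => forall y', meval g l y' -> y = y')
  (fun gs l ys => forall ys', meval_list gs l ys' -> ys = ys')).
- by move=> l y' M; inversion M.
- by move=> x l y' M; inversion M.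
- by move=> i l y' M; inversion M.
- move=> f gs l ys y IH1 IH2 y' M; inversion M; subst.
  match goal with H : meval_list gs l _ |- _ => by apply: IH2; rewrite (IH1 _ H) end.
- by move=> f g l y IH y' M; inversion M; subst; exact: IH.
- move=> f g n l r y IH1 IH2 y' M; inversion M; subst.
  match goal with H : meval _ (n :: l) _ |- _ => by apply: IH2; rewrite (IH1 _ H) end.
- move=> f l n IH1 IH2 y' M; inversion M; subst.
  case: (ltngtP n y') => // lt.
    match goal with H : forall m : nat, _ |- _ => by have [k /IH1] := H n lt end.
  match goal with H : meval f (y' :: l) 0 |- _ => by have [k /(_ _ H)] := IH2 y' lt end.
- by move=> l ys' M; inversion M.
- move=> g gs l y ys IH1 IH2 ys' M; inversion M; subst.
  match goal with H : meval g l _, H' : meval_list gs l _ |- _ => by rewrite (IH1 _ H) (IH2 _ H') end.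
Qed.

(** * Programs that compute codes of sentences, and injectivity of codes *)

Fixpoint mconst c := if c is c'.+1 then MComp MSucc [:: mconst c'] else MZero.
Definition madd := MPrim (MProj 0) (MComp MSucc [:: MProj 1]).
Definition mtriangle := MPrim MZero (MComp MSucc [:: MComp madd [:: MProj 0; MProj 1]]).
Definition mpair f g := MComp (MComp madd [:: MComp mtriangle [:: madd]; MProj 1]) [:: f; g].

Lemma meval_comp1 f g l x y : meval g l x -> meval f [:: x] y -> meval (MComp f [:: g]) l y.
Proof. by move=> hg; apply: ev_comp; apply: evl_cons hg (evl_nil _). Qed.

Lemma meval_comp2 f g1 g2 l x1 x2 y : meval g1 l x1 -> meval g2 l x2 -> meval f [:: x1; x2] y ->
  meval (MComp f [:: g1; g2]) l y.
Proof.
by move=> h1 h2; apply: ev_comp; apply: evl_cons h1 _; apply: evl_cons h2 (evl_nil _).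
Qed.

Lemma meval_const c l : meval (mconst c) l c.
Proof.
elim: c => [|c IH] /=; first exact: ev_zero.
by apply: meval_comp1 IH _; exact: ev_succ.
Qed.

Lemma meval_add x y : meval madd [:: x; y] (x + y).
Proof.
elim: x => [|x IH]; first exact: ev_prim0 (ev_proj 0 [:: y]).
apply: ev_primS IH _; apply: meval_comp1 (ev_proj 1 _) _; exact: ev_succ.
Qed.

Lemma meval_triangle n : meval mtriangle [:: n] (triangle n).
Proof.
elim: n => [|n IH]; first by apply: ev_prim0; exact: ev_zero.
apply: ev_primS IH _; rewrite triangleS addnS addnC.
apply: meval_comp1 (ev_succ _ _).
exact: meval_comp2 (ev_proj 0 _) (ev_proj 1 _) (meval_add _ _).
Qed.

Lemma meval_pair f g l x y : meval f l x -> meval g l y -> meval (mpair f g) l (cpair x y).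
Proof.
move=> hf hg; apply: meval_comp2 hf hg _; rewrite cpairE.
apply: meval_comp2 (ev_proj 1 [:: x; y]) _; last exact: meval_add.
exact: meval_comp1 (meval_add _ _) (meval_triangle _).
Qed.

(** A numeral is an iterated sum of variable 0; 6 and 8 are the tags of [GZero] and [GAdd]. *)
Definition mnumeral := MPrim (mconst (cpair 6 0))
  (mpair (mconst 8) (mpair (MProj 1) (mconst (tcode (Var SG 0))))).

Lemma meval_numeral n : meval mnumeral [:: n] (tcode (lg (lconst n))).
Proof.
elim: n => [|n IH]; first by apply: ev_prim0; exact: meval_const.
apply: ev_primS IH _; apply: meval_pair (meval_const _ _) _.
exact: meval_pair (ev_proj 1 _) (meval_const _ _).
Qed.

Fixpoint mblock (t : nat) s i n g :=
  if n is n'.+1 then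
    mpair (mconst t) (mpair (mconst (sort_code s)) (mpair (mconst i) (mblock t s i.+1 n' g)))
  else g.

Lemma meval_exB s i n g l f : meval g l (fcode f) -> meval (mblock 6 s i n g) l (fcode (exB s i n f)).
Proof.
move=> hg; elim: n i => [//|n IH] i.
exact: meval_pair (meval_const 6 _) (meval_pair (meval_const (sort_code s) _)
  (meval_pair (meval_const i _) (IH i.+1))).
Qed.

Lemma meval_allB s i n g l f : meval g l (fcode f) -> meval (mblock 7 s i n g) l (fcode (allB s i n f)).
Proof.
move=> hg; elim: n i => [//|n IH] i.
exact: meval_pair (meval_const 7 _) (meval_pair (meval_const (sort_code s) _)
  (meval_pair (meval_const i _) (IH i.+1))).
Qed.

(** Dependent pairs are needed because the sorts of the two terms are not known to agree
    beforehand. *)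
Lemma tcode_inj s (t : term s) s' (t' : term s') : tcode t = tcode t' ->
  existT term s t = existT term s' t'.
Proof.
have dec : forall x y : sort, {x = y} + {x <> y} by decide equality.
have inj s0 (a b : term s0) : existT term s0 a = existT term s0 b -> a = b.
  exact: (inj_pair2_eq_dec _ dec).
elim: t s' t' => [s0 n||| a IHa b IHb | a IHa b IHb | a IHa ||| a IHa b IHb | a IHa |||
  a IHa b IHb | a IHa b IHb | a IHa] s' [s1 n'||| a' b' | a' b' | a' ||| a' b' | a' |||
  a' b' | a' b' | a'] //= /cpair_inj [] // _; try move=> /cpair_inj [].
- by case: s0 s1 => [] [] // _ ->.
- by move=> /IHa/inj -> /IHb/inj ->.
- by move=> /IHa/inj -> /IHb/inj ->.
- by move=> /IHa/inj ->.
- by move=> /IHa/inj -> /IHb/inj ->.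
- by move=> /IHa/inj ->.
- by move=> /IHa/inj -> /IHb/inj ->.
- by move=> /IHa/inj -> /IHb/inj ->.
- by move=> /IHa/inj ->.
Qed.

Lemma fcode_inj f f' : fcode f = fcode f' -> f = f'.
Proof.
have dec : forall x y : sort, {x = y} + {x <> y} by decide equality.
have inj s0 (a b : term s0) : existT term s0 a = existT term s0 b -> a = b.
  exact: (inj_pair2_eq_dec _ dec).
have sinj s s' : sort_code s = sort_code s' -> s = s' by case: s s' => [] [].
elim: f f' => [s a b|a b|g IHg|g IHg h IHh|g IHg h IHh|g IHg h IHh|s n g IHg|s n g IHg]
  [s' a' b'|a' b'|g'|g' h'|g' h'|g' h'|s' n' g'|s' n' g'] //= /cpair_inj [] // _;
  try move=> /cpair_inj [].
- move=> /sinj ss /cpair_inj [ea eb]; move: a b ea eb; rewrite ss => a b.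
  by move=> /tcode_inj/inj -> /tcode_inj/inj ->.
- by move=> /tcode_inj/inj -> /tcode_inj/inj ->.
- by move=> /IHg ->.
- by move=> /IHg -> /IHh ->.
- by move=> /IHg -> /IHh ->.
- by move=> /IHg -> /IHh ->.
- by move=> /sinj -> /cpair_inj [-> /IHg ->].
- by move=> /sinj -> /cpair_inj [-> /IHg ->].
Qed.

(** * Diagonalization against a decision procedure *)

Section Diagonal.
Variables (p : nat) (pr : prime p).

Definition halting_form h := LAnd inj_clause (horn_form (mcode h)).
Definition halting_body h :=
  coded_body p nExist (nTotal nNodes) (exist_atoms p) (all_node_atoms nNodes) (halting_form h).
Definition halting_sentence h N :=
  coded_sentence p nExist (nTotal nNodes) (exist_atoms p) (all_node_atoms nNodes)
    (halting_form h) N.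

Lemma nExist_gt2 : 2 < nExist. Proof. by []. Qed.
Lemma nNodes_gt1 : 1 < nNodes. Proof. by []. Qed.
Lemma nExist_le : nExist <= nTotal nNodes. Proof. by []. Qed.

Lemma halting_form_ok h : lform_ok (nTotal nNodes) (halting_form h).
Proof.
have := horn_form_ok (mcode h); rewrite /halting_form; move: (horn_form _) => f hf.
by change (lform_ok (nTotal nNodes) inj_clause && lform_ok (nTotal nNodes) f); rewrite hf.
Qed.

Lemma halting_sentence_closed h N : sentence (halting_sentence h N).
Proof.
exact: (coded_sentence_closed p nExist_gt2 nExist_le (exist_atoms_ok p) (all_node_atoms_ok nNodes)
  (halting_form_ok h)).
Qed.

Lemma halting_sentence_EA h N : is_EA (halting_sentence h N).
Proof. exact: coded_sentence_EA. Qed.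

(** Circularity is avoided by letting N be the code of the body, which does not depend on N; the
    code of the whole sentence is then a computable function of N. *)
Definition mdiagonal :=
  let m := nTotal nNodes in let kE := exK_count (exist_atoms p) in
  mblock 6 SG 0 nExist (mblock 6 SK 0 kE
    (mblock 7 SG nExist (m.+1 - nExist) (mblock 7 SK kE (allK_count (all_node_atoms nNodes))
      (mpair (mconst 3) (mpair
        (mpair (mconst 0) (mpair (mconst 1) (mpair (mconst (tcode (Var SG 1))) mnumeral)))
        (MProj 0)))))).

Lemma meval_diagonal h :
  meval mdiagonal [:: fcode (halting_body h)]
    (fcode (halting_sentence h (fcode (halting_body h)))).
Proof.
rewrite /mdiagonal /halting_sentence /coded_sentence /prefix.
do 2!apply: meval_exB; do 2!apply: meval_allB.
apply: meval_pair (meval_const _ _) _.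
apply: meval_pair _ (ev_proj 0 _).
apply: meval_pair (meval_const _ _) (meval_pair (meval_const _ _) _).
exact: meval_pair (meval_const _ _) (meval_numeral _).
Qed.

Lemma halting_sentence_false h N : meval h [:: N] 1 ->
  exists E0, forall (P : VField) (sec : int -> VK P) (E : nat), is_padic_field p P ->
    cross_section sec -> Vv (p%:R : VK P)%R = Some (Posz E) -> E0 <= E ->
    ~ models sec (halting_sentence h N).
Proof.
move=> M; have [N0 hN0] := horn_form_down M.
exists (window_bound p N0 + 4 * p ^ 3).+1 => P sec E hP hs vp hE mod.
have [r hr] : exists r, solution p nExist (nTotal nNodes) (exist_atoms p)
    (all_node_atoms nNodes) (halting_form h) E N r.
  have Epos : 0 < E by lia.
  have Ebig : 4 * p ^ 3 <= E by lia.
  exact: (models_solution nExist_gt2 nExist_le (exist_atoms_ok p) (all_node_atoms_ok nNodes)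
    (halting_form_ok h) pr hP hs vp Epos mod Ebig).
have [|T [L [R [S [hT H]]]]] := solution_tables pr nNodes_gt1 hr (N0 := N0); first by lia.
exact: (hN0 T L R S hT H).
Qed.

Lemma halting_sentence_true h N : ~ meval h [:: N] 1 ->
  forall (P : VField) (sec : int -> VK P), is_padic_field p P -> cross_section sec ->
    models sec (halting_sentence h N).
Proof.
move=> nM P sec hP hs.
have [E [E0 vE]] : exists E : nat, 0 < E /\ Vv (p%:R : VK P)%R = Some (Posz E).
  have [_ [_ [_ [_ [_ [_ [_ [_ [_ [_ [_ [_ [[e [e0 ->]] _]]]]]]]]]]]]] := hP.
  by exists `|e|; split; [lia | congr Some; lia].
apply: (solution_models nExist_gt2 nExist_le (exist_atoms_ok p) (all_node_atoms_ok nNodes)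
  (halting_form_ok h) pr hP hs vE E0).
apply: (tables_solution pr nNodes_gt1 (L := cfst) (R := csnd) (S := valid_fact)).
- exact: cfst_le.
- exact: csnd_le.
- by move=> t; rewrite /valid_fact; case: `[< _ >].
- by move=> r tau r0 r1 V; exact: (horn_form_up nM r0 r1 V).
Qed.

(** Any set between the EA-sentences true in all p-adic fields and the asymptotic theory is treated
    at once, which covers both claims. *)
Lemma undecidable_between (C : forall P : VField, int -> VK P) (Th : formula -> Prop) :
  (forall P, is_padic_field p P -> cross_section (C P)) ->
  (forall f, Th f -> asymptotic_theory p C f) ->
  (forall f, sentence f -> is_EA f ->
     (forall P, is_padic_field p P -> models (C P) f) -> Th f) ->
  ~ decidable_theory Th.
Proof.
move=> hC sub sup [f hf].
(* On the code N of the body, h returns the verdict of f on the sentence about h and N. *)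
pose h := MComp f [:: mdiagonal].
have := meval_diagonal h; have := halting_sentence_closed h (fcode (halting_body h)).
have := halting_sentence_EA h (fcode (halting_body h)).
have := @halting_sentence_true h (fcode (halting_body h)).
have := @halting_sentence_false h (fcode (halting_body h)).
move: (halting_sentence h (fcode (halting_body h))) => sigma.
move: (fcode (halting_body h)) => N hfalse htrue ea cl D.
have run y : meval f [:: fcode sigma] y -> meval h [:: N] y by exact: meval_comp1.
have [yes no] := hf (fcode sigma).
have thE : (exists g, fcode g = fcode sigma /\ Th g) <-> Th sigma.
  by split=> [[g [/fcode_inj <-]]|t]; [| exists sigma].
have F : meval h [:: N] 1 -> ~ Th sigma.
  move=> /hfalse [E0 H] t; have [_ [n [E hE]]] := sub _ t.
  (* The field must have large v(p) and also avoid the finitely many exceptions allowed by the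
     asymptotic theory. *)
  have [e [le_e av]] := eis_field_avoid pr n E0 (fun i => VK (E i)).
  have hP := eis_padic pr e.
  by apply: (H _ _ e.+1 hP (hC _ hP) (eis_val_p pr e) (ltnW _) (hE _ hP av)).
have nM : ~ meval h [:: N] 1.
  (* If h(N) = 1, the sentence is outside [Th], so f answers 0, against functionality. With h(N) <>
     1 established, the sentence holds everywhere and f answers 1, a contradiction again. *)
  move=> M; have nt := F M; have M0 := run _ (no (fun x => nt (proj1 thE x))).
  by have := meval_functional M M0.
apply: (nM); apply/run/yes/thE; apply: sup => // P hP.
exact: (htrue nM _ _ hP (hC _ hP)).
Qed.

End Diagonal.

Theorem mainTheorem1 (p : nat) (hp : prime p)
    (C : forall P : VField, int -> VK P)
    (hC : forall P : VField, is_padic_field p P -> cross_section (C P)) :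
  ~ decidable_theory (asymptotic_EA_theory p C) /\
  ~ decidable_theory (asymptotic_theory p C).
Proof.
split; apply: (undecidable_between hp hC).
- by move=> f [].
- by move=> f cl ea H; split=> //; split=> //; exists 0, (fun _ => eis_vfield hp 0) => P hP _; exact: H.
- by [].
- by move=> f cl _ H; split=> //; exists 0, (fun _ => eis_vfield hp 0) => P hP _; exact: H.
Qed.
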